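(* Let $s\ge0$, let $\boldsymbol f^-(T)\in\mathbf{W}_s(T^{-1}\mathcal{O}_{K_s}[T^{-1}])$, and let $\overline{\boldsymbol f^-}(t)\in\mathbf{W}_s(t^{-1}k_s[t^{-1}])$ be its reduction. Then: (3) If $\widetilde{\boldsymbol f}^-(T)\in\mathbf{W}_s(T^{-1}\mathcal{O}_{K_s}[T^{-1}])$ is another lifting of $\overline{\boldsymbol f^-}(t)$, then $$\frac{\mathrm{e}_{p^s}(\boldsymbol f^-(T),1)}{\mathrm{e}_{p^s}(\widetilde{\boldsymbol f}^-(T),1)}=\mathrm{e}_{p^s}(\boldsymbol f^-(T)-\widetilde{\boldsymbol f}^-(T),1)$$ is convergent for $|T|>1-\varepsilon$ for some $\varepsilon>0$ (i.e. lies in $\mathcal{R}_{K_s}$). (4) If $\boldsymbol f^-_{(\bar{\mathrm F})}(T)\in\mathbf{W}_s(T^{-1}\mathcal{O}_{K_s}[T^{-1}])$ is an arbitrary lifting of $\bar{\mathrm F}(\overline{\boldsymbol f^-}(t))$, then $$\frac{\mathrm{e}_{p^s}(\boldsymbol f^-_{(\bar{\mathrm F})}(T),1)}{\mathrm{e}_{p^s}(\boldsymbol f^-(T),1)}=\mathrm{e}_{p^s}(\boldsymbol f^-_{(\bar{\mathrm F})}(T)-\boldsymbol f^-(T),1)$$ is convergent for $|T|>1-\varepsilon'$ for some $\varepsilon'>0$ (i.e. lies in $\mathcal{R}_{K_s}$). (5) Conversely, the function $\mathrm{e}_{p^s}(\boldsymbol f^-(T),1)$ lies in $\mathcal{R}_{K_s}$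 if and only if the equation $\bar{\mathrm F}(\bar{\boldsymbol\nu}^-)-\bar{\boldsymbol\nu}^-=\overline{\boldsymbol f^-}(t)$ has a solution $\bar{\boldsymbol\nu}^-\in\mathbf{W}_s(t^{-1}k_s[t^{-1}])$.
   Context: $p$ is a prime, $(K,|.|)$ a complete ultrametric field containing $(\mathbb{Q}_p,|.|)$. $\mathcal{A}_K(I)=\{\sum_{i\in\mathbb{Z}}a_iT^i: a_i\in K,\ \sup_i|a_i|\rho^i<\infty\ \forall\rho\in I\}$, $\mathcal{R}_K=\bigcup_{\varepsilon>0}\mathcal{A}_K(]1-\varepsilon,1[)$ (Robba ring), and $\mathcal{R}_H=\mathcal{R}_K\otimes_KH$ for $H/K$ algebraic; $\mathcal{O}_H$ is the ring of integers of $H$. Fix a Lubin-Tate series $P$ for the uniformizer $p$: $P(X)\in\mathbb{Z}_p[[X]]$, $P\equiv pX\pmod{X^2}$, $P\equiv X^p\pmod p$, and a generator $(\pi_j)_{j\ge0}$ of its Tate module: $\pi_j\in\mathbb{Q}_p^{\mathrm{alg}}$, $|\pi_j|<1$, $P(\pi_0)=0$, $\pi_0\ne0$, $P(\pi_{j+1})=\pi_j$. Put $K_s=K(\pi_s)$, with residue field $k_s$. $\mathbf{W}_s(R)=\mathbf{W}(R)/\mathrm{V}^{s+1}\mathbf{W}(R)$ (vectors with $s+1$ entries), and $T^{-1}\mathcal{O}[T^{-1}]$, $t^{-1}k[t^{-1}]$ are considered as rings without unit. In characteristic $p$, $\bar{\mathrm F}(r_0,\ldots,r_s)=(r_0^p,\ldots,r_s^p)$.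 For $\boldsymbol f^-(T)=(f_0^-(T),\ldots,f_s^-(T))$ with phantom components $\phi_j^-(T)=\sum_{i=0}^jp^if_i^-(T)^{p^{j-i}}$ set $$\mathrm{e}_{p^s}(\boldsymbol f^-(T),1)=\exp\Bigl(\pi_s\phi_0^-(T)+\pi_{s-1}\frac{\phi_1^-(T)}{p}+\cdots+\pi_0\frac{\phi_s^-(T)}{p^s}\Bigr)\in1+\pi_sT^{-1}\mathcal{O}_{K_s}[[T^{-1}]].$$ *)

(* Defs.v *)
From HB Require Import structures.
From mathcomp Require Import all_boot all_order all_algebra.
From mathcomp Require Import reals.
From mathcomp Require Import mpoly.

Set Implicit Arguments.
Unset Strict Implicit.
Unset Printing Implicit Defensive.

Import Order.TTheory GRing.Theory Num.Theory.
Local Open Scope ring_scope.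

Record ultrametric_abs (R : realType) (F : fieldType) (v : F -> R) : Prop := {
  uabs_ge0 : forall x, 0 <= v x;
  uabs_eq0 : forall x, v x = 0 <-> x = 0;
  uabsM : forall x y, v (x * y) = v x * v y;
  uabsD : forall x y, v (x + y) <= Num.max (v x) (v y) }.

Definition abs_cvg (R : realType) (F : fieldType) (v : F -> R)
    (u : nat -> F) (l : F) : Prop :=
  forall e : R, 0 < e ->
    exists N : nat, forall n, (N <= n)%N -> v (u n - l) < e.

Definition abs_cauchy (R : realType) (F : fieldType) (v : F -> R)
    (u : nat -> F) : Prop :=
  forall e : R, 0 < e ->
    exists N : nat, forall m n, (N <= m)%N -> (N <= n)%N -> v (u m - u n) < e.

Definition abs_complete (R : realType) (F : fieldType) (v : F -> R) : Prop :=
  forall u, abs_cauchy v u -> exists l, abs_cvg v u l.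

(* (Qp, v) is a completion of the rationals for the p-adic absolute value
   normalized by |p| = 1/p; this determines (Qp, v) up to a unique isometric
   isomorphism. *)
Record is_padic_field (R : realType) (p : nat) (Qp : fieldType) (v : Qp -> R)
    : Prop := {
  padic_abs : ultrametric_abs v;
  padic_p : v p%:R = p%:R^-1;
  padic_complete : abs_complete v;
  padic_dense : forall (x : Qp) (e : R), 0 < e ->
    exists q : rat, v (x - ratr q) < e }.

(* Lubin-Tate series for the uniformizer p; the power series \sum_n P_n X^n is
   given by its sequence of coefficients. *)
Record lubin_tate_series (R : realType) (p : nat) (Qp : fieldType)
    (v : Qp -> R) (P : nat -> Qp) : Prop := {
  lt_int : forall n, v (P n) <= 1;
  lt_coef0 : P 0%N = 0;
  lt_coef1 : P 1%N = p%:R;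
  lt_modp : forall n, exists2 z : Qp, v z <= 1 & P n - (n == p)%:R = p%:R * z }.

(* y is the sum of the convergent series \sum_n P_n x^n. *)
Definition pseries_at (R : realType) (F : fieldType) (v : F -> R)
    (P : nat -> F) (x y : F) : Prop :=
  abs_cvg v (fun n => \sum_(i < n) P i * x ^+ i) y.

(* A generator of the Tate module of P, with values in a field L containing
   Qp through iota. *)
Record tate_generator (R : realType) (Qp L : fieldType) (v : L -> R)
    (iota : Qp -> L) (P : nat -> Qp) (pi : nat -> L) : Prop := {
  tate_alg : forall j, algebraicOver iota (pi j);
  tate_lt1 : forall j, v (pi j) < 1;
  tate_neq0 : pi 0%N != 0;
  tate_root : pseries_at v (iota \o P) (pi 0%N) 0;
  tate_step : forall j, pseries_at v (iota \o P) (pi j.+1) (pi j) }.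

(* The subfield K(x) of L, for K contained in L through iota. *)
Definition adjoin (K L : fieldType) (iota : {rmorphism K -> L}) (x : L)
    : L -> Prop :=
  fun y => exists q r : {poly K},
    (map_poly iota r).[x] != 0 /\
    y = (map_poly iota q).[x] / (map_poly iota r).[x].

Definition integers (R : realType) (L : fieldType) (v : L -> R)
    (H : L -> Prop) : L -> Prop :=
  fun x => H x /\ v x <= 1.

(* k is the residue field of the subfield H of L, with reduction map red; the
   values of red outside the ring of integers are irrelevant. *)
Record residue_field (R : realType) (L : fieldType) (v : L -> R)
    (H : L -> Prop) (k : fieldType) (red : L -> k) : Prop := {
  red1 : red 1 = 1;
  redD : forall x y, integers v H x -> integers v H y ->
    red (x + y) = red x + red y;
  redM : forall x y, integers v H x -> integers v H y ->
    red (x * y) = red x * red y;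
  red_surj : forall c, exists2 x, integers v H x & red x = c;
  red_ker : forall x, integers v H x -> (red x = 0 <-> v x < 1) }.

Definition witt_phantom (A : comNzRingType) (p s : nat) (a : {ffun 'I_s.+1 -> A})
    (j : nat) : A :=
  \sum_(i < s.+1 | (i <= j)%N) (a i ^+ (p ^ (j - i))) *+ (p ^ i).

(* The first n universal polynomials S_0, S_1, ... of Witt vector subtraction.
   They are computed over the rationals by solving
     \sum_(i <= j) p^i S_i^(p^(j-i)) = witt_phantom_j(X) - witt_phantom_j(Y)
   for S_j, where X_i = 'X_(lshift _ i) and Y_i = 'X_(rshift _ i). By Witt's
   theorem their coefficients are integers. *)
Fixpoint witt_sub_polys (p s n : nat) : seq {mpoly rat[s.+1 + s.+1]} :=
  if n is j.+1 then
    let S := witt_sub_polys p s j in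
    rcons S ((p ^ j)%:R^-1 *:
      (witt_phantom p [ffun i : 'I_s.+1 => 'X_(lshift s.+1 i)] j
       - witt_phantom p [ffun i : 'I_s.+1 => 'X_(rshift s.+1 i)] j
       - \sum_(i < j) (S`_i ^+ (p ^ (j - i))) *+ (p ^ i)))
  else [::].

(* The polynomials above have integer coefficients, so applying numq to the
   coefficients allows evaluation in any commutative ring. *)
Definition witt_sub (A : comNzRingType) (p s : nat)
    (a b : {ffun 'I_s.+1 -> A}) : {ffun 'I_s.+1 -> A} :=
  [ffun j : 'I_s.+1 =>
    mmap (fun c : rat => (numq c)%:~R : A)
         (fun i : 'I_(s.+1 + s.+1) =>
            match split i with inl l => a l | inr r => b r end)
         (witt_sub_polys p s s.+1)`_j].

(* Polynomials in T^-1 are represented in {poly _}, whose variable 'X stands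
   for T^-1; in_neg S is the set T^-1 S[T^-1] of those without constant term
   and with coefficients in S. It is stable under the operations of {poly _},
   so the Witt vectors over this ring without unit are those over {poly _}
   with all their components in it. *)
Definition in_neg (F : fieldType) (S : F -> Prop) (f : {poly F}) : Prop :=
  f`_0 = 0 /\ forall i, S f`_i.

Definition witt_in (A : Type) (s : nat) (S : A -> Prop)
    (a : {ffun 'I_s.+1 -> A}) : Prop := forall i, S (a i).

Definition witt_red (L k : fieldType) (red : L -> k) (s : nat)
    (f : {ffun 'I_s.+1 -> {poly L}}) : {ffun 'I_s.+1 -> {poly k}} :=
  [ffun i => map_poly red (f i)].

Definition witt_frob (A : comNzRingType) (p s : nat)
    (a : {ffun 'I_s.+1 -> A}) : {ffun 'I_s.+1 -> A} :=
  [ffun i => a i ^+ p].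

(* Power series in T^-1 are given by their sequence of coefficients. *)

(* exp(g) for a polynomial g without constant term: the powers g^m with m > n
   do not contribute to the coefficient of index n. *)
Definition exp_series (F : fieldType) (g : {poly F}) (n : nat) : F :=
  \sum_(m < n.+1) (g ^+ m)`_n / m`!%:R.

(* c = a / b, for a power series b with nonzero constant term. *)
Definition is_series_quotient (F : fieldType) (a b c : nat -> F) : Prop :=
  b 0%N != 0 /\ forall n, \sum_(i < n.+1) c i * b (n - i)%N = a n.

(* The coefficients of e_{p^s}(f, 1). *)
Definition artin_hasse_exp (F : fieldType) (p s : nat) (pi : nat -> F)
    (f : {ffun 'I_s.+1 -> {poly F}}) : nat -> F :=
  exp_series (\sum_(j < s.+1) (pi (s - j)%N / (p ^ j)%:R) *: witt_phantom p f j).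

(* Laurent series \sum_(i : int) a_i T^i are given by their coefficients. *)

Definition laurent_neg (F : fieldType) (c : nat -> F) (i : int) : F :=
  if i <= 0 then c `|i|%N else 0.

(* The ring A_H(I) of series with coefficients in the subfield H of F. *)
Definition analytic_on (R : realType) (F : fieldType) (v : F -> R)
    (H : F -> Prop) (I : interval R) (a : int -> F) : Prop :=
  (forall i, H (a i)) /\
  forall rho : R, rho \in I -> exists M : R, forall i, v (a i) * rho ^ i <= M.

Definition in_robba (R : realType) (K : fieldType) (v : K -> R)
    (a : int -> K) : Prop :=
  exists2 e : R, 0 < e & analytic_on v (fun=> True) `]1 - e, 1[ a.

(* The Robba ring R_H, for K <= H <= L with K complete and H algebraic over K:
   R_K (x)_K H, identified with its image \sum_j R_K h_j in the series with
   coefficients in H. *)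
Definition in_robba_ext (R : realType) (K L : fieldType) (v : K -> R)
    (iota : {rmorphism K -> L}) (H : L -> Prop) (a : int -> L) : Prop :=
  exists (n : nat) (f : 'I_n -> int -> K) (h : 'I_n -> L),
    [/\ forall j, in_robba v (f j), forall j, H (h j)
      & forall i, a i = \sum_(j < n) iota (f j i) * h j].

(* Main.v *)
(** Idea. The pairing of a Witt vector f with (pi_s, ..., pi_0) splits as a sum of
   logarithms, so e(f, 1) is the product of the E_(s-i)(f_i), where
   E_m(X) = exp(pi_m X + pi_(m-1) X^p/p + ... + pi_0 X^(p^m)/p^m).
   By Dwork's lemma for the Frobenius lift Z |-> P(Z), the sequence
   (pi_m, ..., pi_0, 0, ...) is the ghost of an integral Witt vector, so that E_m
   is a product of Artin-Hasse exponentials and has integral coefficients; hence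
   e(f, 1) is overconvergent as soon as f reduces to 0, which gives (3).
   Since p Z - P(Z) = Z k(Z) with k(0) = 0, the same lemma writes E_m(X^p)/E_m(X) as
   exp(- p pi_(m+1) X) times a finite product of E_(m+1-i)(mu_i X^(p^i)) with
   |mu_i| < 1, so it is overconvergent, which gives (4) and half of (5).
   For the converse in (5), the p-th power of the exponential at level m+1 is, up to
   overconvergent factors, the exponential at level m, so by induction only the last
   component remains. There, if exp(pi_0 g) = 1 + pi_0 u is overconvergent then u
   reduces to a polynomial, and comparing (1 + pi_0 u)^p with exp(p pi_0 g) modulo
   p pi_0^2 gives u - u^p = g in the residue field, because pi_0^p = - p pi_0 modulo
   p pi_0^2. *)
Require Import Defs.
From HB Require Import structures.
From mathcomp Require Import all_boot all_order all_algebra.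
From mathcomp Require Import boolp reals mpoly ring lra zify.

Set Implicit Arguments.
Unset Strict Implicit.
Unset Printing Implicit Defensive.

Import Order.TTheory GRing.Theory Num.Theory.
Local Open Scope ring_scope.

(** * Ultrametric absolute values *)

(** Two obstacles shape the argument. The series P is infinite, while Dwork's lemma is run in Q_p[Z]
    with the substitution of a polynomial. So P is truncated, the lemma is applied to the
    truncation, and the resulting components are compared with those of the true sequence by a
    perturbation bound, whose precision pays for the divisions by p^j. Coefficients stay in Q_p
    because x^p = x modulo p holds for its integers, so that the substitution alone lifts Frobenius.
    In the residue field, of characteristic p, ghost components no longer determine a Witt vector.
    Identities between Witt differences are therefore proved on lifts to characteristic 0 and then
    reduced. Overconvergence is expressed by a bound M r^n, r < 1, on the coefficients. For series
    in T^-1 over K_s it amounts to membership in the Robba ring, because K(pi_s) is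
    finite-dimensional over the complete field K and coordinates in a basis are bounded by the
    absolute value. The same bound makes K_s closed, so that it contains every pi_j with j <= s. *)

Section UltrametricField.
Context (R : realType) (F : fieldType) (v : F -> R).
Hypothesis um : ultrametric_abs v.

Lemma uabs0 : v 0 = 0.
Proof. by apply/(uabs_eq0 um). Qed.

Lemma uabs_neq0 x : x != 0 -> 0 < v x.
Proof.
move=> x0; rewrite lt_def (uabs_ge0 um) andbT.
by apply: contra_neqN x0 => /eqP /(uabs_eq0 um).
Qed.

Lemma uabs1 : v 1 = 1.
Proof.
have n0 : v 1 != 0 by rewrite gt_eqF // uabs_neq0 // oner_neq0.
by apply: (mulfI n0); rewrite mulr1 -(uabsM um) mulr1.
Qed.

Lemma uabsN x : v (- x) = v x.
Proof.
have vN1 : v (-1) = 1.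
  have h : v (-1) ^+ 2 = 1 by rewrite expr2 -(uabsM um) mulrNN mulr1 uabs1.
  by apply/eqP; rewrite -(@pexpr_eq1 _ _ 2) ?(uabs_ge0 um) // h.
by rewrite -mulN1r (uabsM um) vN1 mul1r.
Qed.

Lemma uabsX x n : v (x ^+ n) = v x ^+ n.
Proof.
elim: n => [|n IH]; first by rewrite !expr0 uabs1.
by rewrite !exprS (uabsM um) IH.
Qed.

Lemma uabsV x : v x^-1 = (v x)^-1.
Proof.
have [->|x0] := eqVneq x 0; first by rewrite invr0 uabs0 invr0.
have vx0 : v x != 0 by rewrite gt_eqF // uabs_neq0.
by apply: (mulfI vx0); rewrite -(uabsM um) !divff // uabs1.
Qed.

Lemma uabsD_le B x y : v x <= B -> v y <= B -> v (x + y) <= B.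
Proof. by move=> hx hy; apply: (le_trans (uabsD um _ _)); rewrite ge_max hx. Qed.

Lemma uabsB_le B x y : v x <= B -> v y <= B -> v (x - y) <= B.
Proof. by move=> hx hy; apply: uabsD_le; rewrite ?uabsN. Qed.

Lemma uabsD_lt B x y : v x < B -> v y < B -> v (x + y) < B.
Proof. by move=> hx hy; apply: (le_lt_trans (uabsD um _ _)); rewrite gt_max hx. Qed.

Lemma uabsB_lt B x y : v x < B -> v y < B -> v (x - y) < B.
Proof. by move=> hx hy; apply: uabsD_lt; rewrite ?uabsN. Qed.

Lemma uabs_subC x y : v (x - y) = v (y - x).
Proof. by rewrite -opprB uabsN. Qed.

Lemma uabs_sum_le (I : Type) (r : seq I) (P : pred I) (E : I -> F) B :
  0 <= B -> (forall i, P i -> v (E i) <= B) -> v (\sum_(i <- r | P i) E i) <= B.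
Proof.
move=> B0 h; elim/big_ind: _ => //; first by rewrite uabs0.
exact: uabsD_le.
Qed.

Lemma uabs_nat n : v n%:R <= 1.
Proof.
elim: n => [|n IH]; first by rewrite uabs0 ler01.
by rewrite -natr1; apply: uabsD_le; rewrite ?uabs1.
Qed.

Lemma uabs_int (z : int) : v z%:~R <= 1.
Proof. by case: z => n; rewrite ?NegzE ?mulrNz ?uabsN; apply: uabs_nat. Qed.

Lemma uabsMle x y A B : v x <= A -> v y <= B -> v (x * y) <= A * B.
Proof. by move=> hx hy; rewrite (uabsM um) ler_pM ?(uabs_ge0 um). Qed.

Lemma uabsM_le1 x y B : v x <= 1 -> v y <= B -> v (x * y) <= B.
Proof. by move=> hx hy; rewrite -[B]mul1r uabsMle. Qed.

Lemma uabsMn_le x B n : v x <= B -> v (x *+ n) <= B.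
Proof. by move=> hx; rewrite -mulr_natl uabsM_le1 ?uabs_nat. Qed.

Lemma uabsX_le1 x n : v x <= 1 -> v (x ^+ n) <= 1.
Proof. by move=> hx; rewrite uabsX exprn_ile1 ?(uabs_ge0 um). Qed.

Lemma uabsX_leX x m n : (m <= n)%N -> v x <= 1 -> v (x ^+ n) <= v x ^+ m.
Proof. by move=> mn x1; rewrite uabsX ler_wiXn2l ?(uabs_ge0 um). Qed.

Lemma uabs_subX x y n :
  v x <= 1 -> v y <= 1 -> v (x ^+ n - y ^+ n) <= v (x - y).
Proof.
move=> hx hy; elim: n => [|n IH]; first by rewrite subrr uabs0 (uabs_ge0 um).
have -> : x ^+ n.+1 - y ^+ n.+1 = x ^+ n * (x - y) + (x ^+ n - y ^+ n) * y.
  by rewrite !exprSr; ring.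
apply: uabsD_le; first by apply: uabsM_le1; rewrite ?uabsX_le1.
by rewrite mulrC; apply: uabsM_le1.
Qed.

Lemma uabs_horner (g : {poly F}) x B :
  0 <= B -> (forall i, v g`_i <= B) -> v x <= 1 -> v g.[x] <= B.
Proof.
move=> B0 hg hx; rewrite horner_coef; apply: uabs_sum_le => // i _.
by rewrite mulrC; apply: uabsM_le1; rewrite ?uabsX_le1.
Qed.

Lemma uabs_horner_sub (g : {poly F}) x y :
  (forall i, v g`_i <= 1) -> v x <= 1 -> v y <= 1 ->
  v (g.[x] - g.[y]) <= v (x - y).
Proof.
move=> hg hx hy; rewrite !horner_coef -sumrB.
apply: uabs_sum_le => [|i _]; first exact: uabs_ge0 um _.
by rewrite -mulrBr; apply: uabsM_le1 => //; apply: uabs_subX.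
Qed.

Lemma uabs_horner0 (g : {poly F}) x :
  (forall i, v g`_i <= 1) -> g`_0 = 0 -> v x <= 1 -> v g.[x] <= v x.
Proof.
move=> hg g0 hx; have := uabs_horner_sub hg hx (_ : v 0 <= 1).
by rewrite horner_coef0 g0 !subr0 uabs0 ler01; apply.
Qed.

Definition poly_le B (g : {poly F}) := forall i, v g`_i <= B.

Lemma poly_le_ge0 B g : poly_le B g -> 0 <= B.
Proof. by move/(_ 0%N); apply: le_trans; apply: uabs_ge0 um _. Qed.

Lemma poly_le0 B : 0 <= B -> poly_le B 0.
Proof. by move=> B0 i; rewrite coef0 uabs0. Qed.

Lemma poly_leD B g h : poly_le B g -> poly_le B h -> poly_le B (g + h).
Proof. by move=> hg hh i; rewrite coefD uabsD_le. Qed.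

Lemma poly_leN B g : poly_le B g -> poly_le B (- g).
Proof. by move=> hg i; rewrite coefN uabsN. Qed.

Lemma poly_leM A B g h : poly_le A g -> poly_le B h -> poly_le (A * B) (g * h).
Proof.
move=> hg hh i; rewrite coefM.
by apply: uabs_sum_le => [|j _]; [rewrite mulr_ge0 ?(poly_le_ge0 hg) ?(poly_le_ge0 hh)
  | rewrite uabsMle].
Qed.

Lemma poly_leM1 B g h : poly_le 1 g -> poly_le B h -> poly_le B (g * h).
Proof. by rewrite -{2}[B]mul1r; apply: poly_leM. Qed.

Lemma poly_leZ A B c g : v c <= A -> poly_le B g -> poly_le (A * B) (c *: g).
Proof. by move=> hc hg i; rewrite coefZ uabsMle. Qed.

Lemma poly_leC B c : v c <= B -> poly_le B c%:P.
Proof.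
move=> hc i; rewrite coefC; case: ifP => // _.
by rewrite uabs0 (le_trans (uabs_ge0 um c)).
Qed.

Lemma poly_le1 : poly_le 1 1.
Proof. by rewrite -polyC1; apply: poly_leC; rewrite uabs1. Qed.

Lemma poly_leXn n : poly_le 1 'X^n.
Proof. by move=> i; rewrite coefXn; apply: uabs_nat. Qed.

Lemma poly_leX B g n : poly_le B g -> poly_le (B ^+ n) (g ^+ n).
Proof.
move=> hg; elim: n => [|n IH]; first exact: poly_le1.
by rewrite !exprS; apply: poly_leM.
Qed.

Lemma poly_leX1 g n : poly_le 1 g -> poly_le 1 (g ^+ n).
Proof. by move=> /(@poly_leX _ _ n); rewrite expr1n. Qed.

Lemma poly_leMn B g n : poly_le B g -> poly_le B (g *+ n).
Proof. by move=> hg i; rewrite coefMn uabsMn_le. Qed.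

Lemma poly_le_sum (I : Type) (r : seq I) (P : pred I) (E : I -> {poly F}) B :
  0 <= B -> (forall i, P i -> poly_le B (E i)) ->
  poly_le B (\sum_(i <- r | P i) E i).
Proof.
move=> B0 h; elim/big_ind: _ => //; [exact: poly_le0 | exact: poly_leD].
Qed.

Lemma poly_le_comp B g h : poly_le B g -> poly_le 1 h -> poly_le B (g \Po h).
Proof.
move=> hg hh; rewrite comp_polyE; apply: poly_le_sum => [|i _].
  exact: poly_le_ge0 hg.
by rewrite -[B]mulr1; apply: poly_leZ => //; apply: poly_leX1.
Qed.

Lemma poly_le_strict (g : {poly F}) : (forall i, v g`_i < 1) ->
  exists2 B, B < 1 & poly_le B g.
Proof.
move=> hg; exists (\big[Num.max/0]_(i < size g) v g`_i).
  by elim/big_ind: _ => // x y; rewrite gt_max => -> ->.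
move=> i; case: (ltnP i (size g)) => hi.
  by rewrite (le_bigmax _ (fun i : 'I_(size g) => v g`_i) (Ordinal hi)).
by rewrite nth_default // uabs0; apply: bigmax_ge_id.
Qed.

End UltrametricField.

(** * The p-adic size of integers and factorials *)

Lemma logn_fact_bound p n : prime p -> (0 < n)%N -> (p.-1 * logn p n`! < n)%N.
Proof.
move=> pp n0; have p0 := prime_gt0 pp; rewrite logn_fact //.
(* The term [n %/ p ^ m] makes the sum telescope, as p times the next quotient is at most the
   current one. The strict bound is carried separately because that term eventually vanishes. *)
suff h m : (p.-1 * (\sum_(1 <= k < m.+1) n %/ p ^ k) + n %/ p ^ m <= n)%N /\
    (p.-1 * (\sum_(1 <= k < m.+1) n %/ p ^ k) < n)%N by case: (h n).
elim: m => [|m [IH1 IH2]]; first by rewrite big_geq // muln0 expn0 divn1.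
rewrite big_nat_recr //= mulnDr.
set S := (p.-1 * _)%N in IH1 IH2 *; set y := (n %/ p ^ m.+1)%N.
have hy : (p.-1 * y + y <= n %/ p ^ m)%N.
  by rewrite -mulSnr prednK // /y expnSr divnMA mulnC leq_trunc_div.
by case: (posnP y) hy => [->|y_gt0] hy; split; lia.
Qed.

Section AbsOfIntegers.
Context (R : realType) (F : fieldType) (v : F -> R) (p : nat).
Hypotheses (um : ultrametric_abs v) (pp : prime p) (vp : v p%:R = p%:R^-1).

Lemma inv_prime_lt1 : (p%:R^-1 : R) < 1.
Proof. by rewrite invf_lt1 ?ltr0n ?ltr1n ?prime_gt0 ?prime_gt1. Qed.

Lemma inv_prime_gt0 : 0 < (p%:R^-1 : R).
Proof. by rewrite invr_gt0 ltr0n prime_gt0. Qed.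

Lemma uabs_coprime n : coprime p n -> v n%:R = 1.
Proof.
move=> cpn; apply/le_anti; rewrite uabs_nat //= leNgt; apply/negP => h.
have n0 : (0 < n)%N.
  case: n cpn {h} => //; rewrite /coprime gcdn0 => /eqP p1.
  by move: pp; rewrite p1.
have [u w e _] := egcdnP p n0.
move: e; rewrite gcdnC (eqP cpn) => /(congr1 (fun m : nat => m%:R : F)).
rewrite natrD !natrM => e.
suff : v (1 : F) < 1 by rewrite uabs1 // ltxx.
have -> : (1 : F) = u%:R * n%:R - w%:R * p%:R by rewrite e addrC addKr.
apply: uabsB_lt => //.
  by apply: le_lt_trans h; apply: uabsM_le1 => //; apply: uabs_nat.
by apply: le_lt_trans inv_prime_lt1; rewrite -vp; apply: uabsM_le1 => //; apply: uabs_nat.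
Qed.

Lemma uabs_natE n : (0 < n)%N -> v n%:R = p%:R^-1 ^+ logn p n.
Proof.
move=> n0; have [m cm {1}->] := pfactor_coprime pp n0.
by rewrite natrM natrX (uabsM um) uabs_coprime // mul1r uabsX // vp.
Qed.

Lemma uabs_nat_neq0 n : (0 < n)%N -> (n%:R : F) != 0.
Proof.
move=> n0; apply/eqP => e; have := uabs_natE n0.
by rewrite e uabs0 // => /esym/eqP; rewrite expf_eq0 (gt_eqF inv_prime_gt0) andbF.
Qed.

Lemma fact_neq0 n : (n`!%:R : F) != 0.
Proof. by rewrite uabs_nat_neq0 ?fact_gt0. Qed.

Lemma uabs_pV j : v (p%:R ^- j) = p%:R ^+ j.
Proof. by rewrite uabsV // uabsX // vp exprVn invrK. Qed.

(** By [logn_fact_bound], the factorial cancels at most k - 1 of the k factors p. *)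
Lemma uabs_expX_fact k : (0 < k)%N -> v (p%:R ^+ k / k`!%:R) <= p%:R^-1.
Proof.
move=> k0; rewrite (uabsM um) uabsV // uabsX // vp uabs_natE ?fact_gt0 //.
rewrite ler_pdivrMr ?exprn_gt0 ?inv_prime_gt0 // -exprS.
apply: ler_wiXn2l; rewrite ?ltW ?inv_prime_gt0 ?inv_prime_lt1 //.
have := logn_fact_bound pp k0; have := prime_gt1 pp.
case: p => [|[|q]] //= _; nia.
Qed.

(* The radius of convergence of exp is p^(-1/(p-1)), reached by v x. *)
Lemma uabs_exp_critical x k : (0 < k)%N -> v x ^+ p.-1 = p%:R^-1 ->
  v (x ^+ k / k`!%:R) <= v x.
Proof.
move=> k0 hx; have vx1 : v x <= 1.
  have := inv_prime_lt1; rewrite -hx; have := prime_gt1 pp.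
  by case: p => [|[|q]] //= _ /ltW; rewrite expr_le1 // (uabs_ge0 um).
rewrite (uabsM um) uabsV // uabsX // uabs_natE ?fact_gt0 // -hx -exprM.
have x0 : 0 < v x.
  rewrite lt_def (uabs_ge0 um) andbT; apply/eqP => e; move: hx; rewrite e.
  have := prime_gt1 pp; case: p => [|[|q]] //= _.
  by rewrite expr0n /= => /esym/eqP; rewrite invr_eq0 pnatr_eq0.
rewrite ler_pdivrMr ?exprn_gt0 // -exprS ler_wiXn2l //; first exact: ltW.
exact: logn_fact_bound.
Qed.

End AbsOfIntegers.

(** * Exponentials of polynomials *)

Definition series_mul (F : fieldType) (a b : nat -> F) (n : nat) : F :=
  \sum_(i < n.+1) a i * b (n - i)%N.

Lemma coef_expr_small (F : fieldType) (g : {poly F}) m n :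
  g`_0 = 0 -> (n < m)%N -> (g ^+ m)`_n = 0.
Proof.
move=> g0; elim: m n => // m IH n hn.
rewrite exprS coefM big1 // => -[[|i] hi] _ /=; first by rewrite g0 mul0r.
by rewrite IH ?mulr0 //; lia.
Qed.

Section ExpSeries.
Context (F : fieldType).
Hypothesis fact_neq0 : forall n, (n`!%:R : F) != 0.
Implicit Types g h : {poly F}.

Lemma exp_series_widen g n N : g`_0 = 0 -> (n < N)%N ->
  exp_series g n = \sum_(m < N) (g ^+ m)`_n / m`!%:R.
Proof.
move=> g0 nN; rewrite /exp_series.
rewrite -(big_mkord predT (fun m => (g ^+ m)`_n / m`!%:R)).
rewrite -(big_mkord predT (fun m => (g ^+ m)`_n / m`!%:R)) /=.
rewrite [RHS](big_cat_nat (n := n.+1)) //= [X in _ + X]big_nat_cond.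
rewrite [X in _ + X]big1 ?addr0 // => i /andP[/andP[hi _] _].
by rewrite coef_expr_small ?mul0r.
Qed.

Lemma exp_series_coef0 g : exp_series g 0 = 1.
Proof. by rewrite /exp_series big_ord1 expr0 coef1 fact0 divr1. Qed.

Lemma exp_series0 n : exp_series (0 : {poly F}) n = (n == 0%N)%:R.
Proof.
rewrite /exp_series big_ord_recl expr0 coef1 fact0 divr1 big1 ?addr0 // => i _.
by rewrite expr0n /= coef0 mul0r.
Qed.

Lemma exp_seriesD g h n : g`_0 = 0 -> h`_0 = 0 ->
  exp_series (g + h) n = series_mul (exp_series g) (exp_series h) n.
Proof.
move=> g0 h0; pose ex (u : {poly F}) m : {poly F} := m`!%:R^-1 *: u ^+ m.
pose E (u : {poly F}) : {poly F} := \sum_(m < n.+1) ex u m.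
have EE (u : {poly F}) i : u`_0 = 0 -> (i <= n)%N -> (E u)`_i = exp_series u i.
  move=> u0 hi; rewrite (exp_series_widen u0 (N := n.+1)) // coef_sum.
  by apply: eq_bigr => m _; rewrite coefZ mulrC.
(* An auxiliary variable records the exponent m in u^m / m!. Its m-th coefficient in [A g * A h] is
   (g + h)^m / m! for m <= n by the binomial theorem, and has order greater than n in the series
   variable for m > n. Setting the variable to 1 gives [E g * E h]. *)
pose A (u : {poly F}) : {poly {poly F}} := \poly_(m < n.+1) ex u m.
have AE u : E u = (A u).[1].
  by rewrite horner_poly; apply: eq_bigr => m _; rewrite expr1n mulr1.
have -> : series_mul (exp_series g) (exp_series h) n = (E g * E h)`_n.
  rewrite coefM; apply: eq_bigr => i _; rewrite !EE //; [exact: leq_subr|].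
  by rewrite -ltnS.
rewrite !AE -hornerM horner_coef coef_sum.
set N := size _.
have AM m : (m <= n)%N -> (A g * A h)`_m = ex (g + h) m.
  move=> hm; rewrite coefM /ex addrC exprDn scaler_sumr; apply: eq_bigr => i _.
  rewrite !coef_poly !ifT; [|lia|have := ltn_ord i; lia].
  rewrite -scalerAl -scalerAr scalerA -scaler_nat scalerA [h ^+ _ * _]mulrC.
  have hi : (i <= m)%N by rewrite -ltnS.
  have := fact_neq0 m; rewrite -(bin_fact hi) natrM mulf_eq0 negb_or natrM.
  case/andP=> c0 d0; congr (_ *: _).
  by rewrite [in RHS]invfM mulrAC mulVf // mul1r invfM.
have Abig m : (n < m)%N -> ((A g * A h)`_m)`_n = 0.
  move=> hm; rewrite coefM coef_sum big1 // => i _.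
  rewrite !coef_poly; case: ifP => hi; last by rewrite mul0r coef0.
  case: ifP => hj; last by rewrite mulr0 coef0.
  rewrite -scalerAl -scalerAr !coefZ coefM big1 ?mulr0 // => k _.
  case: (ltnP k i) => ki; first by rewrite coef_expr_small ?mul0r.
  by rewrite [(h ^+ _)`__]coef_expr_small ?mulr0 //; have := ltn_ord k; lia.
have -> : \sum_(i < N) ((A g * A h)`_i * 1 ^+ i)`_n =
          \sum_(i < N + n.+1) ((A g * A h)`_i)`_n.
  rewrite big_split_ord /= [X in _ = _ + X]big1 ?addr0.
    by apply: eq_bigr => i _; rewrite expr1n mulr1.
  move=> i _ /=; rewrite (_ : (A g * A h)`_(N + i) = 0) ?coef0 //.
    by rewrite nth_default ?leq_addr.
rewrite addnC big_split_ord /= [X in _ = _ + X]big1 ?addr0; last first.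
  by move=> i _; rewrite Abig //= addSn ltnS leq_addr.
by apply: eq_bigr => i _; rewrite AM ?coefZ 1?mulrC // -ltnS.
Qed.

Lemma exp_series_comp g h n : g`_0 = 0 -> h`_0 = 0 ->
  exp_series (g \Po h) n = \sum_(m < n.+1) exp_series g m * (h ^+ m)`_n.
Proof.
move=> g0 h0.
rewrite /exp_series; under [RHS]eq_bigr => m _.
  rewrite -/(exp_series g m) (exp_series_widen g0 (ltn_ord m)) mulr_suml.
  over.
rewrite exchange_big /=; apply: eq_bigr => k _.
rewrite -rmorphXn /= comp_polyE coef_sum mulr_suml.
transitivity (\sum_(i < size (g ^+ k) + n.+1)
   (g ^+ k)`_i / k`!%:R * (h ^+ i)`_n).
  rewrite big_split_ord /= [X in _ = _ + X]big1 ?addr0.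
    by apply: eq_bigr => i _; rewrite coefZ mulrAC.
  by move=> i _; rewrite nth_default ?mul0r //= leq_addr.
rewrite addnC big_split_ord /= [X in _ + X]big1 ?addr0 // => i _.
by rewrite [(h ^+ _)`_n]coef_expr_small ?mulr0 //=; lia.
Qed.

Lemma exp_seriesMn g k n N : g`_0 = 0 -> (n < N)%N ->
  ((\poly_(i < N) exp_series g i) ^+ k)`_n = exp_series (g *+ k) n.
Proof.
move=> g0; elim: k n => [|k IH] n nN.
  by rewrite expr0 mulr0n exp_series0 coef1.
rewrite exprS mulrS exp_seriesD ?coefMn ?g0 ?mul0rn // coefM.
apply: eq_bigr => i _; rewrite coef_poly ifT; last by have := ltn_ord i; lia.
by rewrite IH //; have := ltn_ord i; lia.
Qed.

Lemma exp_seriesN g n : g`_0 = 0 ->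
  series_mul (exp_series g) (exp_series (- g)) n = (n == 0%N)%:R.
Proof. by move=> g0; rewrite -exp_seriesD ?coefN ?g0 ?oppr0 // subrr exp_series0. Qed.

Lemma exp_seriesZX (c : F) n : exp_series (c *: 'X) n = c ^+ n / n`!%:R.
Proof.
rewrite /exp_series big_ord_recr /= big1 ?add0r => [|i _].
  by rewrite exprZn coefZ coefXn eqxx mulr1.
by rewrite exprZn coefZ coefXn (gtn_eqF (ltn_ord i)) mulr0 mul0r.
Qed.

End ExpSeries.

Lemma exp_series_map (E F : fieldType) (f : {rmorphism E -> F}) (g : {poly E}) n :
  exp_series (map_poly f g) n = f (exp_series g n).
Proof.
rewrite /exp_series rmorph_sum; apply: eq_bigr => m _.
by rewrite -rmorphXn coef_map fmorph_div rmorph_nat.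
Qed.

(** * Dwork's lemma and Witt vector subtraction *)

(* Locked: unfolding big sums of polynomials makes unification diverge. *)
HB.lock Definition ghost (A : comNzRingType) (p : nat) (x : nat -> A) (j : nat) : A :=
  \sum_(i < j.+1) x i ^+ (p ^ (j - i)) *+ p ^ i.

Lemma ghostE (A : comNzRingType) (p : nat) (x : nat -> A) (j : nat) :
  ghost p x j = \sum_(i < j.+1) x i ^+ (p ^ (j - i)) *+ p ^ i.
Proof. by rewrite ghost.unlock. Qed.

Lemma eq_ghost (A : comNzRingType) (p : nat) (x y : nat -> A) (j : nat) :
  (forall i, (i <= j)%N -> x i = y i) -> ghost p x j = ghost p y j.
Proof.
by move=> e; rewrite !ghostE; apply: eq_bigr => i _; rewrite e // -ltnS.
Qed.

Section DworkLemma.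
Context (A : comNzRingType) (I : A -> Prop) (p : nat).
Hypotheses (pp : prime p) (I1 : I 1) (IN : forall x, I x -> I (- x))
  (ID : forall x y, I x -> I y -> I (x + y))
  (IM : forall x y, I x -> I y -> I (x * y)).

Let I0 : I 0. Proof. by rewrite -(subrr 1); apply/ID/IN. Qed.

Let IX x n : I x -> I (x ^+ n).
Proof. by move=> Ix; elim: n => // n IH; rewrite exprS; apply: IM. Qed.

Let IMn x n : I x -> I (x *+ n).
Proof. by move=> Ix; elim: n => // n IH; rewrite mulrS; apply: ID. Qed.

(** The quotient [z] must lie in the subring [I]: in Q_p[Z], where p is invertible, a congruence
    modulo p has content only relative to integral polynomials. *)
Definition congr_mod m x y := exists2 z, I z & x = y + z *+ m.

Lemma congr_mod_refl m x : congr_mod m x x.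
Proof. by exists 0; rewrite // mul0rn addr0. Qed.

Lemma congr_modD m x y x' y' :
  congr_mod m x y -> congr_mod m x' y' -> congr_mod m (x + x') (y + y').
Proof.
move=> [z Iz ->] [z' Iz' ->]; exists (z + z'); first exact: ID.
by rewrite mulrnDl addrACA.
Qed.

Lemma congr_mod_sym m x y : congr_mod m x y -> congr_mod m y x.
Proof. by case=> z Iz ->; exists (- z); rewrite ?mulNrn ?addrK; auto. Qed.

Lemma congr_mod_trans m x y z : congr_mod m x y -> congr_mod m y z -> congr_mod m x z.
Proof.
case=> a Ia -> [b Ib ->]; exists (b + a); first exact: ID.
by rewrite mulrnDl addrA.
Qed.

Lemma congr_modM m x y x' y' : I y -> I x' ->
  congr_mod m x y -> congr_mod m x' y' -> congr_mod m (x * x') (y * y').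
Proof.
move=> Iy Ix' [z Iz ->] [z' Iz' e]; rewrite mulrDl {1}e mulrDr.
exists (y * z' + z * x'); first by apply: ID; apply: IM.
by rewrite mulrnDl addrA mulrnAr mulrnAl.
Qed.

Lemma congr_modX m x y n : I x -> I y -> congr_mod m x y ->
  congr_mod m (x ^+ n) (y ^+ n).
Proof.
move=> Ix Iy h; elim: n => [|n IH]; first exact: congr_mod_refl.
by rewrite !exprS; apply: congr_modM; auto.
Qed.

Lemma congr_mod_sum m (J : Type) (r : seq J) (P : pred J) (E E' : J -> A) :
  (forall j, P j -> congr_mod m (E j) (E' j)) ->
  congr_mod m (\sum_(j <- r | P j) E j) (\sum_(j <- r | P j) E' j).
Proof.
move=> h; elim/big_rec2: _ => [|j x y Pj hxy]; first exact: congr_mod_refl.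
by apply: congr_modD; auto.
Qed.

(** In the factorization of x^p - y^p by x - y, the cofactor is congruent to p y^(p-1), hence to 0,
    modulo p. This uses x = y modulo p, whence m > 0. *)
Lemma congr_mod_expp m x y : (0 < m)%N -> I x -> I y ->
  congr_mod (p ^ m) x y -> congr_mod (p ^ m.+1) (x ^+ p) (y ^+ p).
Proof.
move=> m0 Ix Iy h.
have [z Iz e] := h.
have [w Iw ew] : congr_mod p (\sum_(i < p) x ^+ (p.-1 - i) * y ^+ i) 0.
  apply: (@congr_mod_trans _ _ (\sum_(i < p) y ^+ p.-1)); last first.
    exists (y ^+ p.-1); rewrite ?add0r; auto.
    by rewrite sumr_const card_ord.
  apply: congr_mod_sum => i _.
  have -> : y ^+ p.-1 = y ^+ (p.-1 - i) * y ^+ i.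
    by rewrite -exprD subnK // -ltnS prednK ?prime_gt0.
  apply: congr_modM; auto; last exact: congr_mod_refl.
  apply: congr_modX => //.
  exists (z *+ p ^ m.-1); first exact: IMn.
  by rewrite -mulrnA -expnSr prednK.
exists (w * z); first exact: IM.
apply/eqP; rewrite -subr_eq0 opprD addrA; apply/eqP.
rewrite subrXX ew e [y + _]addrC addrK add0r.
by rewrite mulrnAl mulrnAr -mulrnA -expnS mulrC subrr.
Qed.

Lemma congr_mod_exp_iter k x y : I x -> I y -> congr_mod p x y ->
  congr_mod (p ^ k.+1) (x ^+ (p ^ k)) (y ^+ (p ^ k)).
Proof.
move=> Ix Iy h; elim: k => [|k IH]; first by rewrite !expn0 expn1.
by rewrite (expnSr p k) !exprM; apply: congr_mod_expp; auto.
Qed.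

Lemma congr_mod_freshman x y : I x -> I y ->
  congr_mod p ((x + y) ^+ p) (x ^+ p + y ^+ p).
Proof.
move=> Ix Iy; move: pp; case: p => [|q] // qp.
rewrite exprDn big_ord_recr big_ord_recl /= subnn subn0 bin0 binn.
rewrite !expr0 mulr1 mul1r !mulr1n addrAC.
rewrite -[X in congr_mod _ _ X]addr0; apply: congr_modD; first exact: congr_mod_refl.
rewrite [X in congr_mod _ _ X](_ : _ = \sum_(i < q) 0); last by rewrite big1_eq.
apply: congr_mod_sum => i _.
have /dvdnP[c ->] : (q.+1 %| 'C(q.+1, bump 0 i))%N.
  by apply: prime_dvd_bin => //=; rewrite /bump /=; have := ltn_ord i; lia.
exists ((x ^+ (q.+1 - bump 0 i) * y ^+ (bump 0 i)) *+ c); first by auto.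
by rewrite add0r mulrnA.
Qed.

Lemma congr_mod_int (c : int) : congr_mod p ((c%:~R : A) ^+ p) c%:~R.
Proof.
have Iint (b : int) : I b%:~R.
  by case: b => n; rewrite ?NegzE ?mulrNz -pmulrn; auto.
have N1 : congr_mod p ((-1 : A) ^+ p) (-1).
  case: (boolP (odd p)) => hp.
    by rewrite -signr_odd hp expr1; exact: congr_mod_refl.
  have [->|hp2] := even_prime pp; last by rewrite hp2 in hp.
  by exists 1; rewrite // sqrrN expr1n addrC [1 *+ 2]mulr2n addrK.
elim/int_rect: c => [|n IH|n IH].
- by rewrite mulr0z expr0n gtn_eqF ?prime_gt0 //; exact: congr_mod_refl.
- rewrite -addn1 PoszD rmorphD /=.
  apply: congr_mod_trans (congr_mod_freshman (Iint _) I1) _.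
  by rewrite expr1n; apply: congr_modD => //; exact: congr_mod_refl.
- rewrite -addn1 PoszD opprD rmorphD rmorphN /= -mulrNz.
  apply: congr_mod_trans (congr_mod_freshman (Iint _) (IN I1)) _.
  exact: congr_modD.
Qed.

Context (sigma : {rmorphism A -> A}).
Hypothesis sigmaI : forall x, I x -> I (sigma x).
Hypothesis sigma_frob : forall x, I x -> congr_mod p (sigma x) (x ^+ p).

(** Solving for x_n requires b_n minus the terms in earlier components to be divisible by p^n in
    [I]. This holds because b_n = sigma(b_(n-1)) modulo p^n and sigma(x_i) = x_i^p modulo p, which
    becomes a congruence modulo p^(n-i) after raising to the power p^(n-1-i). *)
Lemma dwork_ghost (b : nat -> A) n : I (b 0%N) ->
  (forall j, congr_mod (p ^ j.+1) (b j.+1) (sigma (b j))) ->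
  exists2 x : nat -> A, (forall j, I (x j)) & forall j, (j < n)%N -> ghost p x j = b j.
Proof.
move=> Ib0 hb; elim: n => [|n [x Ix hx]]; first by exists (fun=> 0).
have [y Iy hy] : exists2 y, I y &
    b n = \sum_(i < n) x i ^+ (p ^ (n - i)) *+ p ^ i + y *+ p ^ n.
  case: n hx => [|n] hx; first by exists (b 0%N); rewrite // big_ord0 add0r mulr1n.
  apply: congr_mod_trans (hb n) _; rewrite -hx // ghostE rmorph_sum /=.
  apply: congr_mod_sum => i _; rewrite rmorphMn rmorphXn /=.
  have hi : (i <= n)%N by rewrite -ltnS.
  rewrite subSn // (expnS p (n - i)) exprM.
  have [z Iz ->] := congr_mod_exp_iter (n - i) (sigmaI (Ix i)) (IX p (Ix i)) (sigma_frob (Ix i)).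
  by exists z => //; rewrite mulrnDl -mulrnA -expnD addSn subnK.
pose x' j := if j == n then y else x j.
have x'E m : (m <= n)%N -> \sum_(i < m) x' i ^+ (p ^ (m - i)) *+ p ^ i =
    \sum_(i < m) x i ^+ (p ^ (m - i)) *+ p ^ i.
  by move=> hm; apply: eq_bigr => i _; rewrite /x' ltn_eqF // (leq_trans (ltn_ord i)).
exists x' => [j|j]; first by rewrite /x'; case: ifP.
rewrite ltnS leq_eqVlt => /orP[/eqP->|hj].
  by rewrite !ghostE big_ord_recr /= x'E // subnn expr1 /x' eqxx hy.
rewrite -hx // !ghostE; apply: eq_bigr => i _; rewrite /x' ltn_eqF //.
exact: leq_trans (ltn_ord i) hj.
Qed.

End DworkLemma.

Lemma ghost_map (A B : comNzRingType) (f : {rmorphism A -> B}) p (x : nat -> A) j :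
  f (ghost p x j) = ghost p (f \o x) j.
Proof.
by rewrite !ghostE rmorph_sum; apply: eq_bigr => i _; rewrite rmorphMn rmorphXn.
Qed.

Lemma ghostS (A : comNzRingType) p (x : nat -> A) j :
  ghost p x j.+1 = ghost p (fun i => x i ^+ p) j + x j.+1 *+ p ^ j.+1.
Proof.
rewrite !ghostE big_ord_recr /= subnn expr1; congr (_ + _).
apply: eq_bigr => i _; rewrite -exprM -expnS subSn //.
by rewrite -ltnS.
Qed.

Lemma witt_phantomE (A : comNzRingType) p s (a : {ffun 'I_s.+1 -> A}) j :
  (j <= s)%N -> witt_phantom p a j = ghost p (a \o inord) j.
Proof.
move=> hj; rewrite ghostE.
rewrite (big_ord_widen s.+1 (fun i => (a \o inord) i ^+ (p ^ (j - i)) *+ p ^ i)) //.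
by apply: eq_big => [i|i _]; rewrite ?ltnS //= inord_val.
Qed.

(** * Integrality and functoriality of Witt vector subtraction *)

Section WittSubtraction.
Context (p s : nat).
Hypothesis pp : prime p.
Local Notation N := (s.+1 + s.+1)%N.

Let X (R : nzRingType) (i : nat) : {mpoly R[N]} := 'X_(lshift s.+1 (inord i)).
Let Y (R : nzRingType) (i : nat) : {mpoly R[N]} := 'X_(rshift s.+1 (inord i)).

(** The substitution X_i -> X_i^p agrees with the p-th power exactly on monomials, modulo p on
    integers by Fermat, and modulo p on sums since the middle binomial coefficients are divisible by
    p. *)
Lemma mpoly_int_frobenius : exists sg : {rmorphism {mpoly int[N]} -> {mpoly int[N]}},
  (forall i, sg 'X_i = 'X_i ^+ p) /\
  forall g, congr_mod (fun=> True) p (sg g) (g ^+ p).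
Proof.
exists (comp_mpoly [tuple 'X_i ^+ p | i < N]); split=> [i|g] /=.
  by rewrite comp_mpolyXU -tnth_nth tnth_mktuple.
elim/mpolyind: g => [|c m q _ _ IH].
  by rewrite comp_mpoly0 expr0n gtn_eqF ?prime_gt0 //; exists 0; rewrite // mul0rn addr0.
rewrite comp_mpolyD; apply: congr_mod_trans; last first.
- by apply: congr_mod_sym; last exact: congr_mod_freshman.
- apply: congr_modD IH => //.
  rewrite comp_mpolyZ comp_mpolyX exprZn -mul_mpolyC -[(c ^+ p) *: _]mul_mpolyC.
  apply: congr_modM => //; last first.
    rewrite [X in X ^+ p]mpolyXE_id -prodrXl.
    rewrite (eq_bigr (fun i => ('X_i ^+ m i) ^+ p)); first exact: congr_mod_refl.
    by move=> i _; rewrite tnth_mktuple -!exprM mulnC.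
  apply: congr_mod_sym => //.
  have [z _ e] := @congr_mod_int int (fun=> True) p pp I (fun _ _ => I) (fun _ _ _ _ => I)
    (fun _ _ _ _ => I) c.
  by exists z%:MP => //; rewrite -mpolyCMn -mpolyCD -[X in (X ^+ p)%:MP]intz e intz.
- by [].
Qed.

(** The ghost sequences of the variables satisfy Dwork's congruences for X_i -> X_i^p, hence so does
    their difference. *)
Lemma witt_sub_integral : exists S : nat -> {mpoly int[N]}, forall j, (j <= s)%N ->
  ghost p S j = ghost p (@X int) j - ghost p (@Y int) j.
Proof.
have [sg [sgX sgF]] := mpoly_int_frobenius.
have gS (Z : nat -> {mpoly int[N]}) j : (forall i, sg (Z i) = Z i ^+ p) ->
    ghost p Z j.+1 = sg (ghost p Z j) + Z j.+1 *+ p ^ j.+1.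
  move=> hZ; rewrite (ghost_map sg) ghostS; congr (_ + _).
  by apply: eq_ghost => i _; rewrite /= hZ.
move: (ghost p (@X int)) (ghost p (@Y int)) (gS (@X int) ^~ (fun=> sgX _))
  (gS (@Y int) ^~ (fun=> sgX _)) => gX gY hX hY.
have [|S _ hS] := @dwork_ghost {mpoly int[N]} (fun=> True) p pp I
   (fun _ _ => I) (fun _ _ _ _ => I) (fun _ _ _ _ => I) sg (fun _ _ => I)
   (fun g _ => sgF g) (fun j => gX j - gY j) s.+1 I.
  move=> j; exists (X int j.+1 - Y int j.+1) => //.
  by rewrite hX hY raddfB mulrnBl opprD addrACA.
by exists S => j hj; rewrite hS.
Qed.

Lemma size_witt_sub_polys n : size (witt_sub_polys p s n) = n.
Proof. by elim: n => //= n IH; rewrite size_rcons IH. Qed.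

Lemma nth_witt_sub_polys n j : (j < n)%N ->
  (witt_sub_polys p s n)`_j = (witt_sub_polys p s j.+1)`_j.
Proof.
elim: n => // n IH; rewrite ltnS leq_eqVlt => /orP[/eqP->//|hj].
by rewrite [in LHS]/= nth_rcons size_witt_sub_polys hj IH.
Qed.

Lemma witt_sub_polysE j : (j <= s)%N ->
  (witt_sub_polys p s s.+1)`_j = (p ^ j)%:R^-1 *:
    (ghost p (@X rat) j - ghost p (@Y rat) j
     - \sum_(i < j) (witt_sub_polys p s s.+1)`_i ^+ (p ^ (j - i)) *+ p ^ i).
Proof.
move=> hj; rewrite nth_witt_sub_polys //.
rewrite [X in X`__ = _]/= nth_rcons size_witt_sub_polys ltnn eqxx.
rewrite (witt_phantomE _ _ hj).
rewrite (witt_phantomE _ _ hj).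
congr (_ *: _).
congr (_ - _).
  congr (_ - _).
- by apply: eq_ghost => i _; rewrite /= ffunE.
- by apply: eq_ghost => i _; rewrite /= ffunE.
apply: eq_bigr => i _; rewrite [in RHS]nth_witt_sub_polys; last first.
  by have := ltn_ord i; lia.
by rewrite nth_witt_sub_polys.
Qed.

Lemma mmap_map_int (A : nzRingType) (h : 'I_N -> A) (g : {mpoly int[N]}) :
  mmap (fun c : rat => (numq c)%:~R : A) h (map_mpoly intr g) = mmap intr h g.
Proof.
rewrite /mmap.
have e : perm_eq (msupp (map_mpoly (intr : int -> rat) g)) (msupp g).
  apply: uniq_perm; rewrite ?msupp_uniq // => m.
  by rewrite !mcoeff_msupp mcoeff_map_mpoly intr_eq0.
rewrite (perm_big _ e) /=; apply: eq_bigr => m _.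
by rewrite mcoeff_map_mpoly numq_int.
Qed.

(* Stating the polynomials over int gives one S valid in all rings at once,
   including those of characteristic p. *)
Lemma witt_sub_mmap : exists S : nat -> {mpoly int[N]},
  (forall j, (j <= s)%N -> ghost p S j = ghost p (@X int) j - ghost p (@Y int) j) /\
  forall (A : comNzRingType) (a b : {ffun 'I_s.+1 -> A}) j,
    witt_sub p a b j = mmap (intr : int -> A)
      (fun i => match split i with inl l => a l | inr r => b r end) (S j).
Proof.
have [S hS] := witt_sub_integral; exists S; split => // A a b j.
rewrite ffunE.
suff -> : (witt_sub_polys p s s.+1)`_j = map_mpoly intr (S j) by rewrite mmap_map_int.
move: (nat_of_ord j) (ltn_ord j : (j <= s)%N) => {}j.
elim/ltn_ind: j => j IH hj.
rewrite witt_sub_polysE //.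
have -> : \sum_(i < j) (witt_sub_polys p s s.+1)`_i ^+ (p ^ (j - i)) *+ p ^ i =
    map_mpoly intr (\sum_(i < j) S i ^+ (p ^ (j - i)) *+ p ^ i).
  rewrite rmorph_sum; apply: eq_bigr => i _; rewrite rmorphMn rmorphXn /= IH //.
  by have := ltn_ord i; lia.
have -> : ghost p (@X rat) j - ghost p (@Y rat) j =
    map_mpoly intr (ghost p (@X int) j - ghost p (@Y int) j).
  rewrite rmorphB !ghost_map; congr (_ - _).
    by apply: eq_ghost => i _; rewrite /= /X /map_mpoly mmapX mmap1U.
  by apply: eq_ghost => i _; rewrite /= /Y /map_mpoly mmapX mmap1U.
rewrite -hS // ghostE big_ord_recr /= subnn expr1 rmorphD /= addrC addrA addNr add0r.
rewrite rmorphMn /= -scaler_nat scalerA mulVf ?scale1r //.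
by have := prime_gt0 pp; rewrite lt0n pnatr_eq0 expn_eq0 negb_and => ->.
Qed.

(** Subtraction is given by polynomials over the integers, so it preserves every relation compatible
    with the ring operations. It is used for reduction to the residue field and for taking constant
    coefficients. *)
Lemma witt_sub_rel (A B : comNzRingType) (Rel : A -> B -> Prop)
    (a b : {ffun 'I_s.+1 -> A}) (a' b' : {ffun 'I_s.+1 -> B}) j :
  Rel 1 1 -> (forall x x', Rel x x' -> Rel (- x) (- x')) ->
  (forall x y x' y', Rel x x' -> Rel y y' -> Rel (x + y) (x' + y')) ->
  (forall x y x' y', Rel x x' -> Rel y y' -> Rel (x * y) (x' * y')) ->
  (forall i, Rel (a i) (a' i)) -> (forall i, Rel (b i) (b' i)) ->
  Rel (witt_sub p a b j) (witt_sub p a' b' j).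
Proof.
move=> R1 RN RD RM ha hb; have [S [_ hS]] := witt_sub_mmap; rewrite !hS /mmap.
have R0 : Rel 0 0 by rewrite -(subrr (1 : A)) -(subrr (1 : B)); apply/RD/RN.
have RX n x x' : Rel x x' -> Rel (x ^+ n) (x' ^+ n).
  by move=> h; elim: n => // n IH; rewrite !exprS; apply: RM.
have Rn n : Rel n%:R n%:R by elim: n => // n IH; rewrite !mulrS; apply: RD.
elim/big_ind2: _ => // [x x' y y' hx hy|m _]; first exact: RD.
apply/RM; last first.
  rewrite /mmap1; elim/big_ind2: _ => // [x x' y y' hx hy|i _]; first exact: RM.
  by apply: RX; case: (split i).
by case: (S j)@_m => n; rewrite ?NegzE ?mulrNz -?pmulrn; auto.
Qed.

Lemma witt_phantom_sub (A : comNzRingType) (a b : {ffun 'I_s.+1 -> A}) j :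
  (j <= s)%N ->
  witt_phantom p (witt_sub p a b) j = witt_phantom p a j - witt_phantom p b j.
Proof.
move=> hj; have [S [gS hS]] := witt_sub_mmap.
pose h (i : 'I_N) : A := match split i with inl l => a l | inr r => b r end.
pose ev : {rmorphism {mpoly int[N]} -> A} := mmap (intr : int -> A) h.
have := congr1 ev (gS j hj); rewrite rmorphB !ghost_map !witt_phantomE //.
have -> : ghost p (ev \o S) j = ghost p (witt_sub p a b \o inord) j.
  by apply: eq_ghost => i hi; rewrite /= hS inordK //; lia.
move=> ->; congr (_ - _); apply: eq_ghost => i _.
  by rewrite /= /X mmapX mmap1U /h (unsplitK (inl _)).
by rewrite /= /Y mmapX mmap1U /h (unsplitK (inr _)).
Qed.

End WittSubtraction.

(** * The Artin-Hasse exponential *)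

Lemma coef_expr_local (F : fieldType) (g h : {poly F}) n k :
  (forall i, (i <= n)%N -> g`_i = h`_i) ->
  forall i, (i <= n)%N -> (g ^+ k)`_i = (h ^+ k)`_i.
Proof.
move=> e; elim: k => [|k IH] i hi; first by rewrite !expr0.
rewrite !exprS !coefM; apply: eq_bigr => j _.
by rewrite e ?IH //; have := ltn_ord j; lia.
Qed.

Lemma exp_series_local (F : fieldType) (g h : {poly F}) n :
  (forall i, (i <= n)%N -> g`_i = h`_i) -> exp_series g n = exp_series h n.
Proof.
by move=> e; apply: eq_bigr => m _; rewrite (coef_expr_local _ e).
Qed.

Lemma sum_triangle (V : nmodType) (E : nat -> nat -> V) J :
  \sum_(j < J) \sum_(i < j.+1) E i (j - i)%N = \sum_(i < J) \sum_(l < J - i) E i l.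
Proof.
elim: J => [|J IH]; first by rewrite !big_ord0.
rewrite big_ord_recr /= IH [in RHS]big_ord_recr /= subSnn big_ord1.
rewrite [X in _ + X]big_ord_recr /= subnn addrA -big_split; congr (_ + _) => /=.
apply: eq_bigr => i _; have hi := ltn_ord i.
by rewrite [in RHS]subSn ?big_ord_recr //= ltnW.
Qed.

Lemma series_mul_le (R : realType) (F : fieldType) (v : F -> R)
    (um : ultrametric_abs v) (a b : nat -> F) n :
  (forall i, (i <= n)%N -> v (a i) <= 1) ->
  (forall i, (i <= n)%N -> v (b i) <= 1) -> v (series_mul a b n) <= 1.
Proof.
move=> ha hb; apply: (uabs_sum_le um) => [|i _]; first exact: ler01.
by apply: (uabsM_le1 um); [apply: ha|apply: hb]; have := ltn_ord i; lia.
Qed.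

(** A truncation of the logarithm X + X^q/q + X^(q^2)/q^2 + ... of the Artin-Hasse exponential. *)
Definition ah_log (F : fieldType) (q J : nat) : {poly F} :=
  \sum_(j < J) (q%:R ^- j) *: 'X^(q ^ j).

Lemma ah_log_coef0 (F : fieldType) q J : (0 < q)%N -> (ah_log F q J)`_0 = 0.
Proof.
move=> q0; rewrite coef_sum big1 // => j _.
by rewrite coefZ coefXn eq_sym expn_eq0 (gtn_eqF q0) mulr0.
Qed.

Lemma exp_ah_log_widen (F : fieldType) q J n : (n < q ^ J)%N ->
  exp_series (ah_log F q J.+1) n = exp_series (ah_log F q J) n.
Proof.
move=> hn; apply: exp_series_local => i hi.
rewrite /ah_log big_ord_recr /= coefD coefZ coefXn ltn_eqF ?mulr0 ?addr0 //.
exact: leq_ltn_trans hi hn.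
Qed.

Section PadicIntegers.
Context (R : realType) (p : nat) (pp : prime p) (Qp : fieldType) (v : Qp -> R).
Hypothesis Qp_padic : is_padic_field p v.
Let um := padic_abs Qp_padic.
Let vp := padic_p Qp_padic.

Let pV0 : 0 <= (p%:R^-1 : R). Proof. exact/ltW/inv_prime_gt0. Qed.
Let pV1 : (p%:R^-1 : R) <= 1. Proof. exact/ltW/inv_prime_lt1. Qed.

Lemma congr_mod_uabs (x y : Qp) :
  congr_mod (fun z => v z <= 1) p x y -> v (x - y) <= p%:R^-1.
Proof.
case=> z hz ->; rewrite addrC addKr -[z *+ p]mulr_natr (uabsM um) vp.
by rewrite -[X in _ <= X]mul1r ler_wpM2r.
Qed.

(** By density, x is within 1/p of a fraction a / b whose denominator is a p-adic unit, which
    reduces the claim to Fermat's theorem for a and b. *)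
Lemma padic_fermat x : v x <= 1 -> v (x ^+ p - x) <= p%:R^-1.
Proof.
move=> hx; have [q hq] := padic_dense Qp_padic x (inv_prime_gt0 R pp).
have {}hq := ltW hq; set y : Qp := ratr q in hq *.
have hy : v y <= 1.
  rewrite -[y](subKr x); apply: (uabsB_le um) => //; exact: le_trans hq _.
have -> : x ^+ p - x = (x ^+ p - y ^+ p) + ((y ^+ p - y) - (x - y)) by ring.
apply: (uabsD_le um); first by apply: le_trans hq; apply: uabs_subX.
apply: (uabsB_le um) => //.
set a : Qp := (numq q)%:~R; set b : Qp := (denq q)%:~R.
have ha : v a <= 1 by exact: uabs_int.
have hb : v b <= 1 by exact: uabs_int.
have b0 : b != 0.
  rewrite /b; case: (denq q) (denq_neq0 q) => [] n; rewrite ?NegzE ?mulrNz ?oppr_eq0 -?pmulrn;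
    last by move=> _; apply: (uabs_nat_neq0 um pp vp).
  by move=> n0; apply: (uabs_nat_neq0 um pp vp); case: n n0.
have yb : y * b = a by rewrite /y /ratr mulfVK.
(* Here |a| = |y b| <= |b|, so a Bezout relation between a and b forces |b| >= 1. *)
have vb : v b = 1.
  apply/le_anti; rewrite hb /=.
  have vab : v a <= v b by rewrite -yb; apply: (uabsM_le1 um).
  have [u [w e]] := Bezoutz (numq q) (denq q).
  have g1 : gcdz (numq q) (denq q) = 1.
    by have := coprime_num_den q; rewrite /coprime /gcdz => /eqP ->.
  move: e; rewrite g1 => /(congr1 (fun z : int => z%:~R : Qp)).
  rewrite rmorphD !rmorphM /= -/a -/b => e1.
  rewrite -{1}(uabs1 um) -[1]/(1%:~R) -e1; apply: (uabsD_le um).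
    by apply: (uabsM_le1 um) => //; exact: uabs_int.
  by apply: (uabsM_le1 um) => //; exact: uabs_int.
have fermat c : v (c%:~R ^+ p - c%:~R) <= p%:R^-1.
  apply/congr_mod_uabs/congr_mod_int => //; first by rewrite uabs1.
  - by move=> z; rewrite uabsN.
  - by move=> z t; apply: uabsD_le.
  - by move=> z t; apply: uabsM_le1.
have -> : v (y ^+ p - y) = v ((a ^+ p - a) - y ^+ p * (b ^+ p - b)).
  have -> : (a ^+ p - a) - y ^+ p * (b ^+ p - b) = (y ^+ p - y) * b.
    by rewrite -yb exprMn; ring.
  by rewrite (uabsM um) vb mulr1.
apply: (uabsB_le um); first exact: fermat.
by apply: (uabsM_le1 um); [apply: uabsX_le1|exact: fermat].
Qed.

Local Notation Zpoly := (poly_le v 1).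

Lemma congr_mod_poly (g h : {poly Qp}) :
  congr_mod Zpoly p g h <-> poly_le v p%:R^-1 (g - h).
Proof.
split=> [[z hz ->]|hgh].
  rewrite addrC addKr -scaler_nat -[X in poly_le _ X _]mulr1.
  by apply: (poly_leZ um) => //; rewrite vp.
have p0 := uabs_nat_neq0 um pp vp (prime_gt0 pp).
exists (p%:R^-1 *: (g - h)).
  rewrite -[1](@mulfV _ (p%:R : R)) ?pnatr_eq0 ?gtn_eqF ?prime_gt0 //.
  by apply: (poly_leZ um) => //; rewrite uabsV // vp invrK.
by rewrite -scaler_nat scalerA mulfV // scale1r addrC subrK.
Qed.

(** Substituting Q fixes the coefficients, in agreement with c -> c^p modulo p by [padic_fermat],
    and sends X to X^p modulo p; a Horner induction combines the two. *)
Lemma poly_frobenius (Q g : {poly Qp}) :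
  Zpoly Q -> poly_le v p%:R^-1 (Q - 'X^p) -> Zpoly g ->
  congr_mod Zpoly p (g \Po Q) (g ^+ p).
Proof.
move=> hQ /congr_mod_poly hQp.
have CD := @poly_leD _ _ _ um 1; have CN := @poly_leN _ _ _ um 1.
have C1 := @poly_le1 _ _ _ um; have CM := fun g h => @poly_leM1 _ _ _ um 1 g h.
elim/poly_ind: g => [|g c IH] hg.
  rewrite comp_poly0 expr0n gtn_eqF ?prime_gt0 //.
  by apply: congr_mod_refl => //; rewrite -(subrr 1); apply/CD/CN.
have hg' : Zpoly g by move=> i; have := hg i.+1; rewrite coefD coefMX coefC addr0.
have hc : v c <= 1 by have := hg 0%N; rewrite coefD coefMX coefC add0r.
have hcP : Zpoly c%:P by exact: poly_leC.
have hX : Zpoly 'X by rewrite -['X]expr1; exact: poly_leXn.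
apply: (congr_mod_trans CD) (congr_mod_sym CN (congr_mod_freshman pp C1 CN CD CM (CM _ _ hg' hX) hcP)).
rewrite comp_poly_MXaddC; apply: (congr_modD CD); last first.
  apply/(congr_mod_sym CN)/congr_mod_poly; rewrite -polyC_exp -polyCB.
  by apply: (poly_leC um); apply: padic_fermat.
rewrite exprMn; apply: (congr_modM CD CM) => //; last exact: IH.
exact: (poly_leX1 um).
Qed.

(* Dwork's argument: the logarithm L satisfies p L(X) = p X + L(X^p), so its
   exponential satisfies F(X)^p = exp(p X) F(X^p); modulo p, this determines p
   times the n-th coefficient of F in terms of the previous ones. *)
Lemma artin_hasse_integral J n : (n < p ^ J)%N ->
  v (exp_series (ah_log Qp p J) n) <= 1.
Proof.
elim/ltn_ind: n J => n IH J hn.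
have f0 := fact_neq0 um pp vp.
have [->|n0] := posnP n; first by rewrite exp_series_coef0 uabs1.
case: J hn => [|J] hn; first by move: hn; rewrite expn0 ltnNge n0.
have p1 := prime_gt1 pp; have p0 := prime_gt0 pp.
have L0 j : (ah_log Qp p j)`_0 = 0 by apply: ah_log_coef0.
pose c i := exp_series (ah_log Qp p J.+1) i.
pose A := \poly_(i < n) c i.
have hA : Zpoly A.
  move=> i; rewrite coef_poly; case: ifP => hi; last by rewrite uabs0 ?ler01.
  by apply: IH => //; apply: ltn_trans hi hn.
have A0 : A.[0] = 1 by rewrite horner_coef0 coef_poly n0 /c exp_series_coef0.
have split_c : \poly_(i < n.+1) c i = A + c n *: 'X^n.
  apply/polyP => i; rewrite coefD coefZ coefXn !coef_poly ltnS leq_eqVlt.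
  by case: eqVneq => [->|_] /=; rewrite ?ltnn ?add0r ?mulr1 // mulr0 addr0.
(* [A] is the series cut before degree n. As its constant term is 1, adding c_n X^n changes the n-th
   coefficient of the p-th power by p c_n. *)
have lhs : exp_series (ah_log Qp p J.+1 *+ p) n = (A ^+ p)`_n + c n *+ p.
  rewrite -(exp_seriesMn f0 p (L0 _) (ltnSn n)) -/c split_c.
  set B := A + _.
  have B0 : B.[0] = 1.
    by rewrite hornerD A0 hornerZ hornerXn expr0n gtn_eqF // mulr0 addr0.
  have -> : B ^+ p = A ^+ p + c n *: 'X^n * \sum_(i < p) B ^+ (p.-1 - i) * A ^+ i.
    have -> : c n *: 'X^n = B - A by rewrite /B addrC addKr.
    by rewrite -subrXX addrC subrK.
  rewrite coefD -scalerAl coefZ coefXnM ltnn subnn -horner_coef0 horner_sum.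
  rewrite (eq_bigr (fun=> 1)) ?sumr_const ?card_ord ?mulr_natr // => i _.
  by rewrite hornerM !horner_exp A0 B0 !expr1n mulr1.
have rhs : ah_log Qp p J.+1 *+ p = (p%:R *: 'X) + (ah_log Qp p J \Po 'X^p).
  rewrite /ah_log big_ord_recl mulrnDl expr0 invr1 scale1r expn0 scaler_nat.
  congr (_ + _); rewrite raddf_sum -sumrMnl; apply: eq_bigr => i _ /=.
  rewrite comp_polyZ comp_Xn_poly -exprM -expnS -scaler_nat scalerA.
  by rewrite /bump /= add1n exprS invfM mulVKf // (uabs_nat_neq0 um pp vp).
pose e k := exp_series (ah_log Qp p J \Po 'X^p) k.
have Xp0 : ('X^p : {poly Qp})`_0 = 0 by rewrite coefXn eq_sym gtn_eqF.
have eE k : e k = \sum_(m < k.+1) exp_series (ah_log Qp p J) m * ('X^p ^+ m)`_k.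
  exact: exp_series_comp.
have small m : (n == p * m)%N -> (m < n)%N && (m < p ^ J)%N.
  by move=> /eqP nE; move: hn; rewrite expnS nE ltn_pmul2l // => ->; nia.
have he k : (k <= n)%N -> v (e k) <= 1.
  move=> hk; rewrite eE; apply: (uabs_sum_le um) => [|m _]; first exact: ler01.
  rewrite -exprM coefXn; case: eqP => [kE|_]; last by rewrite mulr0 uabs0.
  rewrite mulr1; apply: IH; first by nia.
  by move: hn; rewrite expnS; nia.
have hAe : v (e n - (A ^+ p)`_n) <= p%:R^-1.
  have -> : e n = (A \Po 'X^p)`_n.
    rewrite eE big_ord_recr /= -exprM coefXn (_ : (n == _)%N = false) ?mulr0 ?addr0.
      rewrite /A poly_def raddf_sum coef_sum; apply: eq_bigr => m _ /=.
      rewrite comp_polyZ comp_Xn_poly coefZ -exprM coefXn.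
      case: eqVneq => [nE|_]; last by rewrite !mulr0.
      have /small/andP[_ hm] : (n == p * m)%N by rewrite {1}nE.
      by rewrite /c exp_ah_log_widen.
    by apply/negP => /small; rewrite ltnn.
  have hX : poly_le v p%:R^-1 ('X^p - 'X^p : {poly Qp}) by rewrite subrr; apply: poly_le0.
  have /congr_mod_poly /(_ n) := poly_frobenius (poly_leXn um p) hX hA.
  by rewrite coefB.
have hc : c n *+ p = (e n - (A ^+ p)`_n) +
    \sum_(i < n) (p%:R ^+ i.+1 / i.+1`!%:R) * e (n - i.+1)%N.
  apply: (addrI (A ^+ p)`_n); rewrite -lhs rhs exp_seriesD ?coefZ ?coefX ?mulr0 //.
    rewrite /series_mul big_ord_recl exp_series_coef0 // mul1r subn0 addrA subrKC.
    by congr (_ + _); apply: eq_bigr => i _; rewrite exp_seriesZX.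
  by rewrite -horner_coef0 horner_comp hornerXn expr0n gtn_eqF // horner_coef0.
have : v (c n *+ p) <= p%:R^-1.
  rewrite hc; apply: (uabsD_le um) => //; apply: (uabs_sum_le um) => // i _.
  rewrite mulrC; apply: (uabsM_le1 um); first by apply: he; lia.
  exact: (uabs_expX_fact um pp vp).
by rewrite -[c n *+ p]mulr_natr (uabsM um) vp ger_pMl // inv_prime_gt0.
Qed.

End PadicIntegers.

(** * Logarithms attached to ghost sequences *)

Definition seq_log (F : fieldType) (p : nat) (a : nat -> F) (J : nat) : {poly F} :=
  \sum_(j < J) (a j / (p ^ j)%:R) *: 'X^(p ^ j).

Lemma seq_log_coef0 (F : fieldType) p (a : nat -> F) J : (0 < p)%N ->
  (seq_log p a J)`_0 = 0.
Proof.
move=> p0; rewrite coef_sum big1 // => j _.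
by rewrite coefZ coefXn eq_sym expn_eq0 (gtn_eqF p0) mulr0.
Qed.

(** Group by component, with j = i + l: the factor p^i of the ghost turns the denominator p^j into
    p^l, and the sequence [a] is shifted by i. *)
Lemma sum_ghost_comp (F : fieldType) p (a : nat -> F) (f : nat -> {poly F}) J :
  (p%:R : F) != 0 ->
  \sum_(j < J) (a j / (p ^ j)%:R) *: ghost p f j =
  \sum_(i < J) (seq_log p (fun l => a (i + l)%N) (J - i) \Po f i).
Proof.
move=> p0; transitivity (\sum_(i < J) \sum_(l < J - i)
    (a (i + l)%N / (p ^ l)%:R) *: f i ^+ (p ^ l)).
  rewrite -(sum_triangle (fun i l => (a (i + l)%N / (p ^ l)%:R) *: f i ^+ (p ^ l))).
  apply: eq_bigr => j _; rewrite ghostE scaler_sumr; apply: eq_bigr => i _.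
  have hi : (i <= j)%N by rewrite -ltnS.
  rewrite -scaler_nat scalerA subnKC //; congr (_ *: _).
  have -> : (p ^ j)%:R = (p ^ (j - i))%:R * (p ^ i)%:R :> F.
    by rewrite -natrM -expnD subnK.
  by rewrite invfM mulrA mulfVK // natrX expf_neq0.
apply: eq_bigr => i _; rewrite /seq_log raddf_sum; apply: eq_bigr => l _ /=.
by rewrite comp_polyZ comp_Xn_poly.
Qed.

(** These components are homogeneous of matching weights, so a ghost relation between constants
    becomes one between multiples of X^(p^j). *)
Lemma ghost_monomial (F : fieldType) p (l : nat -> F) j :
  ghost p (fun i => l i *: 'X^(p ^ i)) j = ghost p l j *: 'X^(p ^ j).
Proof.
rewrite !ghostE scaler_suml; apply: eq_bigr => i _.
rewrite exprZn -exprM -expnD subnKC; last by rewrite -ltnS.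
by rewrite scalerMnl.
Qed.

Lemma ghost_inj (A : idomainType) p (p_neq0 : (p%:R : A) != 0) (x y : nat -> A) J :
  (forall j, (j < J)%N -> ghost p x j = ghost p y j) ->
  forall j, (j < J)%N -> x j = y j.
Proof.
move=> h; elim/ltn_ind => j IH hj; have := h j hj.
rewrite !ghostE !big_ord_recr /= !subnn !expr1.
have -> : \sum_(i < j) x i ^+ (p ^ (j - i)) *+ p ^ i =
          \sum_(i < j) y i ^+ (p ^ (j - i)) *+ p ^ i.
  by apply: eq_bigr => i _; rewrite IH // (ltn_trans (ltn_ord i)).
move/addrI; rewrite -[x j *+ _]mulr_natr -[y j *+ _]mulr_natr natrX.
by apply/mulIf/expf_neq0.
Qed.

Section CharZero.
Context (F : fieldType) (p : nat).
Hypothesis p_neq0 : (p%:R : F) != 0.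

Lemma ghost_surj (b : nat -> F) J :
  exists x : nat -> F, forall j, (j < J)%N -> ghost p x j = b j.
Proof.
elim: J => [|J [x hx]]; first by exists (fun=> 0).
pose y := (b J - \sum_(i < J) x i ^+ (p ^ (J - i)) *+ p ^ i) / p%:R ^+ J.
exists (fun j => if j == J then y else x j) => j.
rewrite ltnS leq_eqVlt => /orP[/eqP->|hj]; last first.
  rewrite -hx //; apply: eq_ghost => i hi.
  by rewrite ltn_eqF // (leq_ltn_trans hi).
rewrite ghostE big_ord_recr /= eqxx subnn expr1 -[y *+ _]mulr_natr natrX.
rewrite divfK ?expf_neq0 // addrC -[RHS](subrK (\sum_(i < J) x i ^+ (p ^ (J - i)) *+ p ^ i)).
congr (_ + _); apply: eq_bigr => i _.
by rewrite ltn_eqF.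
Qed.

End CharZero.

(** * Bounding Witt components from approximate ghosts *)

Section Perturbation.
Context (R : realType) (F : fieldType) (v : F -> R) (p : nat).
Hypotheses (um : ultrametric_abs v) (pp : prime p) (vp : v p%:R = p%:R^-1).

Let p0 : (p%:R : F) != 0. Proof. by apply: (uabs_nat_neq0 um pp vp); apply: prime_gt0. Qed.
Let pR1 : 1 <= (p%:R : R). Proof. by rewrite ler1n prime_gt0. Qed.

(** Solving for the j-th component divides by p^j, which enlarges errors by at most D = p^J. Raising
    to powers does not enlarge errors between elements of absolute value at most 1, so the total
    loss stays below D^(J+1), the factor built into the hypothesis. *)
Lemma ghost_perturb (x y : nat -> F) (c : R) J : c <= 1 ->
  (forall i, v (y i) <= c) ->
  (forall j, (j < J)%N ->
     v (ghost p x j - ghost p y j) <= c / (p%:R ^+ J) ^+ J.+1) ->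
  forall j, (j < J)%N -> v (x j) <= c.
Proof.
move=> c1 hy; set D : R := p%:R ^+ J; set e := c / _ => h.
have D1 : 1 <= D by rewrite exprn_ege1.
have c0 : 0 <= c by apply: le_trans (hy 0%N); apply: uabs_ge0 um _.
have e0 : 0 <= e by rewrite divr_ge0 ?exprn_ge0 // (le_trans ler01).
pose d j : R := D ^+ j.+1 * e.
have dc j : (j <= J)%N -> d j <= c.
  move=> hj; rewrite /d /e mulrCA ler_piMr //.
  by rewrite ler_pdivrMr ?exprn_gt0 ?(lt_le_trans ltr01) // mul1r ler_weXn2l.
suff hd j : (j < J)%N -> v (x j - y j) <= d j.
  move=> j hj; rewrite -(subrK (y j) (x j)); apply: (uabsD_le um) => //.
  by apply: le_trans (hd j hj) (dc _ (ltnW hj)).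
elim/ltn_ind: j => j IH hj.
have hx i : (i < j)%N -> v (x i) <= 1.
  move=> hi; have hiJ := ltn_trans hi hj.
  rewrite -(subrK (y i) (x i)); apply: (uabsD_le um); last exact: le_trans (hy i) c1.
  by apply: le_trans (IH i hi hiJ) (le_trans (dc _ (ltnW hiJ)) c1).
have -> : x j - y j = p%:R ^- j * ((ghost p x j - ghost p y j) -
    \sum_(i < j) (x i ^+ (p ^ (j - i)) - y i ^+ (p ^ (j - i))) *+ p ^ i).
  under eq_bigr do rewrite mulrnBl.
  rewrite sumrB !ghostE !big_ord_recr /= !subnn !expr1.
  rewrite -[x j *+ _]mulr_natr -[y j *+ _]mulr_natr natrX.
  by apply: (mulfI (expf_neq0 j p0)); rewrite mulVKf ?expf_neq0 //; ring.
have hD : v (p%:R ^- j) <= D.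
  by rewrite (uabs_pV um vp) ler_weXn2l // ltnW.
rewrite /d exprS -mulrA; apply: (uabsMle um) => //.
apply: (uabsB_le um).
  by apply: le_trans (h j hj) _; rewrite ler_peMl // exprn_ege1.
apply: (uabs_sum_le um) => [|i _]; first by rewrite mulr_ge0 // exprn_ge0 // (le_trans ler01).
have hi := ltn_ord i; have hiJ := ltn_trans hi hj.
apply: (uabsMn_le um); apply: le_trans (uabs_subX um _ (hx _ hi) (le_trans (hy i) c1)) _.
by apply: le_trans (IH i hi hiJ) _; rewrite /d ler_wpM2r // ler_weXn2l.
Qed.

End Perturbation.

Lemma map_iter_comp (E F : fieldType) (f : {rmorphism E -> F}) (Q g : {poly E}) j x :
  (map_poly f (iter j (fun h => h \Po Q) g)).[x] =
  (map_poly f g).[iter j (fun y => (map_poly f Q).[y]) x].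
Proof.
elim: j x => // j IH x.
by rewrite iterS iterSr map_comp_poly horner_comp IH.
Qed.

Section PadicSubfield.
Context (R : realType) (p : nat) (pp : prime p) (Qp F : fieldType).
Context (vQ : Qp -> R) (v : F -> R) (iota : {rmorphism Qp -> F}).
Hypotheses (Qp_padic : is_padic_field p vQ) (um : ultrametric_abs v).
Hypothesis iota_isom : forall x, v (iota x) = vQ x.

Let umQ := padic_abs Qp_padic.

Lemma iota_vp : v p%:R = p%:R^-1.
Proof. by have := iota_isom p%:R; rewrite rmorph_nat (padic_p Qp_padic). Qed.
Let vp := iota_vp.

Let p0 : (p%:R : F) != 0.
Proof. by apply: (uabs_nat_neq0 um pp vp); apply: prime_gt0. Qed.
Let f0 := fact_neq0 um pp vp.

Lemma map_poly_le B g : poly_le vQ B g -> poly_le v B (map_poly iota g).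
Proof. by move=> hg i; rewrite coef_map /= iota_isom. Qed.

Lemma seq_log1 J : seq_log p (fun=> 1) J = map_poly iota (ah_log Qp p J).
Proof.
rewrite /ah_log raddf_sum; apply: eq_bigr => j _ /=.
by rewrite map_polyZ map_polyXn div1r natrX fmorphV rmorphXn /= rmorph_nat.
Qed.

(** [sum_ghost_comp], for the constant sequence 1 and the monomials l_i X^(p^i), writes the
    exponential as a product of Artin-Hasse series in these monomials. *)
Lemma exp_ghost_integral (l : nat -> F) J n :
  (forall i, (i < J)%N -> v (l i) <= 1) ->
  (n < p ^ J)%N -> v (exp_series (seq_log p (ghost p l) J) n) <= 1.
Proof.
move=> hl hn; have pg0 := prime_gt0 pp.
have -> : seq_log p (ghost p l) J =
    \sum_(i < J) (seq_log p (fun=> 1) (J - i) \Po (l i *: 'X^(p ^ i))).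
  rewrite -(sum_ghost_comp (fun=> 1) (fun i => l i *: 'X^(p ^ i)) J p0).
  apply: eq_bigr => j _; rewrite ghost_monomial scalerA; congr (_ *: _).
  by rewrite mul1r mulrC.
pose ok (g : {poly F}) := g`_0 = 0 /\ forall m, (m <= n)%N -> v (exp_series g m) <= 1.
suff [_ /(_ n (leqnn n))//] :
    ok (\sum_(i < J) (seq_log p (fun=> 1) (J - i) \Po (l i *: 'X^(p ^ i)))).
have Xl0 i : (l i *: 'X^(p ^ i))`_0 = 0.
  by rewrite coefZ coefXn eq_sym expn_eq0 (gtn_eqF pg0) mulr0.
elim/big_ind: _ => [|g h [g0 hg] [h0 hh]|i _].
- split=> [|m _]; first by rewrite coef0.
  by rewrite exp_series0 (uabs_nat um).
- split=> [|m hm]; first by rewrite coefD g0 h0 addr0.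
  by rewrite exp_seriesD //; apply: (series_mul_le um) => k hk;
    [apply: hg|apply: hh]; apply: leq_trans hm.
- split=> [|m hm].
    by rewrite -horner_coef0 horner_comp horner_coef0 Xl0 horner_coef0 seq_log_coef0.
  rewrite exp_series_comp ?seq_log_coef0 //.
  apply: (uabs_sum_le um) => [|k _]; first exact: ler01.
  rewrite exprZn coefZ -exprM coefXn; case: eqP => [mE|_]; last first.
    by rewrite !mulr0 uabs0 ?ler01.
  rewrite mulr1 seq_log1 exp_series_map mulrC.
  apply: (uabsM_le1 um); first by apply: (uabsX_le1 um); apply: hl.
  (* Only k with p^i k = m contributes, and m < p^J gives k < p^(J-i), the range in which the
     truncated logarithm has integral exponential coefficients. *)
  rewrite iota_isom; apply: (artin_hasse_integral pp Qp_padic).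
  have hi := ltn_ord i.
  have : (p ^ i * k < p ^ i * p ^ (J - i))%N.
    by rewrite -mE -expnD subnKC ?(ltnW hi) //; apply: leq_ltn_trans hn.
  by rewrite ltn_pmul2l // expn_gt0 pg0.
Qed.

(* The polynomials Q stand for truncations of the Lubin-Tate series; the
   Frobenius lift of Z_p[Z] used in Dwork's lemma is g(Z) |-> g(Q(Z)). *)
Lemma ghost_approx (x : F) (b : nat -> F) J : x != 0 -> v x <= 1 ->
  (forall e : R, 0 < e -> exists Q g : {poly Qp},
     [/\ poly_le vQ 1 Q, poly_le vQ p%:R^-1 (Q - 'X^p), Q`_0 = 0,
         poly_le vQ 1 g & g`_0 = 0] /\
     forall j, (j < J)%N ->
       v (b j - (map_poly iota g).[iter j (fun y => (map_poly iota Q).[y]) x]) <= e) ->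
  exists2 m : nat -> F, (forall j, (j < J)%N -> v (m j) <= v x) &
    forall j, (j < J)%N -> ghost p m j = b j.
Proof.
move=> x0 x1 hb; have vx0 := uabs_neq0 um x0.
(* Over a field with p nonzero the ghost equations always have a solution [m]. Only its size is in
   question, so one approximation of sufficient precision is enough. *)
have [m hm] := ghost_surj p0 b J; exists m => //.
have [|Q [g [[hQ hQp Q0 hg g0] hQg]]] := hb (v x / (p%:R ^+ J) ^+ J.+1).
  by rewrite divr_gt0 // !exprn_gt0 // ltr0n prime_gt0.
pose sg : {rmorphism {poly Qp} -> {poly Qp}} := comp_poly Q.
have C1 := @poly_le1 _ _ _ umQ; have CN := @poly_leN _ _ _ umQ 1.
have CD := @poly_leD _ _ _ umQ 1; have CM := fun g h => @poly_leM1 _ _ _ umQ 1 g h.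
have sgI h : poly_le vQ 1 h -> poly_le vQ 1 (sg h) by move=> hh; apply: poly_le_comp.
have sgF h : poly_le vQ 1 h -> congr_mod (poly_le vQ 1) p (sg h) (h ^+ p).
  exact: (poly_frobenius pp Qp_padic hQ hQp).
have [j|y hy gy] := @dwork_ghost {poly Qp} (poly_le vQ 1) p pp C1 CN CD CM sg sgI sgF
    (fun j => iter j (fun h => h \Po Q) g) J hg.
  exact: congr_mod_refl.
have pQ0 : (p%:R : Qp) != 0.
  by apply: (uabs_nat_neq0 umQ pp (padic_p Qp_padic)); apply: prime_gt0.
(* Vanishing constant terms improve |y_j(x)| <= 1 to |y_j(x)| <= |x|. At Z = 0 all the ghosts vanish
   because [Q] and [g] do, and ghosts determine the components. *)
have y0 j : (j < J)%N -> (y j)`_0 = 0.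
  move=> hj; rewrite -horner_coef0.
  apply: (ghost_inj pQ0 (x := fun j => (y j).[0]) (y := fun=> 0) (J := J)) hj => {}j hj.
  have -> : ghost p (fun j => (y j).[0]) j = (ghost p y j).[0].
    by rewrite -[RHS]/(horner_eval 0 _) (ghost_map (horner_eval 0)).
  rewrite gy //.
  have -> : (iter j (fun h => h \Po Q) g).[0] = 0.
    elim: (j) => [|k IH]; first by rewrite /= horner_coef0.
    by rewrite iterS horner_comp [Q.[0]]horner_coef0 Q0.
  rewrite ghostE big1 // => i _.
  by rewrite expr0n (gtn_eqF (_ : 0 < _)%N) ?mul0rn // expn_gt0 prime_gt0.
pose y' j := if (j < J)%N then (map_poly iota (y j)).[x] else 0.
have hy' j : v (y' j) <= v x.
  rewrite /y'; case: ifP => hj; last by rewrite uabs0 // ltW.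
  apply: (uabs_horner0 um) => //; first exact: map_poly_le.
  by rewrite coef_map y0 //= rmorph0.
apply: (ghost_perturb um pp vp x1 hy') => j hj.
have -> : ghost p y' j = (map_poly iota (ghost p y j)).[x].
  rewrite -[RHS]/((horner_eval x \o map_poly iota) _).
  rewrite (ghost_map (horner_eval x \o map_poly iota)).
  by apply: eq_ghost => i hi; rewrite /y' (leq_ltn_trans hi hj).
by rewrite gy // hm // map_iter_comp; apply: hQg.
Qed.

End PadicSubfield.

(** * Overconvergent exponentials *)

Section Overconvergence.
Context (R : realType) (F : fieldType) (v : F -> R).
Hypotheses (um : ultrametric_abs v) (f0 : forall n, (n`!%:R : F) != 0).
Implicit Types g h : {poly F}.

Definition geometric (c : nat -> F) : Prop :=
  exists r M : R, [/\ 0 < r, r < 1, 0 <= M & forall n, v (c n) <= M * r ^+ n].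

Lemma geometric_mul c d : geometric c -> geometric d -> geometric (series_mul c d).
Proof.
move=> [r [M [r0 r1 M0 hc]]] [s [N [s0 s1 N0 hd]]].
exists (Num.max r s), (M * N); split; rewrite ?lt_max ?r0 ?gt_max ?r1 ?mulr_ge0 // => n.
apply: (uabs_sum_le um) => [|i _].
  by rewrite !mulr_ge0 // exprn_ge0 // le_max (ltW r0).
have -> : Num.max r s ^+ n = Num.max r s ^+ i * Num.max r s ^+ (n - i).
  by rewrite -exprD subnKC // -ltnS.
rewrite mulrACA; apply: (uabsMle um).
  apply: le_trans (hc i) _; rewrite ler_wpM2l // lerXn2r ?nnegrE ?le_max ?lexx ?(ltW r0) //.
apply: le_trans (hd _) _.
by rewrite ler_wpM2l // lerXn2r ?nnegrE ?le_max ?lexx ?(ltW r0) ?(ltW s0) ?orbT.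
Qed.

Lemma eq_geometric c d : c =1 d -> geometric c -> geometric d.
Proof. by move=> e [r [M [? ? ? h]]]; exists r, M; split=> // n; rewrite -e. Qed.

Lemma geometric_expD g h : g`_0 = 0 -> h`_0 = 0 ->
  geometric (exp_series g) -> geometric (exp_series h) ->
  geometric (exp_series (g + h)).
Proof.
move=> g0 h0 hg hh; apply: eq_geometric (geometric_mul hg hh) => n.
by rewrite exp_seriesD.
Qed.

Lemma geometric_exp0 : geometric (exp_series (0 : {poly F})).
Proof.
exists 2^-1, 1; split=> [||//|n]; rewrite ?invr_gt0 ?invf_lt1 ?ltr0n ?ltr1n //.
rewrite exp_series0 mul1r; case: n => [|n]; first by rewrite expr0 uabs1.
by rewrite uabs0 // exprn_ge0 ?invr_ge0.
Qed.

Lemma geometric_expMn g k : g`_0 = 0 ->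
  geometric (exp_series g) -> geometric (exp_series (g *+ k)).
Proof.
move=> g0 hg; elim: k => [|k IH]; first exact: geometric_exp0.
by rewrite mulrS; apply: geometric_expD => //; rewrite coefMn g0 mul0rn.
Qed.

(** Requiring both signs makes these logarithms a group, so that overconvergent factors can be moved
    across a quotient. *)
Definition good_log g :=
  [/\ g`_0 = 0, geometric (exp_series g) & geometric (exp_series (- g))].

Lemma good_log0 : good_log 0.
Proof. by split; rewrite ?coef0 ?oppr0; try exact: geometric_exp0. Qed.

Lemma good_logD g h : good_log g -> good_log h -> good_log (g + h).
Proof.
move=> [g0 hg hgN] [h0 hh hhN]; split; first by rewrite coefD g0 h0 addr0.
  exact: geometric_expD.
by rewrite opprD; apply: geometric_expD; rewrite ?coefN ?g0 ?h0 ?oppr0.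
Qed.

Lemma good_logN g : good_log g -> good_log (- g).
Proof. by case=> g0 ? ?; split; rewrite ?opprK // coefN g0 oppr0. Qed.

Lemma good_log_sum (I : Type) (r : seq I) (P : pred I) (E : I -> {poly F}) :
  (forall i, P i -> good_log (E i)) -> good_log (\sum_(i <- r | P i) E i).
Proof. by move=> h; elim/big_ind: _ => //; [exact: good_log0|exact: good_logD]. Qed.

Lemma bernoulli (x : R) d : 0 <= x -> x <= 1 -> 1 - d%:R * x <= (1 - x) ^+ d.
Proof.
move=> x0 x1; elim: d => [|d IH]; first by rewrite mul0r subr0 expr0.
rewrite exprS; apply: le_trans (_ : (1 - x) * (1 - d%:R * x) <= _); last first.
  by rewrite ler_wpM2l // subr_ge0.
rewrite -natr1 -subr_ge0.
have -> : (1 - x) * (1 - d%:R * x) - (1 - (d%:R + 1) * x) = d%:R * x ^+ 2 by ring.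
by rewrite mulr_ge0 // sqr_ge0.
Qed.

Lemma comp_poly_coef0 (G f : {poly F}) : G`_0 = 0 -> f`_0 = 0 -> (G \Po f)`_0 = 0.
Proof. by move=> G0 h; rewrite -horner_coef0 horner_comp !horner_coef0 h horner_coef0. Qed.

(** As [f] is a polynomial, f^m reaches degree n only when n <= d m for a suitable d. Up to the
    factor [M], the surviving terms are at most (c B)^m, which is at most r^(d m) <= r^n once c B <=
    r^d. *)
Lemma geometric_exp_comp (G f : {poly F}) (c M B : R) :
  G`_0 = 0 -> f`_0 = 0 -> (forall m, v (exp_series G m) <= M * c ^+ m) ->
  poly_le v B f -> 0 <= c -> 0 <= M -> c * B < 1 ->
  geometric (exp_series (G \Po f)).
Proof.
move=> G0 h0 hG hf c0 M0 q1; have B0 := poly_le_ge0 um hf.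
set q := c * B in q1; have q0 : 0 <= q by rewrite mulr_ge0.
(* Bernoulli's inequality gives q <= (1 - x)^d for x = (1 - q) / d without extracting a d-th root.
   The added 2 ensures d > 1, hence x < 1. *)
pose d := (size f).+2; have d0 : 0 < (d%:R : R) by rewrite ltr0n.
pose x : R := (1 - q) / d%:R.
have x0 : 0 < x by rewrite divr_gt0 // subr_gt0.
have x1 : x < 1.
  by rewrite ltr_pdivrMr // mul1r; apply: le_lt_trans (_ : _ <= 1) _; rewrite ?gerBl ?ltr1n.
have r0 : 0 < 1 - x by rewrite subr_gt0.
have hq : q <= (1 - x) ^+ d.
  apply: le_trans (bernoulli d (ltW x0) (ltW x1)).
  by rewrite /x mulrC divfK ?gt_eqF // opprB addrC subrK.
exists (1 - x), M; split=> [|||n] //; first by rewrite gtrBl.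
rewrite exp_series_comp //; apply: (uabs_sum_le um) => [|m _].
  by rewrite mulr_ge0 // exprn_ge0 // ltW.
have [hn|hn] := leqP n (d * m).
  apply: le_trans (_ : M * q ^+ m <= _).
    by rewrite exprMn mulrA; apply: (uabsMle um) => //; apply: poly_leX.
  rewrite ler_wpM2l //; apply: le_trans (_ : ((1 - x) ^+ d) ^+ m <= _).
    by rewrite lerXn2r ?nnegrE // exprn_ge0 // ltW.
  by rewrite -exprM ler_wiXn2l // ?ltW // gtrBl.
rewrite [(f ^+ m)`__]nth_default ?mulr0 ?uabs0 //.
  by rewrite mulr_ge0 // exprn_ge0 // ltW.
apply: leq_trans (size_poly_exp_leq _ _) _; rewrite /d in hn *; nia.
Qed.

Lemma exp_seriesN_integral g : g`_0 = 0 ->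
  (forall n, v (exp_series g n) <= 1) -> forall n, v (exp_series (- g) n) <= 1.
Proof.
move=> g0 hg n; elim/ltn_ind: n => [[|n] IH]; first by rewrite exp_series_coef0 uabs1.
have := exp_seriesN f0 n.+1 g0; rewrite /series_mul big_ord_recl /= subn0.
rewrite exp_series_coef0 mul1r => /eqP; rewrite addr_eq0 => /eqP ->.
rewrite uabsN //; apply: (uabs_sum_le um) => [|i _]; first exact: ler01.
by apply: (uabsM_le1 um) => //; apply: IH; rewrite /bump /= add1n; lia.
Qed.

Lemma good_log_comp_small (G f : {poly F}) : G`_0 = 0 ->
  (forall n, v (exp_series G n) <= 1) -> f`_0 = 0 -> (forall i, v f`_i < 1) ->
  good_log (G \Po f).
Proof.
move=> G0 hG h0 hf; have [B B1 hB] := poly_le_strict um hf.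
have aux (H : {poly F}) : H`_0 = 0 -> (forall n, v (exp_series H n) <= 1) ->
    geometric (exp_series (H \Po f)).
  move=> H0 hH; apply: (geometric_exp_comp (c := 1) (M := 1) (B := B)) => //.
    by move=> m; rewrite expr1n mulr1.
  by rewrite mul1r.
split; [exact: comp_poly_coef0 | exact: aux |].
have -> : - (G \Po f) = (- G) \Po f by rewrite raddfN.
apply: aux; first by rewrite coefN G0 oppr0.
exact: exp_seriesN_integral.
Qed.

Lemma good_log_comp (G f : {poly F}) : good_log G -> f`_0 = 0 -> poly_le v 1 f ->
  good_log (G \Po f).
Proof.
move=> [G0 hG hGN] h0 hf.
have aux (H : {poly F}) : H`_0 = 0 -> geometric (exp_series H) ->
    geometric (exp_series (H \Po f)).
  move=> H0 [r [M [r0 r1 M0 hH]]].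
  by apply: (geometric_exp_comp (c := r) (M := M) (B := 1)) => //; rewrite ?mulr1 // ltW.
split; [exact: comp_poly_coef0 | exact: aux |].
have -> : - (G \Po f) = (- G) \Po f by rewrite raddfN.
by apply: aux; rewrite // coefN G0 oppr0.
Qed.

(** The bound |p^k / k!| <= 1 leaves the decay |x|^k. The factor x matters: for p = 2, exp(2 X) has
    radius of convergence exactly 1. *)
Lemma good_log_pX p (x : F) (f : {poly F}) :
  prime p -> v p%:R = p%:R^-1 -> v x < 1 -> f`_0 = 0 -> poly_le v 1 f ->
  good_log ((p%:R * x) *: f).
Proof.
move=> pp vp x1 h0 hf.
have aux y : v y < 1 -> geometric (exp_series ((p%:R * y) *: 'X)).
  move=> y1; rewrite -[X in exp_series X]comp_polyXr.
  apply: (geometric_exp_comp (c := v y) (M := 1) (B := 1)); rewrite ?coefZ ?coefX ?mulr0 //.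
  - case=> [|m]; first by rewrite exp_series_coef0 uabs1 // mul1r.
    rewrite exp_seriesZX exprMn mulrAC (uabsM um) mul1r uabsX //.
    rewrite ler_piMl ?exprn_ge0 ?(uabs_ge0 um) //.
    exact: le_trans (uabs_expX_fact um pp vp (ltn0Sn m)) (ltW (inv_prime_lt1 R pp)).
  - by rewrite -['X]expr1; apply: poly_leXn.
  - exact: uabs_ge0 um _.
  - by rewrite mulr1.
have -> : (p%:R * x) *: f = ((p%:R * x) *: 'X) \Po f by rewrite comp_polyZ comp_polyX.
apply: good_log_comp => //; split; [by rewrite coefZ coefX mulr0|exact: aux|].
by rewrite -scaleNr -mulrN; apply: aux; rewrite uabsN.
Qed.

End Overconvergence.

(** * Lubin-Tate exponentials *)

Section LubinTateExponentials.
Context (R : realType) (p : nat) (pp : prime p) (Qp F : fieldType).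
Context (vQ : Qp -> R) (v : F -> R) (iota : {rmorphism Qp -> F}).
Hypotheses (Qp_padic : is_padic_field p vQ) (um : ultrametric_abs v).
Hypothesis iota_isom : forall x, v (iota x) = vQ x.
Context (P : nat -> Qp) (P_LT : lubin_tate_series p vQ P).
Context (pi : nat -> F) (pi_gen : tate_generator v iota P pi).

Let umQ := padic_abs Qp_padic.
Let vp := iota_vp Qp_padic iota_isom.
Let p0 : (p%:R : F) != 0.
Proof. by apply: (uabs_nat_neq0 um pp vp); apply: prime_gt0. Qed.
Let f0 := fact_neq0 um pp vp.

Lemma pi_neq0 j : pi j != 0.
Proof.
elim: j => [|j IH]; first exact: tate_neq0 pi_gen.
apply: contra_neq IH => e; apply/(uabs_eq0 um)/le_anti.
rewrite (uabs_ge0 um) andbT; apply/ler_addgt0Pl => d d0; rewrite addr0.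
have [N /(_ N.+1 (leqnSn N))] := tate_step pi_gen j d0.
rewrite e big_ord_recl big1 ?addr0 => [|i _]; last by rewrite expr0n mulr0.
by rewrite /= (lt_coef0 P_LT) rmorph0 mul0r sub0r uabsN // => /ltW.
Qed.

(** The orbit of pi_M under P. It continues by 0 because P(pi_0) = 0 and P(0) = 0, so it is
    available at every length. *)
Definition pi_down M j := if (j <= M)%N then pi (M - j) else 0.

Lemma pi_down_shift M i l : pi_down M (i + l) = if (i <= M)%N then pi_down (M - i) l else 0.
Proof.
rewrite /pi_down; case: leqP => h; case: leqP => h' //; last first.
- by rewrite leqNgt (_ : (M - i < l)%N) //; lia.
- by move: h; lia.
- by rewrite leq_subRL // h subnDA.
Qed.

Definition lt_trunc N : {poly Qp} := \poly_(i < N) P i.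

Lemma horner_lt_trunc N x :
  (map_poly iota (lt_trunc N)).[x] = \sum_(i < N) iota (P i) * x ^+ i.
Proof.
have -> : map_poly iota (lt_trunc N) = \poly_(i < N) iota (P i).
  by apply/polyP => i; rewrite coef_map !coef_poly; case: ifP => //= _; rewrite rmorph0.
by rewrite horner_poly.
Qed.

Lemma lt_trunc_int N : poly_le vQ 1 (lt_trunc N).
Proof.
move=> i; rewrite coef_poly; case: ifP => _; first exact: lt_int P_LT i.
by rewrite uabs0.
Qed.

Lemma lt_trunc_frob N : (p < N)%N -> poly_le vQ p%:R^-1 (lt_trunc N - 'X^p).
Proof.
move=> hN i; rewrite coefB coefXn coef_poly; case: ltnP => hi.
  have [z hz ->] := lt_modp P_LT i.
  by rewrite (uabsM umQ) (padic_p Qp_padic) ler_piMr // ltW // inv_prime_gt0.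
rewrite (_ : (i == p) = false) ?subr0 ?uabs0 //; first exact/ltW/inv_prime_gt0.
by apply/negP => /eqP; lia.
Qed.

Lemma lt_trunc_coef0 N : (lt_trunc N)`_0 = 0.
Proof. by rewrite coef_poly (lt_coef0 P_LT) if_same. Qed.

(** The three cases are a step of the Tate module, the fixed point 0 and the root pi_0. The
    tolerance depends on [j] because [pi_down_quotient_ghost] divides by the j-th term of the
    orbit. *)
Lemma lt_trunc_approx M J (e : nat -> R) : (forall j, 0 < e j) ->
  exists N0, forall N, (N0 <= N)%N -> forall j, (j < J)%N ->
    v ((map_poly iota (lt_trunc N)).[pi_down M j] - pi_down M j.+1) <= e j.
Proof.
move=> e0; elim: J => [|J [N1 h1]]; first by exists 0%N.
suff [N2 h2] : exists N2, forall N, (N2 <= N)%N ->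
    v ((map_poly iota (lt_trunc N)).[pi_down M J] - pi_down M J.+1) <= e J.
  exists (maxn N1 N2) => N; rewrite geq_max => /andP[hN1 hN2] j.
  by rewrite ltnS leq_eqVlt => /orP[/eqP->|]; [exact: h2|exact: h1].
have lim x y : pseries_at v (iota \o P) x y -> exists N2, forall N, (N2 <= N)%N ->
    v ((map_poly iota (lt_trunc N)).[x] - y) <= e J.
  move=> /(_ _ (e0 J))[N2 h2]; exists N2 => N hN.
  by rewrite horner_lt_trunc; apply/ltW/h2.
rewrite /pi_down; case: (ltngtP J M) => hJ.
- apply: lim; rewrite -subSS subSn //; exact: tate_step pi_gen _.
- exists 0%N => N _; rewrite subr0 horner_coef0 coef_map lt_trunc_coef0 /= rmorph0.
  by rewrite uabs0 // ltW.
- by rewrite (_ : (M - J = 0)%N); [apply: lim; exact: tate_root pi_gen | lia].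
Qed.

Lemma pi_down_le1 M j : v (pi_down M j) <= 1.
Proof.
rewrite /pi_down; case: ifP => _; last by rewrite uabs0.
exact/ltW/(tate_lt1 pi_gen).
Qed.

(** An integral polynomial is 1-Lipschitz on the closed unit disc, so one-step errors do not
    accumulate along the orbit. *)
Lemma iter_lt_trunc M J N (e : R) :
  (forall j, (j < J)%N ->
    v ((map_poly iota (lt_trunc N)).[pi_down M j] - pi_down M j.+1) <= e) ->
  0 <= e -> forall j, (j <= J)%N ->
    let y := iter j (fun y => (map_poly iota (lt_trunc N)).[y]) (pi M) in
    v y <= 1 /\ v (y - pi_down M j) <= e.
Proof.
move=> h e0; elim=> [|j IH] hj /=.
  by rewrite /pi_down subn0 subrr uabs0 //; split=> //; apply/ltW/(tate_lt1 pi_gen).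
have [y1 hy] := IH (ltnW hj); set y := iter _ _ _ in y1 hy *.
have hQ : poly_le v 1 (map_poly iota (lt_trunc N)).
  exact: (map_poly_le iota_isom (lt_trunc_int N)).
split; first exact: (uabs_horner um ler01 hQ y1).
set Q := map_poly _ _ in hQ *.
have -> : Q.[y] - pi_down M j.+1 =
    (Q.[y] - Q.[pi_down M j]) + (Q.[pi_down M j] - pi_down M j.+1).
  by rewrite addrA subrK.
apply: (uabsD_le um); last exact: h.
by apply: le_trans (uabs_horner_sub um hQ y1 (pi_down_le1 M j)) hy.
Qed.

Lemma pi_down_ghost M J :
  exists2 m : nat -> F, (forall j, (j < J)%N -> v (m j) <= v (pi M)) &
    forall j, (j < J)%N -> ghost p m j = pi_down M j.
Proof.
apply: (ghost_approx pp Qp_padic um iota_isom); first exact: pi_neq0.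
  exact/ltW/(tate_lt1 pi_gen).
move=> e e0; have [N0 hN0] := @lt_trunc_approx M J (fun=> e) (fun=> e0).
pose N := maxn N0 p.+1; exists (lt_trunc N), 'X; split.
  split; rewrite ?coefX //; [exact: lt_trunc_int| | exact: lt_trunc_coef0|].
    by apply: lt_trunc_frob; rewrite /N; lia.
  by rewrite -['X]expr1; apply: poly_leXn.
move=> j hj; rewrite map_polyX hornerX uabs_subC //.
by have [] := iter_lt_trunc (hN0 N (leq_maxl _ _)) (ltW e0) (ltnW hj).
Qed.

(* The values of the series k with p Z - P(Z) = Z k(Z); it vanishes at 0
   because P(Z) = p Z modulo Z^2. *)
Lemma pi_down_quotient_ghost M :
  exists2 m : nat -> F, (forall j, (j < M.+1)%N -> v (m j) <= v (pi M)) &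
    forall j, (j < M.+1)%N ->
      pi_down M j * ghost p m j = p%:R * pi_down M j - pi_down M j.+1.
Proof.
pose b j := (p%:R * pi_down M j - pi_down M j.+1) / pi_down M j.
suff [m hm hb] : exists2 m : nat -> F, (forall j, (j < M.+1)%N -> v (m j) <= v (pi M)) &
    forall j, (j < M.+1)%N -> ghost p m j = b j.
  exists m => // j hj; rewrite hb // /b mulrC divfK //.
  by rewrite /pi_down -ltnS hj pi_neq0.
apply: (ghost_approx pp Qp_padic um iota_isom); first exact: pi_neq0.
  exact/ltW/(tate_lt1 pi_gen).
move=> e e0.
(* The factor |pi_(M-j)| compensates the division in [b]; the minimum with 1 keeps the tolerance
   below [e] along the orbit itself. *)
pose d j := e * Num.min 1 (v (pi (M - j))).
have d0 j : 0 < d j by rewrite mulr_gt0 // lt_min ltr01 (uabs_neq0 um) // pi_neq0.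
have [N0 hN0] := @lt_trunc_approx M M.+1 d d0.
pose N := (maxn N0 p.+1).+1.
(* [g] truncates k: the coefficient of X in p X - P(X) is p - p, hence the 0 at index 0. *)
pose g : {poly Qp} := - \poly_(i < N.-1) (if i == 0%N then 0 else P i.+1).
have gE : g * 'X = p%:R *: 'X - lt_trunc N.
  apply/polyP => -[|i]; rewrite coefMX coefB coefZ coefX /lt_trunc coef_poly.
    by rewrite (lt_coef0 P_LT) mulr0; case: (0 < N)%N; rewrite subr0.
  rewrite /= /g coefN coef_poly /= ltnS.
  case: i => [|i]; last by rewrite /= mulr0 sub0r.
  by rewrite leq_max orbT /= (lt_coef1 P_LT) mulr1 subrr oppr0.
have g1 : poly_le vQ 1 g.
  move=> i; rewrite coefN uabsN // coef_poly; case: ifP => _; last by rewrite uabs0.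
  by case: ifP => _; [rewrite uabs0 | exact: lt_int P_LT _].
exists (lt_trunc N), g; split.
  split=> //; [exact: lt_trunc_int| |exact: lt_trunc_coef0|].
    by apply: lt_trunc_frob; rewrite /N; lia.
  by rewrite coefN coef_poly eqxx if_same oppr0.
have hN j : (j < M.+1)%N ->
    v ((map_poly iota (lt_trunc N)).[pi_down M j] - pi_down M j.+1) <= d j.
  by apply: hN0; rewrite /N; lia.
move=> j hj; have aj : pi_down M j = pi (M - j) by rewrite /pi_down -ltnS hj.
have de i : d i <= e by rewrite /d ler_piMr ?(ltW e0) // ge_min lexx.
have [y1 hy] := iter_lt_trunc (fun i hi => le_trans (hN i hi) (de i)) (ltW e0) (ltnW hj).
set y := iter _ _ _ in y1 hy *; set gL := map_poly iota g.
have gL1 : poly_le v 1 gL by exact: (map_poly_le iota_isom g1).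
have -> : b j - gL.[y] = (b j - gL.[pi_down M j]) - (gL.[y] - gL.[pi_down M j]).
  by rewrite opprB addrA subrK.
apply: (uabsB_le um); last first.
  exact: le_trans (uabs_horner_sub um gL1 y1 (pi_down_le1 M j)) hy.
have a0 : pi_down M j != 0 by rewrite aj pi_neq0.
rewrite -(ler_pM2r (uabs_neq0 um a0)) -(uabsM um) mulrBl /b divfK //.
have -> : gL.[pi_down M j] * pi_down M j =
    p%:R * pi_down M j - (map_poly iota (lt_trunc N)).[pi_down M j].
  rewrite -[X in _ * X]hornerX -hornerM -(map_polyX iota) -rmorphM /= gE.
  by rewrite raddfB /= map_polyZ map_polyX rmorph_nat hornerD hornerN hornerZ hornerX.
rewrite opprB addrC addrA subrK uabs_subC //.
apply: le_trans (_ : d j <= _); last by rewrite aj /d ler_wpM2l ?(ltW e0) // ge_min lexx orbT.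
by rewrite uabs_subC // hN.
Qed.

(** The logarithm of E_m. *)
Definition lt_log m : {poly F} := seq_log p (pi_down m) m.+1.

Lemma lt_log_coef0 m : (lt_log m)`_0 = 0.
Proof. exact: seq_log_coef0 (prime_gt0 pp). Qed.

(** The orbit can be padded with zeros to any length [J] without changing the logarithm, so [J] may
    be taken large enough for degree n. *)
Lemma exp_lt_log_integral m n : v (exp_series (lt_log m) n) <= 1.
Proof.
pose J := (n + m).+1.
have [mu hmu gmu] := pi_down_ghost m J.
have -> : lt_log m = seq_log p (ghost p mu) J.
  rewrite /lt_log /seq_log (_ : J = (m.+1 + n)%N); last by rewrite /J; lia.
  rewrite big_split_ord /= [X in _ = _ + X]big1 ?addr0 => [|i _].
    by apply: eq_bigr => i _; rewrite gmu // /J; have := ltn_ord i; lia.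
  rewrite gmu; last by rewrite /J; have := ltn_ord i; lia.
  by rewrite /pi_down ifF ?mul0r ?scale0r //; apply/negbTE; rewrite -ltnNge ltnS leq_addr.
apply: (exp_ghost_integral pp Qp_padic um iota_isom) => [i hi|].
  exact: le_trans (hmu i hi) (ltW (tate_lt1 pi_gen m)).
apply: leq_trans (ltn_expl _ (prime_gt1 pp)) _.
by rewrite leq_exp2l ?prime_gt1 // /J; lia.
Qed.

(** Only the components of index at most [m] enter, so the level can be lowered while keeping the
    same sequence [f]. *)
Definition witt_log m (f : nat -> {poly F}) : {poly F} :=
  \sum_(j < m.+1) (pi_down m j / (p ^ j)%:R) *: ghost p f j.

Lemma witt_logE m f : witt_log m f = \sum_(i < m.+1) (lt_log (m - i) \Po f i).
Proof.
rewrite /witt_log (sum_ghost_comp (pi_down m) f m.+1 p0); apply: eq_bigr => i _.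
have hi : (i <= m)%N by rewrite -ltnS.
rewrite subSn //; congr (_ \Po _); apply: eq_bigr => l _.
by rewrite pi_down_shift hi.
Qed.

Lemma good_witt_log_small m (f : nat -> {poly F}) :
  (forall i, (i <= m)%N -> (f i)`_0 = 0 /\ forall k, v (f i)`_k < 1) ->
  good_log v (witt_log m f).
Proof.
move=> hf; rewrite witt_logE; apply: (good_log_sum um f0) => i _.
have [h0 h1] := hf i (ltn_ord i).
apply: (good_log_comp_small um f0) => //; first exact: lt_log_coef0.
exact: exp_lt_log_integral.
Qed.

(** Both logarithms are read along the orbit of pi_(m+1): composing with X^p shifts the index by one
    and produces the factor p. The missing term p pi_(m+1) X is added at index 0 and subtracted
    again. *)
Lemma lt_log_frobenius m : lt_log m \Po 'X^p - lt_log m =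
  \sum_(j < m.+2) ((p%:R * pi_down m.+1 j - pi_down m.+1 j.+1) / (p ^ j)%:R) *: 'X^(p ^ j)
  - (p%:R * pi m.+1) *: 'X.
Proof.
under eq_bigr do rewrite mulrBl scalerBl.
rewrite sumrB addrAC; congr (_ - _).
  rewrite big_ord_recl /= /pi_down leq0n subn0 expn0 divr1 expr1 addrAC subrr add0r.
  rewrite raddf_sum; apply: eq_bigr => j _ /=.
  rewrite comp_polyZ comp_Xn_poly -exprM -expnS /bump /= add1n; congr (_ *: _).
  have hj : (j <= m)%N by rewrite -ltnS.
  by rewrite subSS ltnS hj expnS natrM invfM mulrACA mulfV // mul1r /pi_down hj.
rewrite [RHS]big_ord_recr /= [pi_down _ m.+2]/pi_down ltnn mul0r scale0r addr0.
by apply: eq_bigr => j _; rewrite /pi_down subSS.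
Qed.

Lemma good_lt_log_frobenius m : good_log v (lt_log m \Po 'X^p - lt_log m).
Proof.
have [mu hmu gmu] := pi_down_quotient_ghost m.+1.
have -> : lt_log m \Po 'X^p - lt_log m =
    witt_log m.+1 (fun i => mu i *: 'X^(p ^ i)) - (p%:R * pi m.+1) *: 'X.
  rewrite lt_log_frobenius; congr (_ - _); apply: eq_bigr => j _.
  by rewrite ghost_monomial scalerA mulrAC gmu.
apply: (good_logD um f0).
  apply: good_witt_log_small => i hi; split.
    by rewrite coefZ coefXn eq_sym expn_eq0 (gtn_eqF (prime_gt0 pp)) mulr0.
  move=> k; rewrite coefZ coefXn; case: eqP => _; rewrite ?mulr0 ?uabs0 // mulr1.
  exact: le_lt_trans (hmu i hi) (tate_lt1 pi_gen _).
apply/good_logN/(good_log_pX um pp vp); rewrite ?coefX //; first exact: tate_lt1 pi_gen _.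
by rewrite -['X]expr1; apply: poly_leXn.
Qed.

Lemma good_witt_log_frobenius m (f : nat -> {poly F}) :
  (forall i, (f i)`_0 = 0) -> (forall i, poly_le v 1 (f i)) ->
  good_log v (witt_log m (fun i => f i ^+ p) - witt_log m f).
Proof.
move=> h0 hf; rewrite !witt_logE -sumrB; apply: (good_log_sum um f0) => i _.
have -> : (lt_log (m - i) \Po f i ^+ p) - (lt_log (m - i) \Po f i) =
    (lt_log (m - i) \Po 'X^p - lt_log (m - i)) \Po f i.
  by rewrite comp_polyB -comp_polyA comp_Xn_poly.
by apply: (good_log_comp um) => //; apply: good_lt_log_frobenius.
Qed.

(** By [ghostS], the ghost of index j + 1 of f is the j-th ghost of the p-th powers plus p^(j+1)
    f_(j+1); the factor p lowers the denominator p^(j+1) to p^j. *)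
Lemma witt_logMn m (f : nat -> {poly F}) : witt_log m.+1 f *+ p =
  (p%:R * pi m.+1) *: f 0%N + witt_log m (fun i => f i ^+ p) +
  \sum_(j < m.+1) (p%:R * pi (m - j)) *: f j.+1.
Proof.
rewrite /witt_log big_ord_recl mulrnDl -addrA; congr (_ + _).
  rewrite ghostE big_ord1 /= subnn expn0 expr1 mulr1n divr1 -scaler_nat scalerA.
  by rewrite /pi_down leq0n subn0.
rewrite -sumrMnl -big_split; apply: eq_bigr => j _ /=.
rewrite /bump /= add1n ghostS scalerDr mulrnDl /pi_down subSS ltnS.
have -> : (j <= m)%N by rewrite -ltnS.
rewrite -!scaler_nat !scalerA; congr (_ *: _ + _ *: _).
  by rewrite expnS natrM invfM mulrCA mulVKf.
by rewrite -!mulrA mulVf ?mulr1 // natrX expf_neq0.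
Qed.

(** The linear terms in [witt_logMn] have coefficients p pi_i with |pi_i| < 1, so [good_log_pX]
    disposes of them; [good_witt_log_frobenius] then replaces the p-th powers of the components by
    the components. *)
Lemma geometric_witt_log_pred m (f : nat -> {poly F}) :
  (forall i, (f i)`_0 = 0) -> (forall i, poly_le v 1 (f i)) ->
  geometric v (exp_series (witt_log m.+1 f)) -> geometric v (exp_series (witt_log m f)).
Proof.
move=> h0 hf hg.
have w0 k : (witt_log k f)`_0 = 0.
  rewrite witt_logE coef_sum big1 // => i _.
  by apply: comp_poly_coef0 => //; apply: lt_log_coef0.
pose E := (p%:R * pi m.+1) *: f 0%N + \sum_(j < m.+1) (p%:R * pi (m - j)) *: f j.+1.
have [d0 _ hd] : good_log v (witt_log m (fun i => f i ^+ p) - witt_log m f).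
  exact: good_witt_log_frobenius.
have [e0 _ he] : good_log v E.
  apply: (good_logD um f0); last apply: (good_log_sum um f0) => j _;
    by apply: (good_log_pX um pp vp) => //; apply: tate_lt1 pi_gen _.
have -> : witt_log m f = witt_log m.+1 f *+ p +
    (- E - (witt_log m (fun i => f i ^+ p) - witt_log m f)).
  by rewrite witt_logMn /E; ring.
have N0 (g : {poly F}) : g`_0 = 0 -> (- g)`_0 = 0 by move=> g0; rewrite coefN g0 oppr0.
apply: (geometric_expD um f0).
- by rewrite coefMn w0 mul0rn.
- by rewrite coefB (N0 _ e0) d0 subr0.
- by apply: (geometric_expMn um f0).
- by apply: (geometric_expD um f0) => //; apply: N0.
Qed.

(** Apart from p pi_0 and pi_0^p, everything in the expansion of P(pi_0) = 0 is divisible by p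
    pi_0^2. *)
Lemma pi0_power : v (pi 0%N ^+ p + p%:R * pi 0%N) <= p%:R^-1 * v (pi 0%N) ^+ 2.
Proof.
set x := pi 0%N; pose e : R := p%:R^-1 * v x ^+ 2; rewrite -/e.
have e0 : 0 < e by rewrite mulr_gt0 ?inv_prime_gt0 // exprn_gt0 // (uabs_neq0 um) // pi_neq0.
have x1 : v x <= 1 by apply/ltW/(tate_lt1 pi_gen).
(* Adding p places the index p inside the truncated sum. *)
have [N0 hN0] := tate_root pi_gen e0; pose n := (N0 + p)%N.
have p2 := prime_gt1 pp.
have : v (\sum_(i < n.+2) iota (P i) * x ^+ i) <= e.
  by have := hN0 n.+2; rewrite subr0 => H; apply/ltW/H; rewrite /n; lia.
have -> : \sum_(i < n.+2) iota (P i) * x ^+ i = (x ^+ p + p%:R * x) +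
    \sum_(i < n) iota (P i.+2 - (i.+2 == p)%:R) * x ^+ i.+2.
  have hp : (p - 2 < n)%N by rewrite /n; lia.
  have -> : x ^+ p = \sum_(i < n) iota (i.+2 == p)%:R * x ^+ i.+2.
    have e2 : (p - 2).+2 = p by lia.
    rewrite (bigD1 (Ordinal hp)) //= e2 eqxx rmorph1 mul1r big1 ?addr0 // => i hi.
    rewrite (_ : (i.+2 == p) = false) ?rmorph0 ?mul0r //.
    by apply: contraNF hi => /eqP hi; rewrite -val_eqE /= -hi subSS subSS subn0.
  rewrite addrAC -big_split /= 2!big_ord_recl /= (lt_coef0 P_LT) rmorph0 mul0r add0r.
  rewrite /bump /= (lt_coef1 P_LT) rmorph_nat expr1 addrC; congr (_ + _).
  by apply: eq_bigr => i _; rewrite rmorphB mulrBl addrC subrK.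
set S := \sum_(i < n) _ => hS.
have hS2 : v S <= e.
  apply: (uabs_sum_le um) => [|i _]; first exact: ltW.
  apply: (uabsMle um).
    have [z hz ->] := lt_modp P_LT i.+2; rewrite iota_isom (uabsM umQ) (padic_p Qp_padic).
    by rewrite ler_piMr // ltW // inv_prime_gt0.
  exact: (uabsX_leX um).
by rewrite -(addrK S (_ + _)); apply: (uabsB_le um).
Qed.

(** By [pi0_power] the sum pi_0^p + p pi_0 is strictly smaller than p pi_0, so its two terms have
    the same absolute value. *)
Lemma pi0_critical : v (pi 0%N) ^+ p.-1 = p%:R^-1.
Proof.
set x := pi 0%N; have vx0 : 0 < v x by rewrite (uabs_neq0 um) // pi_neq0.
have pV := inv_prime_gt0 R pp.
have lt : v (x ^+ p + p%:R * x) < v (p%:R * x).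
  apply: le_lt_trans pi0_power _; rewrite (uabsM um) vp ltr_pM2l //.
  by rewrite expr2 gtr_pMr // (tate_lt1 pi_gen).
have e : v (x ^+ p) = v (p%:R * x).
  apply/le_anti/andP; split.
    rewrite -[x ^+ p](addrK (p%:R * x)); apply: (uabsB_le um) => //; exact: ltW.
  rewrite leNgt; apply/negP => h.
  have : v (p%:R * x) < v (p%:R * x); last by rewrite ltxx.
  by rewrite -{1}[p%:R * x](addKr (x ^+ p)) addrC; apply: (uabsB_lt um).
move: e; rewrite (uabsX um) (uabsM um) vp -{1}(prednK (prime_gt0 pp)) exprSr.
by move/(mulIf (lt0r_neq0 vx0)).
Qed.

End LubinTateExponentials.

(** * Finite extensions of complete fields *)

Section FiniteDimension.
Context (R : realType) (K L : fieldType) (vK : K -> R) (v : L -> R).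
Context (iota : {rmorphism K -> L}).
Hypotheses (umK : ultrametric_abs vK) (K_complete : abs_complete vK).
Hypotheses (um : ultrametric_abs v) (iota_isom : forall x, v (iota x) = vK x).

Definition lin_comb n (h : nat -> L) (a : nat -> K) : L :=
  \sum_(i < n) iota (a i) * h i.

Definition in_span n h y := exists a, y = lin_comb n h a.

Definition bounded_coords n h := exists2 C : R, 0 < C &
  forall a i, (i < n)%N -> vK (a i) <= C * v (lin_comb n h a).

Lemma lin_combB n h a b :
  lin_comb n h a - lin_comb n h b = lin_comb n h (fun i => a i - b i).
Proof. by rewrite -sumrB; apply: eq_bigr => i _; rewrite rmorphB mulrBl. Qed.

Lemma lin_comb_le n (h : nat -> L) (a : nat -> K) (B e : R) : 0 <= e ->
  0 <= B -> (forall i, (i < n)%N -> v (h i) <= B) ->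
  (forall i, (i < n)%N -> vK (a i) <= e) -> v (lin_comb n h a) <= e * B.
Proof.
move=> e0 B0 hB he; apply: (uabs_sum_le um) => [|i _]; first exact: mulr_ge0.
by apply: (uabsMle um); rewrite ?iota_isom; [apply: he|apply: hB].
Qed.

Lemma finite_bound n (h : nat -> L) : exists2 B : R, 0 < B &
  forall i, (i < n)%N -> v (h i) <= B.
Proof.
elim: n => [|n [B B0 hB]]; first by exists 1.
exists (Num.max B (v (h n))); first by rewrite lt_max B0.
move=> i; rewrite ltnS leq_eqVlt le_max => /orP[/eqP->|/hB->//].
by rewrite lexx orbT.
Qed.

(** The coordinate bound makes the coordinates of the approximations Cauchy; their limits, which
    exist by completeness of K, are coordinates of y. *)
Lemma span_closed n h y : bounded_coords n h ->
  (forall e : R, 0 < e -> exists2 w, in_span n h w & v (y - w) < e) -> in_span n h y.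
Proof.
move=> [C C0 hC] hy.
have step k : exists a, v (y - lin_comb n h a) < k.+1%:R^-1.
  have [|w [a ->] hw] := hy k.+1%:R^-1; first by rewrite invr_gt0 ltr0n.
  by exists a.
have [a ha] := boolp.choice step.
have small (e : R) : 0 < e -> exists N, forall k, (N <= k)%N -> k.+1%:R^-1 < e.
  move=> e0; exists (Num.trunc e^-1) => k hk.
  rewrite invf_plt ?posrE ?ltr0n // (lt_le_trans (truncnS_gt _)) //.
  by rewrite ler_nat ltnS.
have cauchy i : (i < n)%N -> abs_cauchy vK (fun k => a k i).
  move=> hi e e0; have [N hN] := small (e / C) (divr_gt0 e0 C0).
  exists N => k l hk hl.
  apply: le_lt_trans (hC (fun i => a k i - a l i) i hi) _.
  rewrite -ltr_pdivlMl // mulrC -lin_combB.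
  have -> : lin_comb n h (a k) - lin_comb n h (a l) =
    (y - lin_comb n h (a l)) - (y - lin_comb n h (a k)) by ring.
  by apply: (uabsB_lt um); apply: lt_trans (ha _) (hN _ _).
have lims i : exists b, (i < n)%N -> abs_cvg vK (fun k => a k i) b.
  case: (ltnP i n) => [/cauchy /K_complete [b hb]|_]; first by exists b.
  by exists 0.
have [b hb] := boolp.choice lims; exists b.
have [B B0 hB] := finite_bound n h.
apply/eqP; rewrite -subr_eq0; apply/eqP/(uabs_eq0 um)/le_anti.
rewrite (uabs_ge0 um) andbT; apply/ler_addgt0Pl => e e0; rewrite addr0.
have [N1 hN1] := small e e0.
have [N2 hN2] : exists N, forall k, (N <= k)%N -> forall i, (i < n)%N ->
    vK (a k i - b i) <= e / B.
  have eB : 0 < e / B by rewrite divr_gt0.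
  suff H m : (m <= n)%N -> exists N, forall k, (N <= k)%N -> forall i, (i < m)%N ->
    vK (a k i - b i) <= e / B by exact: H (leqnn n).
  elim: m => [|m IH] hm; first by exists 0%N.
  have [N hN] := IH (ltnW hm); have [N' hN'] := hb m hm _ eB.
  exists (maxn N N') => k; rewrite geq_max => /andP[h1 h2] i.
  rewrite ltnS leq_eqVlt => /orP[/eqP->|hi]; last exact: hN.
  exact/ltW/hN'.
pose k := maxn N1 N2.
have -> : y - lin_comb n h b =
    (y - lin_comb n h (a k)) + (lin_comb n h (a k) - lin_comb n h b) by ring.
apply: (uabsD_le um); first exact/ltW/(lt_trans (ha k))/hN1/leq_maxl.
rewrite lin_combB -[e](divfK (lt0r_neq0 B0)).
apply: lin_comb_le; rewrite ?divr_ge0 ?(ltW e0) ?(ltW B0) //.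
by move=> i hi; apply: hN2 => //; apply: leq_maxr.
Qed.

(** The span of the first n vectors is closed, so the new vector lies at a positive distance d from
    it. This bounds the last coordinate by |y| / d, and subtracting the last term reduces to n
    vectors. *)
Lemma bounded_coordsS n h : bounded_coords n h -> ~ in_span n h (h n) ->
  bounded_coords n.+1 h.
Proof.
move=> hbd hn; have [C C0 hC] := hbd.
have [d d0 hd] : exists2 d : R, 0 < d & forall w, in_span n h w -> d <= v (h n - w).
  apply: boolp.contrapT => H; apply/hn/(span_closed hbd) => e e0.
  apply: boolp.contrapT => H'; apply: H; exists e => // w hw.
  by rewrite leNgt; apply/negP => lt; apply: H'; exists w.
pose D := Num.max d^-1 (C * Num.max 1 (v (h n) / d)).
exists D; first by rewrite lt_max invr_gt0 d0.
move=> a; set y := lin_comb n.+1 h a.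
have yE : y = lin_comb n h a + iota (a n) * h n by rewrite /y /lin_comb big_ord_recr.
have an : vK (a n) <= v y / d.
  have [->|a0] := eqVneq (a n) 0; first by rewrite uabs0 // divr_ge0 ?(uabs_ge0 um) // ltW.
  rewrite ler_pdivlMr //.
  have ia0 : iota (a n) != 0 by rewrite fmorph_eq0.
  have -> : y = iota (a n) * (h n - lin_comb n h (fun i => - (a i / a n))).
    have -> : lin_comb n h (fun i => - (a i / a n)) = - (lin_comb n h a / iota (a n)).
      rewrite /lin_comb mulr_suml -sumrN; apply: eq_bigr => i _.
      by rewrite rmorphN fmorph_div mulNr mulrAC.
    by rewrite opprK mulrDr mulrCA divff // mulr1 addrC.
  by rewrite (uabsM um) iota_isom ler_wpM2l ?(uabs_ge0 umK) //; apply: hd; eexists.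
have w_le : v (lin_comb n h a) <= Num.max 1 (v (h n) / d) * v y.
  have -> : lin_comb n h a = y - iota (a n) * h n by rewrite yE addrK.
  rewrite maxr_pMl ?(uabs_ge0 um) // mul1r.
  apply: (uabsB_le um); first by rewrite le_max lexx.
  rewrite (uabsM um) iota_isom le_max; apply/orP; right.
  by rewrite -mulrA mulrC ler_wpM2l ?(uabs_ge0 um) // mulrC.
move=> i; rewrite ltnS leq_eqVlt => /orP[/eqP->|hi].
  apply: le_trans an _; rewrite mulrC ler_wpM2r ?(uabs_ge0 um) //.
  by rewrite le_max lexx.
apply: le_trans (hC a i hi) _.
apply: le_trans (_ : C * (Num.max 1 (v (h n) / d) * v y) <= _).
  by rewrite ler_wpM2l // ltW.
by rewrite mulrA ler_wpM2r ?(uabs_ge0 um) // le_max lexx orbT.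
Qed.

Lemma in_spanD n h y z : in_span n h y -> in_span n h z -> in_span n h (y + z).
Proof.
move=> [a ->] [b ->]; exists (fun i => a i + b i).
by rewrite -big_split; apply: eq_bigr => i _; rewrite rmorphD mulrDl.
Qed.

Lemma in_spanZ n h c y : in_span n h y -> in_span n h (iota c * y).
Proof.
move=> [a ->]; exists (fun i => c * a i).
by rewrite mulr_sumr; apply: eq_bigr => i _; rewrite rmorphM mulrA.
Qed.

Lemma in_span0 n h : in_span n h 0.
Proof. by exists (fun=> 0); rewrite /lin_comb big1 // => i _; rewrite rmorph0 mul0r. Qed.

Lemma in_span_sum n h (I : Type) (r : seq I) (P : pred I) (E : I -> L) :
  (forall i, P i -> in_span n h (E i)) -> in_span n h (\sum_(i <- r | P i) E i).
Proof.
by move=> H; elim/big_ind: _ => //; [exact: in_span0|move=> *; apply: in_spanD].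
Qed.

Lemma in_span_gen n h i : (i < n)%N -> in_span n h (h i).
Proof.
move=> hi; exists (fun j => (j == i)%:R); rewrite /lin_comb (bigD1 (Ordinal hi)) //=.
rewrite eqxx rmorph1 mul1r big1 ?addr0 // => j.
by rewrite -val_eqE /= => /negPf->; rewrite rmorph0 mul0r.
Qed.

Section SimpleExtension.
Hypothesis L_alg : forall y, algebraicOver iota y.
Context (x : L).

(** The least [d] with x^d in the span of the lower powers is the degree of x over K; its minimality
    is the non-membership that [bounded_coordsS] needs at each step. *)
Lemma power_basis : exists d, bounded_coords d (GRing.exp x) /\
  forall m, in_span d (GRing.exp x) (x ^+ m).
Proof.
have [d [hd hmin]] : exists d, in_span d (GRing.exp x) (x ^+ d) /\
    forall n, (n < d)%N -> ~ in_span n (GRing.exp x) (x ^+ n).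
  have [q q0 /rootP hq] := L_alg x.
  have ex : exists n, `[< in_span n (GRing.exp x) (x ^+ n) >].
    exists (size q).-1; apply/boolp.asboolP.
    have c0 : lead_coef q != 0 by rewrite lead_coef_eq0.
    exists (fun i => - (q`_i / lead_coef q)).
    have q1 : (0 < size q)%N by rewrite size_poly_gt0.
    move: hq; rewrite (@horner_coef_wide _ (size q).-1.+1); last by rewrite size_map_poly prednK.
    rewrite big_ord_recr /=.
    rewrite coef_map /= -/(lead_coef q) => /eqP; rewrite addrC addr_eq0 => /eqP e.
    apply: (mulfI (_ : iota (lead_coef q) != 0)); first by rewrite fmorph_eq0.
    rewrite e /lin_comb mulr_sumr -sumrN; apply: eq_bigr => i _.
    by rewrite coef_map rmorphN fmorph_div mulNr mulrN mulrA mulrCA divff ?fmorph_eq0 // mulr1.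
  case: (ex_minnP ex) => d /boolp.asboolP hd hmin; exists d; split=> // n hn hs.
  by have := hmin n (introT (boolp.asboolP _) hs); rewrite leqNgt hn.
exists d; split; last first.
  elim=> [|m [a IH]].
    case: d hd {hmin} => [|d] hd; first by move: hd; rewrite expr0.
    exact: in_span_gen (ltn0Sn d).
  rewrite exprS IH /lin_comb mulr_sumr; apply: in_span_sum => i _.
  rewrite mulrCA -exprS; apply: in_spanZ.
  have := ltn_ord i; rewrite leq_eqVlt => /orP[/eqP->//|hi].
  exact: in_span_gen hi.
suff h n : (n <= d)%N -> bounded_coords n (GRing.exp x) by exact: h (leqnn d).
elim: n => [|n IH] hn; first by exists 1.
by apply: bounded_coordsS; [apply: IH; apply: ltnW|apply: hmin].
Qed.

(** Strip factors X from an annihilating polynomial until it has the form q X + c with c nonzero;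
    then q(z) z = - c. *)
Lemma inverse_horner (z : L) : z != 0 ->
  exists q : {poly K}, z^-1 = (map_poly iota q).[z].
Proof.
move=> z0; have [q q0 /rootP hq] := L_alg z; move: q q0 hq.
apply: poly_ind => [|q c IH]; first by rewrite eqxx.
rewrite rmorphD rmorphM /= map_polyX map_polyC hornerMXaddC.
have [->|c0] := eqVneq c 0.
  rewrite polyC0 addr0 /= rmorph0 addr0 => qX0 /eqP.
  rewrite mulf_eq0 (negPf z0) orbF => /eqP; apply: IH.
  by apply: contraNneq qX0 => ->; rewrite mul0r.
move=> _ /eqP; rewrite addr_eq0 => /eqP e; exists (- c^-1 *: q).
rewrite map_polyZ hornerZ rmorphN fmorphV mulNr.
apply: (mulIf z0); rewrite mulVf // mulNr -mulrA e mulrN opprK mulVf //.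
by rewrite fmorph_eq0.
Qed.

Lemma adjoinD y z : adjoin iota x y -> adjoin iota x z -> adjoin iota x (y + z).
Proof.
move=> [q [r [r0 ->]]] [q' [r' [r'0 ->]]].
exists (q * r' + q' * r), (r * r').
rewrite !(rmorphD, rmorphM) /= !(hornerD, hornerM) mulf_neq0 //; split=> //.
by rewrite addf_div.
Qed.

Lemma adjoinM y z : adjoin iota x y -> adjoin iota x z -> adjoin iota x (y * z).
Proof.
move=> [q [r [r0 ->]]] [q' [r' [r'0 ->]]]; exists (q * q'), (r * r').
by rewrite !rmorphM /= !hornerM mulf_neq0 // mulf_div.
Qed.

Lemma adjoinC c : adjoin iota x (iota c).
Proof.
exists c%:P, 1; rewrite rmorph1 hornerC oner_neq0 divr1.
by rewrite map_polyC hornerC.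
Qed.

Lemma adjoin_gen : adjoin iota x x.
Proof. by exists 'X, 1; rewrite rmorph1 hornerC oner_neq0 divr1 map_polyX hornerX. Qed.

Lemma adjoinV y : adjoin iota x y -> adjoin iota x y^-1.
Proof.
move=> [q [r [r0 ->]]]; rewrite invf_div.
have [q0|q0] := eqVneq (map_poly iota q).[x] 0; last by exists r, q.
by rewrite q0 invr0 mulr0 -(rmorph0 iota); apply: adjoinC.
Qed.

Lemma adjoinN y : adjoin iota x y -> adjoin iota x (- y).
Proof. by move=> hy; rewrite -mulN1r -(rmorph1 iota) -rmorphN; apply/adjoinM/hy/adjoinC. Qed.

Lemma adjoin_nat n : adjoin iota x n%:R.
Proof. by rewrite -(rmorph_nat iota); apply: adjoinC. Qed.

Lemma adjoinX y n : adjoin iota x y -> adjoin iota x (y ^+ n).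
Proof.
move=> hy; elim: n => [|n IH]; first exact: (adjoin_nat 1).
by rewrite exprS; apply: adjoinM.
Qed.

Lemma adjoin_sum (I : Type) (r : seq I) (P : pred I) (E : I -> L) :
  (forall i, P i -> adjoin iota x (E i)) -> adjoin iota x (\sum_(i <- r | P i) E i).
Proof.
by move=> H; elim/big_ind: _ => //; [exact: (adjoin_nat 0)|exact: adjoinD].
Qed.

Lemma in_span_adjoin d y : in_span d (GRing.exp x) y -> adjoin iota x y.
Proof.
move=> [a ->]; apply: adjoin_sum => i _; apply: adjoinM; first exact: adjoinC.
exact/adjoinX/adjoin_gen.
Qed.

Lemma adjoin_basis : exists d, bounded_coords d (GRing.exp x) /\
  forall y, adjoin iota x y -> in_span d (GRing.exp x) y.
Proof.
have [d [bd pd]] := power_basis; exists d; split=> //.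
have hornerS q : in_span d (GRing.exp x) (map_poly iota q).[x].
  rewrite horner_coef; apply: in_span_sum => i _.
  by rewrite coef_map; apply: in_spanZ.
have spanM y z : in_span d (GRing.exp x) y -> in_span d (GRing.exp x) z ->
    in_span d (GRing.exp x) (y * z).
  move=> [a ->] [b ->]; rewrite mulr_suml; apply: in_span_sum => i _.
  rewrite mulr_sumr; apply: in_span_sum => j _.
  by rewrite mulrACA -rmorphM -exprD; apply: in_spanZ.
move=> _ [q [r [r0 ->]]]; apply: (spanM _ _ (hornerS q)).
have [t ->] := inverse_horner r0.
rewrite horner_coef; apply: in_span_sum => i _; rewrite coef_map; apply: in_spanZ.
elim: (nat_of_ord i) => [|k IH]; first by have := pd 0%N; rewrite !expr0.
by rewrite exprS; apply: spanM.
Qed.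

Lemma adjoin_closed y : (forall e : R, 0 < e -> exists2 w, adjoin iota x w & v (y - w) < e) ->
  adjoin iota x y.
Proof.
have [d [bd hd]] := adjoin_basis => h; apply: (@in_span_adjoin d).
by apply: span_closed bd _ => e /h [w /hd]; exists w.
Qed.

End SimpleExtension.
End FiniteDimension.

(** * Membership in the Robba ring and geometric decay *)

Section RobbaExtension.
Context (R : realType) (K L : fieldType) (vK : K -> R) (v : L -> R).
Context (iota : {rmorphism K -> L}).
Hypotheses (umK : ultrametric_abs vK) (K_complete : abs_complete vK).
Hypotheses (um : ultrametric_abs v) (iota_isom : forall x, v (iota x) = vK x).
Hypothesis L_alg : forall y, algebraicOver iota y.
Context (x : L).

Let analytic_bound (w M r rho : R) n : 0 < r -> r < rho -> 0 <= M ->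
  w <= M * r ^+ n -> w * rho ^ (- n%:Z) <= M.
Proof.
move=> r0 hr M0 hw; have rho0 := lt_trans r0 hr.
rewrite -exprnN ler_pdivrMr ?exprn_gt0 //; apply: le_trans hw _.
by rewrite ler_wpM2l // lerXn2r ?nnegrE ?(ltW r0) ?(ltW rho0) ?(ltW hr).
Qed.

Lemma laurent_neg_bound (F : fieldType) (w : F -> R) (c : nat -> F) (r M : R) :
  w 0 = 0 -> 0 < r -> 0 <= M -> (forall n, w (c n) <= M * r ^+ n) ->
  forall rho, r < rho -> forall i, w (laurent_neg c i) * rho ^ i <= M.
Proof.
move=> w0 r0 M0 hc rho hr i; rewrite /laurent_neg.
case: i => [[|n]|n].
- by have := analytic_bound r0 hr M0 (hc 0%N).
- by rewrite /= w0 mul0r.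
- by rewrite /=; have := analytic_bound r0 hr M0 (hc n.+1); rewrite -NegzE.
Qed.

Lemma geometric_analytic (H : L -> Prop) (c : nat -> L) : H 0 -> (forall n, H (c n)) ->
  geometric v c ->
  exists2 eps : R, 0 < eps & analytic_on v H `]1 - eps, +oo[ (laurent_neg c).
Proof.
move=> H0 Hc [r [M [r0 r1 M0 hc]]]; exists (1 - r); first by rewrite subr_gt0.
split=> [i|rho]; first by rewrite /laurent_neg; case: ifP.
rewrite in_itv /= andbT subKr => hr; exists M.
by apply: laurent_neg_bound hc _ hr => //; rewrite uabs0.
Qed.

(** Coordinates in the power basis are bounded by a constant times the absolute value, so each
    coordinate series inherits the rate r. *)
Lemma geometric_robba_ext (c : nat -> L) : (forall n, adjoin iota x (c n)) ->
  geometric v c -> in_robba_ext vK iota (adjoin iota x) (laurent_neg c).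
Proof.
move=> Kc [r [M [r0 r1 M0 hc]]].
have [d [[C C0 hC] hd]] := adjoin_basis umK K_complete um iota_isom L_alg x.
have [a ha] := boolp.choice (fun n => hd _ (Kc n)).
exists d, (fun j : 'I_d => laurent_neg (fun n => a n j)), (fun j : 'I_d => x ^+ j).
split.
- move=> j; exists (1 - r); first by rewrite subr_gt0.
  split=> // rho; rewrite in_itv /= subKr => /andP[hr _]; exists (C * M).
  apply: laurent_neg_bound hr => //; rewrite ?uabs0 ?mulr_ge0 ?(ltW C0) // => n.
  apply: le_trans (hC (a n) j (ltn_ord j)) _.
  by rewrite -ha -mulrA ler_wpM2l // ltW.
- by move=> j; apply/adjoinX/adjoin_gen.
- move=> i; rewrite /laurent_neg; case: ifP => _; first exact: ha.
  by rewrite big1 // => j _; rewrite rmorph0 mul0r.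
Qed.

Lemma robba_ext_geometric (H : L -> Prop) (c : nat -> L) :
  in_robba_ext vK iota H (laurent_neg c) -> geometric v c.
Proof.
move=> [n [f [h [hf _ hc]]]].
suff [r [M [r0 r1 M0 hM]]] : exists r M : R, [/\ 0 < r, r < 1, 0 <= M &
    forall (j : 'I_n) m, vK (f j (- m%:Z)) * r ^ (- m%:Z) <= M].
  have [B B0 hB] := finite_bound v n (fun i => if insub i is Some j then h j else 0).
  exists r, (M * B); split=> //; first by rewrite mulr_ge0 // ltW.
  move=> m; have -> : c m = laurent_neg c (- m%:Z).
    by rewrite /laurent_neg oppr_le0 lez_nat abszN absz_nat.
  rewrite hc mulrAC; apply: (uabs_sum_le um) => [|j _].
    by rewrite !mulr_ge0 ?exprn_ge0 // ltW.
  apply: (uabsMle um).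
    by rewrite iota_isom; have := hM j m; rewrite -exprnN ler_pdivrMr ?exprn_gt0.
  by have := hB j (ltn_ord j); rewrite valK.
have step j : exists e : R, 0 < e /\ forall rho, 1 - e < rho -> rho < 1 ->
    exists M : R, forall i, vK (f j i) * rho ^ i <= M.
  have [e e0 [_ he]] := hf j; exists e; split=> // rho h1 h2.
  by apply: he; rewrite in_itv /= h1.
have [e he] := boolp.choice step.
(* A common radius for the finitely many series: the minimum with 1/2 keeps it positive, and halving
   [e1] puts it strictly inside every interval. *)
pose e1 := \big[Num.min/2^-1]_j e j.
have e1_gt0 : 0 < e1.
  by apply: lt_bigmin => [|j _]; [rewrite invr_gt0 ltr0n | exact: (he j).1].
have e1_lt1 : e1 < 1.
  by apply: le_lt_trans (bigmin_le_id _ _ _ _) _; rewrite invf_lt1 ?ltr1n ?ltr0n.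
pose r := 1 - e1 / 2.
have hr2 : e1 / 2 < e1 by rewrite ltr_pdivrMr // ltr_pMr // ltr1n.
have r0 : 0 < r by rewrite subr_gt0 (lt_trans hr2).
have r1 : r < 1 by rewrite gtrBl divr_gt0.
have bnd j : exists M : R, forall i, vK (f j i) * r ^ i <= M.
  apply: (he j).2 => //; rewrite ltrD2l ltrN2 (lt_le_trans hr2) //.
  exact: bigmin_le.
have [M hM] := boolp.choice bnd.
exists r, (\big[Num.max/0]_j M j); split=> // [|j m]; first exact: bigmax_ge_id.
exact: le_trans (hM j _) (le_bigmax _ _ _).
Qed.

End RobbaExtension.

(** * Reduction to the residue field *)

Lemma ghost_const0 (A : comNzRingType) p j : (0 < p)%N -> ghost p (fun=> 0 : A) j = 0.
Proof.
move=> p0; rewrite ghostE big1 // => i _.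
by rewrite expr0n (gtn_eqF (_ : 0 < _)%N) ?mul0rn // expn_gt0 p0.
Qed.

Section WittSubtractionInDomain.
Context (A : idomainType) (p s : nat).
Hypotheses (pp : prime p) (p_neq0 : (p%:R : A) != 0).
Implicit Types a b : {ffun 'I_s.+1 -> A}.

Lemma ghost_witt_sub a b j : (j <= s)%N ->
  ghost p (witt_sub p a b \o inord) j = ghost p (a \o inord) j - ghost p (b \o inord) j.
Proof. by move=> hj; rewrite -!witt_phantomE // witt_phantom_sub. Qed.

Lemma witt_sub_self a j : witt_sub p a a j = 0.
Proof.
have := ghost_inj p_neq0 (x := witt_sub p a a \o inord) (y := fun=> 0) (J := s.+1) _ (ltn_ord j).
rewrite /= inord_val; apply=> i hi.
by rewrite ghost_witt_sub // subrr ghost_const0 // prime_gt0.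
Qed.

(** The n-th component of a difference is a_n - b_n plus a polynomial in earlier components: the
    n-th components enter the n-th ghost only multiplied by p^n, which cancels in the domain. *)
Lemma witt_sub_prefix a b a' b' (n : 'I_s.+1) :
  (forall i : 'I_s.+1, (i < n)%N -> a i = a' i) ->
  (forall i : 'I_s.+1, (i < n)%N -> b i = b' i) ->
  (forall i : 'I_s.+1, (i < n)%N -> witt_sub p a b i = witt_sub p a' b' i) /\
  witt_sub p a b n - (a n - b n) = witt_sub p a' b' n - (a' n - b' n).
Proof.
move=> ha hb.
have lt_s i : (i < n)%N -> (i < s.+1)%N by move=> hi; apply: ltn_trans (ltn_ord n).
have inE i : (i < n)%N -> (inord i : 'I_s.+1) = i :> nat.
  by move=> hi; rewrite inordK // lt_s.
have eq_low i : (i < n)%N -> (witt_sub p a b \o inord) i = (witt_sub p a' b' \o inord) i.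
  apply: (ghost_inj p_neq0) => j hj; have hjs : (j <= s)%N := lt_s j hj.
  rewrite !ghost_witt_sub //.
  congr (_ - _); apply: eq_ghost => k hk /=; [apply: ha|apply: hb];
    by rewrite inE // (leq_ltn_trans hk).
split=> [i hi|]; first by have := eq_low _ hi; rewrite /= inord_val.
have nn : (n <= s)%N by rewrite -ltnS.
have top (c : 'I_s.+1 -> A) : ghost p (c \o inord) n =
    \sum_(i < n) (c (inord i)) ^+ (p ^ (n - i)) *+ p ^ i + c n *+ p ^ n.
  by rewrite ghostE big_ord_recr /= subnn expr1 inord_val.
have := ghost_witt_sub a b nn; have := ghost_witt_sub a' b' nn; rewrite !top.
have same (c c' : 'I_s.+1 -> A) : (forall i, (i < n)%N -> c (inord i) = c' (inord i)) ->
    \sum_(i < n) (c (inord i)) ^+ (p ^ (n - i)) *+ p ^ i =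
    \sum_(i < n) (c' (inord i)) ^+ (p ^ (n - i)) *+ p ^ i.
  by move=> e; apply: eq_bigr => i _; rewrite e.
rewrite (same (witt_sub p a b) (witt_sub p a' b')) //.
rewrite (same a a') => [|i hi]; last by apply: ha; rewrite inE.
rewrite (same b b') => [|i hi]; last by apply: hb; rewrite inE.
set W := \sum_(i < n) _; set SA := \sum_(i < n) _; set SB := \sum_(i < n) _.
move=> e' e; have pn0 : ((p ^ n)%:R : A) != 0 by rewrite natrX expf_neq0.
apply: (mulIf pn0); rewrite !mulr_natr !mulrnBl.
apply: (addrI W); rewrite [LHS]addrA [RHS]addrA e e'; ring.
Qed.

End WittSubtractionInDomain.

Record subring_pred (F : fieldType) (H : F -> Prop) : Prop := {
  subring1 : H 1;
  subringN : forall x, H x -> H (- x);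
  subringD : forall x y, H x -> H y -> H (x + y);
  subringM : forall x y, H x -> H y -> H (x * y) }.

Section Reduction.
Context (R : realType) (F k : fieldType) (v : F -> R) (H : F -> Prop) (red : F -> k).
Hypotheses (um : ultrametric_abs v) (res : residue_field v H red).
Hypothesis H_sub : subring_pred H.

Let H1 := subring1 H_sub.
Let HN := @subringN _ _ H_sub.
Let HD := @subringD _ _ H_sub.
Let HM := @subringM _ _ H_sub.

Local Notation O := (integers v H).

Lemma integers1 : O 1.
Proof. by split; rewrite ?uabs1. Qed.

Lemma integersN x : O x -> O (- x).
Proof. by case=> ? ?; split; rewrite ?uabsN; auto. Qed.

Lemma integersD x y : O x -> O y -> O (x + y).
Proof. by move=> [? ?] [? ?]; split; auto; apply: uabsD_le. Qed.

Lemma integersM x y : O x -> O y -> O (x * y).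
Proof. by move=> [? ?] [? ?]; split; auto; apply: uabsM_le1. Qed.

Lemma integers0 : O 0.
Proof. by rewrite -(subrr 1); apply: integersD; [|apply: integersN]; apply: integers1. Qed.

Lemma red0 : red 0 = 0.
Proof. by apply/(red_ker res integers0); rewrite uabs0 // ltr01. Qed.

Lemma redN x : O x -> red (- x) = - red x.
Proof.
move=> hx; apply/eqP; rewrite -subr_eq0 opprK -(redD res) ?addNr ?red0 //.
exact: integersN.
Qed.

Lemma red_small x : O x -> red x = 0 -> v x < 1.
Proof. by move=> hx /(red_ker res hx). Qed.

(** A relation rather than a map, since [red] is meaningful only on integers: it carries integrality
    and reduction together through the ring operations. *)
Definition red_rel (f : {poly F}) (g : {poly k}) :=
  forall i, O f`_i /\ red f`_i = g`_i.

Lemma red_rel_poly_le f g : red_rel f g -> poly_le v 1 f.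
Proof. by move=> h i; case: (h i) => -[]. Qed.

Lemma red_rel_map (f : {poly F}) : (forall i, O f`_i) -> red_rel f (map_poly red f).
Proof. by move=> h i; rewrite coef_map_id0 ?red0. Qed.

Lemma red_rel_eq f g : red_rel f g -> map_poly red f = g.
Proof. by move=> h; apply/polyP => i; rewrite coef_map_id0 ?red0 //; case: (h i). Qed.

Lemma red_rel0 : red_rel 0 0.
Proof. by move=> i; rewrite !coef0 red0; split=> //; apply: integers0. Qed.

Lemma red_rel1 : red_rel 1 1.
Proof.
move=> i; rewrite !coef1; case: eqP => _; first by rewrite (red1 res); split=> //; apply: integers1.
by rewrite red0; split=> //; apply: integers0.
Qed.

Lemma red_relN (f : {poly F}) g : red_rel f g -> red_rel (- f) (- g).
Proof.
move=> h i; have [h1 h2] := h i; rewrite !coefN redN // h2.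
by split=> //; apply: integersN.
Qed.

Lemma red_relD f g f' g' : red_rel f f' -> red_rel g g' -> red_rel (f + g) (f' + g').
Proof.
move=> h h' i; have [h1 h2] := h i; have [h1' h2'] := h' i.
by rewrite !coefD (redD res) // h2 h2'; split=> //; apply: integersD.
Qed.

Lemma red_relM f g f' g' : red_rel f f' -> red_rel g g' -> red_rel (f * g) (f' * g').
Proof.
move=> h h' i; rewrite !coefM.
elim/big_ind2: _ => [|x x' y y' [h1 <-] [h2 <-]|j _].
- by rewrite red0; split=> //; apply: integers0.
- by rewrite (redD res) //; split=> //; apply: integersD.
- have [h1 <-] := h j; have [h2 <-] := h' (i - j)%N.
  by rewrite (redM res) //; split=> //; apply: integersM.
Qed.

Lemma red_relX f g n : red_rel f g -> red_rel (f ^+ n) (g ^+ n).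
Proof.
move=> h; elim: n => [|n IH]; first exact: red_rel1.
by rewrite !exprS; apply: red_relM.
Qed.

Lemma red_rel_unique f f' g : red_rel f g -> red_rel f' g -> forall i, v (f - f')`_i < 1.
Proof.
move=> h h' i; have := red_relD h (red_relN h'); rewrite subrr => /(_ i)[h1].
by rewrite coef0 => /(red_small h1).
Qed.

Lemma red_rel_lift (g : {poly k}) : g`_0 = 0 -> exists2 f, red_rel f g & f`_0 = 0.
Proof.
move=> g0; have step c : exists x, O x /\ red x = c.
  by have [x ? ?] := red_surj res c; exists x.
have [l hl] := boolp.choice step.
exists (\poly_(i < size g) (if i == 0%N then 0 else l g`_i)) => [i|]; last first.
  by rewrite coef_poly eqxx if_same.
rewrite coef_poly; case: ltnP => hi; last first.
  by rewrite nth_default // red0; split=> //; apply: integers0.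
case: eqP => [->|_]; last by case: (hl g`_i).
by rewrite g0 red0; split=> //; apply: integers0.
Qed.

Section WittVectors.
Context (p s : nat).
Hypotheses (pp : prime p) (p_neq0 : (p%:R : F) != 0).

Let pX_neq0 : (p%:R : {poly F}) != 0.
Proof. by rewrite -polyC1 -polyCMn polyC_eq0. Qed.

Lemma witt_sub_red_rel (a b : {ffun 'I_s.+1 -> {poly F}})
    (a' b' : {ffun 'I_s.+1 -> {poly k}}) j :
  (forall i, red_rel (a i) (a' i)) -> (forall i, red_rel (b i) (b' i)) ->
  red_rel (witt_sub p a b j) (witt_sub p a' b' j).
Proof.
move=> ha hb; apply: (witt_sub_rel pp (Rel := red_rel)) => //.
- exact: red_rel1.
- exact: red_relN.
- by move=> *; apply: red_relD.
- by move=> *; apply: red_relM.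
Qed.

Lemma witt_sub_coef0 (a b : {ffun 'I_s.+1 -> {poly F}}) j :
  (forall i, (a i)`_0 = 0) -> (forall i, (b i)`_0 = 0) -> (witt_sub p a b j)`_0 = 0.
Proof.
move=> ha hb; rewrite -[RHS](witt_sub_self pp p_neq0 [ffun=> 0] j).
apply: (witt_sub_rel pp (Rel := fun (x : {poly F}) y => x`_0 = y)).
- by rewrite coef1.
- by move=> x y <-; rewrite coefN.
- by move=> x y x' y' <- <-; rewrite coefD.
- by move=> x y x' y' <- <-; rewrite coefM big_ord1.
- by move=> i; rewrite ffunE.
- by move=> i; rewrite ffunE.
Qed.

(** Both [witt_sub p a b] and [witt_sub p b b] lift the same residual vector, and the second is 0 by
    its ghosts in characteristic 0. *)
Lemma witt_sub_small (a b : {ffun 'I_s.+1 -> {poly F}}) c j :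
  (forall i, red_rel (a i) (c i)) -> (forall i, red_rel (b i) (c i)) ->
  forall i, v (witt_sub p a b j)`_i < 1.
Proof.
move=> ha hb i.
pose cc : {ffun 'I_s.+1 -> {poly k}} := [ffun j => c j].
have ha' l : red_rel (a l) (cc l) by rewrite ffunE.
have hb' l : red_rel (b l) (cc l) by rewrite ffunE.
have := red_rel_unique (witt_sub_red_rel j ha' hb') (witt_sub_red_rel j hb' hb') i.
by rewrite (witt_sub_self pp pX_neq0) subr0.
Qed.

End WittVectors.
End Reduction.

(** * Artin-Schreier equations from overconvergent exponentials *)

Lemma exprD1_split (A : comNzRingType) (y : A) n : (1 < n)%N ->
  (1 + y) ^+ n = 1 + y *+ n + y ^+ n + \sum_(i < n.-2) y ^+ i.+2 *+ 'C(n, i.+2).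
Proof.
case: n => [|[|n]] // _; rewrite exprDn 2!big_ord_recl big_ord_recr /= /bump /=.
rewrite !add1n subnn bin0 bin1 binn !expr1n expr0 expr1 !mul1r !mulr1n.
rewrite [in RHS]addrAC -!addrA; congr (_ + (_ + (_ + _))).
by congr (_ + _); apply: eq_bigr => i _; rewrite expr1n mul1r !add1n.
Qed.

Section ArtinSchreier.
Context (R : realType) (F k : fieldType) (v : F -> R) (H : F -> Prop) (red : F -> k).
Hypotheses (um : ultrametric_abs v) (res : residue_field v H red).
Hypothesis H_sub : subring_pred H.
Context (p : nat).
Hypotheses (pp : prime p) (vp : v p%:R = p%:R^-1).

Let f0 := fact_neq0 um pp vp.

Lemma expX_dominates (M r e : R) : 0 < r -> r < 1 -> 0 < e ->
  exists N, forall n, (N <= n)%N -> M * r ^+ n < e.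
Proof.
move=> r0 r1 e0; pose y := r^-1 - 1.
have y0 : 0 < y by rewrite subr_gt0 invf_gt1.
have bern n : n%:R * y <= r^-1 ^+ n.
  suff: 1 + n%:R * y <= r^-1 ^+ n by apply: le_trans; rewrite lerDr.
  elim: n => [|n IH]; first by rewrite mul0r addr0 expr0.
  have -> : 1 + n.+1%:R * y = y + (1 + n%:R * y) by rewrite -natr1; ring.
  rewrite exprS -{1}(subrK 1 r^-1) -/y mulrDl mul1r lerD // ler_peMr ?(ltW y0) //.
  by apply: le_trans IH; rewrite lerDl mulr_ge0 // ltW.
exists (Num.trunc (`|M| / e / y)).+1 => n hn.
apply: le_lt_trans (_ : `|M| * r ^+ n < e).
  by rewrite ler_wpM2r ?exprn_ge0 ?ler_norm // ltW.
rewrite -ltr_pdivlMr ?exprn_gt0 // -[_^-1]exprVn -ltr_pdivrMl //.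
apply: lt_le_trans (bern n); rewrite mulrC -ltr_pdivrMr //.
by apply: lt_le_trans (truncnS_gt _) _; rewrite ler_nat.
Qed.

Lemma char_residue : (p%:R : k) = 0.
Proof.
have red_nat n : integers v H n%:R /\ red n%:R = n%:R.
  elim: n => [|n [h1 h2]]; first by rewrite (red0 um res H_sub); split=> //; apply: integers0.
  have i1 := integers1 um H_sub.
  by rewrite !mulrS (redD res) // (red1 res) h2; split=> //; apply: integersD.
have [h1 <-] := red_nat p; apply/(red_ker res h1).
by rewrite vp inv_prime_lt1.
Qed.

Context (x : F).
Hypotheses (x_neq0 : x != 0) (x_lt1 : v x < 1) (HxV : H x^-1).
Hypotheses (x_crit : v x ^+ p.-1 = p%:R^-1)
  (x_pow : v (x ^+ p + p%:R * x) <= p%:R^-1 * v x ^+ 2).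

Let pV0 := inv_prime_gt0 R pp.
Let vx0 : 0 < v x. Proof. exact: uabs_neq0. Qed.

(** At the critical absolute value every x^m / m! with m > 0 is at most |x|, so exp(x g) - 1 is
    divisible by x. *)
Lemma exp_scale_le (g : {poly F}) n : g`_0 = 0 -> poly_le v 1 g -> (0 < n)%N ->
  v (exp_series (x *: g) n) <= v x.
Proof.
move=> g0 hg n0; rewrite (_ : x *: g = (x *: 'X) \Po g); last first.
  by rewrite comp_polyZ comp_polyX.
rewrite exp_series_comp ?coefZ ?coefX ?mulr0 //.
apply: (uabs_sum_le um) => [|[[|m] hm] _] /=; first exact: ltW.
  by rewrite expr0 coef1 (gtn_eqF n0) mulr0 uabs0 // ltW.
rewrite mulrC; apply: (uabsM_le1 um); first exact: poly_leX1.
by rewrite exp_seriesZX; apply: (uabs_exp_critical um pp vp).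
Qed.

(* Artin-Schreier: writing exp(x g) = 1 + x u, the two expansions of
   exp(x g)^p = exp(p x g) give u - u^p = g modulo the maximal ideal. *)
Lemma artin_schreier_congruence (g u : {poly F}) n N :
  g`_0 = 0 -> poly_le v 1 g -> (n < N)%N ->
  (forall i, u`_i = if (0 < i < N)%N then exp_series (x *: g) i / x else 0) ->
  v (u - u ^+ p - g)`_n <= v x.
Proof.
move=> g0 hg hn hu.
have u1 : poly_le v 1 u.
  move=> i; rewrite hu; case: ifP => [/andP[i0 _]|_]; last by rewrite uabs0.
  by rewrite (uabsM um) uabsV // ler_pdivrMr // mul1r exp_scale_le.
(* [B] is the size of p x^2. It bounds the middle binomial terms and the terms of exp(p x g) of
   order at least 2; dividing by p x then leaves |x|. *)
pose B := p%:R^-1 * v x ^+ 2 : R.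
have B0 : 0 <= B by rewrite mulr_ge0 ?exprn_ge0 // ltW.
have trunc : \poly_(i < N) exp_series (x *: g) i = 1 + x *: u.
  apply/polyP => i; rewrite coef_poly coefD coef1 coefZ hu.
  case: i => [|i] /=; first by rewrite (leq_ltn_trans _ hn) // exp_series_coef0 // mulr0 addr0.
  by case: ifP => _; rewrite ?mulr0 ?addr0 // mulrC divfK ?add0r.
have lhs : v (((1 + x *: u) ^+ p)`_n - (1 + (p%:R * x) *: u + x ^+ p *: u ^+ p)`_n) <= B.
  rewrite exprD1_split ?prime_gt1 // -scaler_nat scalerA exprZn.
  rewrite -coefB [_ + \sum_(i < _) _]addrC addrK.
  suff /(_ n) : poly_le v B (\sum_(i < p.-2) (x *: u) ^+ i.+2 *+ 'C(p, i.+2)) by [].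
  apply: (poly_le_sum um) => // i _.
  have /dvdnP[c ->] : (p %| 'C(p, i.+2))%N.
    by apply: prime_dvd_bin => //=; have := ltn_ord i; lia.
  rewrite mulrnA exprZn scalerMnr -[X in poly_le _ _ X]scaler_nat scalerA.
  rewrite -[B]mulr1; apply: (poly_leZ um); last by apply/poly_leMn/poly_leX1.
  rewrite /B -vp; apply: (uabsMle um) => //.
  by apply: (uabsX_leX um); rewrite // ltW.
have rhs : v (exp_series ((x *: g) *+ p) n - (1 + (p%:R * x) *: g)`_n) <= B.
  have xg0 : ((x *: g) *+ p)`_0 = 0 by rewrite coefMn coefZ g0 mulr0 mul0rn.
  rewrite (exp_series_widen xg0 (_ : (n < n.+3)%N)) //; last by lia.
  rewrite 2!big_ord_recl /=; set S := \sum_(i < _) _.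
  rewrite (_ : _ - _ = S); last first.
    rewrite expr0 expr1 !divr1 coefD coefMn !coefZ -[_ *+ p]mulr_natr.
    by move: (p%:R) => a; ring.
  rewrite {}/S.
  apply: (uabs_sum_le um) => // i _; rewrite /bump /= !add1n.
  rewrite -scaler_nat scalerA exprZn coefZ mulrAC mulrC.
  apply: (uabsM_le1 um); first exact: poly_leX1.
  rewrite exprMn mulrAC; apply: (uabsMle um); first exact: (uabs_expX_fact um pp vp).
  by apply: (uabsX_leX um); rewrite // ltW.
have eq : ((1 + x *: u) ^+ p)`_n = exp_series ((x *: g) *+ p) n.
  by rewrite -trunc (exp_seriesMn f0) // coefZ g0 mulr0.
have px0 : 0 < v (p%:R * x) by rewrite (uabsM um) vp mulr_gt0.
rewrite -(ler_pM2l px0) -(uabsM um).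
have -> : v (p%:R * x) * v x = B by rewrite (uabsM um) vp -mulrA -expr2.
have -> : p%:R * x * (u - u ^+ p - g)`_n =
   (exp_series ((x *: g) *+ p) n - (1 + (p%:R * x) *: g)`_n)
   - (((1 + x *: u) ^+ p)`_n - (1 + (p%:R * x) *: u + x ^+ p *: u ^+ p)`_n)
   - (x ^+ p + p%:R * x) * (u ^+ p)`_n.
  rewrite eq !(coefN, coefD, coefZ).
  move: (exp_series _ _) (p%:R * x) (x ^+ p) ((u ^+ p)`_n) => E a b c; ring.
apply: (uabsB_le um); first exact: (uabsB_le um).
by rewrite mulrC; apply: (uabsM_le1 um); first exact: poly_leX1.
Qed.

(** Geometric decay makes the coefficients of (exp(x g) - 1) / x eventually smaller than 1, so their
    reductions form a polynomial. Each coefficient of the equation is then checked on a long enough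
    truncation. *)
Lemma artin_schreier_polynomial (g : {poly F}) (gb : {poly k}) :
  red_rel v H red g gb -> g`_0 = 0 -> (forall n, H (exp_series (x *: g) n)) ->
  geometric v (exp_series (x *: g)) ->
  exists u : {poly k}, u`_0 = 0 /\ u ^+ p - u = gb.
Proof.
move=> hg g0 Hc [r [M [r0 r1 M0 hc]]].
have g1 := red_rel_poly_le hg.
have [N0 hN0] := expX_dominates M r0 r1 vx0.
pose c n := exp_series (x *: g) n / x.
have cO n : (0 < n)%N -> integers v H (c n).
  move=> n0; split; first exact: (subringM H_sub).
  by rewrite (uabsM um) (uabsV um) ler_pdivrMr // mul1r exp_scale_le.
pose U N : {poly F} := \poly_(i < N) (if (0 < i)%N then c i else 0).
pose ub : {poly k} := \poly_(i < N0) (if (0 < i)%N then red (c i) else 0).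
have O0 := integers0 um H_sub; have r00 := red0 um res H_sub.
have hU N : (N0 <= N)%N -> red_rel v H red (U N) ub.
  move=> hN i; rewrite !coef_poly; case: (posnP i) => [->|i0]; first by rewrite !if_same.
  have ci := cO i i0; case: (ltnP i N0) => hi.
    by rewrite (leq_trans hi hN).
  case: ifP => // _; split=> //; apply/(red_ker res ci).
  by rewrite (uabsM um) (uabsV um) ltr_pdivrMr // mul1r (le_lt_trans (hc i)) // hN0.
have ub_eq : ub - ub ^+ p = gb.
  apply/eqP; rewrite -subr_eq0; apply/eqP/polyP => n; rewrite coef0.
  pose N := maxn N0 n.+1.
  have hUN := hU N (leq_maxl _ _).
  have [i1 <-] := red_relD um res H_sub
    (red_relD um res H_sub hUN (red_relN um res H_sub (red_relX um res H_sub p hUN)))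
    (red_relN um res H_sub hg) n.
  apply/(red_ker res i1); apply: le_lt_trans x_lt1.
  apply: (artin_schreier_congruence (N := N)) => //; first exact: leq_maxr.
  by move=> i; rewrite coef_poly; case: ltnP; case: (0 < i)%N.
(* The congruence yields u - u^p; the change of sign uses (-1)^p = -1, which holds in characteristic
   p also for p = 2. *)
exists (- ub); split; first by rewrite coefN coef_poly if_same oppr0.
have pk : (p%:R : {poly k}) = 0 by rewrite -polyC1 -polyCMn char_residue polyC0.
have [z _] := @congr_mod_int {poly k} (fun=> True) p pp I (fun _ _ => I) (fun _ _ _ _ => I)
  (fun _ _ _ _ => I) (-1).
rewrite -[z *+ p]mulr_natr pk mulr0 addr0 => N1.
by rewrite exprNn N1 mulN1r opprK addrC.
Qed.

End ArtinSchreier.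

(** * Exponentials of Witt vectors *)

Section WittExponentials.
Context (R : realType) (p : nat) (p_prime : prime p).
Context (Qp K : fieldType) (Kalg : closedFieldType).
Context (absQ : Qp -> R) (absK : K -> R) (abs : Kalg -> R).
Context (jQ : {rmorphism Qp -> K}) (jK : {rmorphism K -> Kalg}).
Hypotheses (Qp_padic : is_padic_field p absQ).
Hypotheses (absK_um : ultrametric_abs absK) (K_complete : abs_complete absK).
Hypothesis jQ_isom : forall x, absK (jQ x) = absQ x.
Hypotheses (abs_um : ultrametric_abs abs) (jK_isom : forall x, abs (jK x) = absK x).
Hypothesis Kalg_alg : forall x, algebraicOver jK x.
Context (P : nat -> Qp) (P_LT : lubin_tate_series p absQ P).
Context (pi : nat -> Kalg) (pi_gen : tate_generator abs (jK \o jQ) P pi).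
Context (s : nat) (ks : fieldType) (red : Kalg -> ks).
Hypothesis ks_res : residue_field abs (adjoin jK (pi s)) red.

Local Notation Ks := (adjoin jK (pi s)).
Local Notation O := (integers abs Ks).
Local Notation wvec := {ffun 'I_s.+1 -> {poly Kalg}}.
Local Notation e := (@artin_hasse_exp Kalg p s pi).
Local Notation rel := (red_rel abs Ks red).
Local Notation good := (good_log abs).

Implicit Types f g N : wvec.

Let iota : {rmorphism Qp -> Kalg} := jK \o jQ.

Let iota_isom x : abs (iota x) = absQ x.
Proof. by rewrite /= jK_isom jQ_isom. Qed.

Let pi_gen' : tate_generator abs iota P pi := pi_gen.
Let vp : abs p%:R = p%:R^-1 := iota_vp Qp_padic iota_isom.
Let p0 : (p%:R : Kalg) != 0.
Proof. by apply: (uabs_nat_neq0 abs_um p_prime vp); apply: prime_gt0. Qed.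
Let pX0 : (p%:R : {poly Kalg}) != 0.
Proof. by rewrite -polyC1 -polyCMn polyC_eq0. Qed.
Let f0 := fact_neq0 abs_um p_prime vp.

Let Ks_sub : subring_pred Ks.
Proof.
split=> [|x|x y|x y]; [exact: (adjoin_nat jK (pi s) 1)|exact: adjoinN|
  exact: adjoinD|exact: adjoinM].
Qed.

Lemma pi_in_Ks j : (j <= s)%N -> Ks (pi j).
Proof.
move=> hj; rewrite -(subKn hj); elim: (s - j)%N (leq_subr j s) => [|i IH] hi.
  by rewrite subn0; apply: adjoin_gen.
have {IH} := IH (ltnW hi); set y := pi (s - i)%N => hy.
apply: (adjoin_closed absK_um K_complete abs_um jK_isom Kalg_alg) => d d0.
have := tate_step pi_gen' (s - i.+1) d0.
rewrite -subSn // subSS -/y => -[N hN].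
exists (\sum_(l < N) iota (P l) * y ^+ l); last first.
  by rewrite uabs_subC //; apply: hN.
by apply: adjoin_sum => l _; apply: adjoinM; [exact: adjoinC|exact: adjoinX].
Qed.

Lemma expr_in_Ks (g : {poly Kalg}) l n : (forall i, Ks g`_i) -> Ks (g ^+ l)`_n.
Proof.
move=> hg; elim: l n => [|l IH] n; first by rewrite expr0 coef1; apply: adjoin_nat.
by rewrite exprS coefM; apply: adjoin_sum => q _; apply: adjoinM.
Qed.

Lemma exp_in_Ks (g : {poly Kalg}) n : (forall i, Ks g`_i) -> Ks (exp_series g n).
Proof.
move=> hg; apply: adjoin_sum => m _; apply: adjoinM; last exact/adjoinV/adjoin_nat.
exact: expr_in_Ks.
Qed.

Lemma witt_log_in_Ks m (f : nat -> {poly Kalg}) : (m <= s)%N ->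
  (forall i k, Ks (f i)`_k) -> forall k, Ks (witt_log p pi m f)`_k.
Proof.
move=> hm hf k; rewrite coef_sum; apply: adjoin_sum => j _.
rewrite coefZ; apply: adjoinM.
  apply: adjoinM; last exact/adjoinV/adjoin_nat.
  rewrite /pi_down; case: ifP => _; last exact: (adjoin_nat jK (pi s) 0).
  by apply: pi_in_Ks; apply: leq_trans (leq_subr _ _) hm.
rewrite ghostE coef_sum; apply: adjoin_sum => i _.
rewrite coefMn -mulr_natr; apply: adjoinM; last exact: adjoin_nat.
exact: expr_in_Ks.
Qed.

Definition wvec_log m (f : wvec) := witt_log p pi m (f \o inord).

Lemma artin_hasse_expE f : e f = exp_series (wvec_log s f).
Proof.
rewrite /artin_hasse_exp; congr exp_series; apply: eq_bigr => j _.
have hj : (j <= s)%N by rewrite -ltnS.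
by rewrite witt_phantomE // /pi_down hj.
Qed.

Lemma wvec_log_coef0 m f : (forall i, (f i)`_0 = 0) -> (wvec_log m f)`_0 = 0.
Proof.
move=> h0; rewrite /wvec_log (witt_logE p_prime Qp_padic abs_um iota_isom).
rewrite coef_sum big1 // => i _; apply: comp_poly_coef0; last exact: h0.
exact: lt_log_coef0.
Qed.

Lemma wvec_log_sub m f g : (m <= s)%N -> wvec_log m (witt_sub p f g) = wvec_log m f - wvec_log m g.
Proof.
move=> hm; rewrite /wvec_log /witt_log -sumrB; apply: eq_bigr => j _.
by rewrite ghost_witt_sub ?scalerBr //; apply: leq_trans hm; rewrite -ltnS.
Qed.

Lemma exp_quotient f g : (forall i, (f i)`_0 = 0) -> (forall i, (g i)`_0 = 0) ->
  is_series_quotient (e f) (e g) (e (witt_sub p f g)).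
Proof.
move=> hf hg; rewrite !artin_hasse_expE; split.
  by rewrite exp_series_coef0 oner_neq0.
move=> n; rewrite -[LHS]/(series_mul _ _ n) -exp_seriesD ?wvec_log_coef0 //; last first.
  by move=> i; apply: (witt_sub_coef0 p_prime p0).
by rewrite wvec_log_sub // subrK.
Qed.

Definition overconvergent (c : nat -> Kalg) :=
  (exists2 eps : R, 0 < eps & analytic_on abs Ks `]1 - eps, +oo[ (laurent_neg c)) /\
  in_robba_ext absK jK Ks (laurent_neg c).

Lemma geometric_overconvergent c : (forall n, Ks (c n)) -> geometric abs c ->
  overconvergent c.
Proof.
move=> hK hc; split.
  by apply: (geometric_analytic abs_um) => //; exact: (adjoin_nat jK (pi s) 0).
exact: (geometric_robba_ext absK_um K_complete abs_um jK_isom Kalg_alg).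
Qed.

Lemma exp_overconvergent (f : wvec) : (forall i k, Ks (f i)`_k) ->
  geometric abs (exp_series (wvec_log s f)) -> overconvergent (e f).
Proof.
move=> hf; rewrite artin_hasse_expE; apply: geometric_overconvergent => n.
by apply/exp_in_Ks/witt_log_in_Ks => // i; apply: hf.
Qed.

Section SameReduction.
Context (f g : wvec) (c : {ffun 'I_s.+1 -> {poly ks}}).
Hypotheses (f_red : forall i, rel (f i) (c i)) (g_red : forall i, rel (g i) (c i)).
Hypotheses (f_0 : forall i, (f i)`_0 = 0) (g_0 : forall i, (g i)`_0 = 0).

Lemma good_wvec_log_sub m : (m <= s)%N -> good (wvec_log m f - wvec_log m g).
Proof.
move=> hm; rewrite -wvec_log_sub //.
apply: (good_witt_log_small p_prime Qp_padic abs_um iota_isom P_LT pi_gen') => i _.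
split; first exact: (witt_sub_coef0 p_prime p0).
exact: (witt_sub_small abs_um ks_res Ks_sub p_prime p0 _ f_red g_red).
Qed.

End SameReduction.

Lemma witt_sub_in_Ks f g (a b : {ffun 'I_s.+1 -> {poly ks}}) i k :
  (forall i, rel (f i) (a i)) -> (forall i, rel (g i) (b i)) -> Ks (witt_sub p f g i)`_k.
Proof.
move=> hf hg.
by have [[]] := witt_sub_red_rel abs_um ks_res Ks_sub p_prime i hf hg k.
Qed.

Definition powp (f : wvec) : wvec := [ffun i => f i ^+ p].

Lemma powp_red f (c : {ffun 'I_s.+1 -> {poly ks}}) : (forall i, rel (f i) (c i)) ->
  forall i, rel (powp f i) (witt_frob p c i).
Proof. by move=> h i; rewrite !ffunE; apply: (red_relX abs_um ks_res Ks_sub). Qed.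

Lemma powp_coef0 f : (forall i, (f i)`_0 = 0) -> forall i, (powp f i)`_0 = 0.
Proof. by move=> h i; rewrite ffunE coef_expr_small ?prime_gt0. Qed.

Lemma wvec_log_powp m f : wvec_log m (powp f) = witt_log p pi m (fun i => f (inord i) ^+ p).
Proof.
by apply: eq_bigr => j _; congr (_ *: _); apply: eq_ghost => i _; rewrite /= ffunE.
Qed.

Lemma good_wvec_log_powp m f : (forall i, (f i)`_0 = 0) -> (forall i, poly_le abs 1 (f i)) ->
  good (wvec_log m (powp f) - wvec_log m f).
Proof.
move=> h0 h1; rewrite wvec_log_powp.
exact: (good_witt_log_frobenius p_prime Qp_padic abs_um iota_isom P_LT pi_gen').
Qed.

Lemma residual_lift (nu : {ffun 'I_s.+1 -> {poly ks}}) : (forall i, (nu i)`_0 = 0) ->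
  exists N : wvec, (forall i, rel (N i) (nu i)) /\ forall i, (N i)`_0 = 0.
Proof.
move=> h0; have step i : exists h : {poly Kalg}, rel h (nu i) /\ h`_0 = 0.
  by have [g ? ?] := red_rel_lift abs_um ks_res Ks_sub (h0 i); exists g.
have [N hN] := boolp.choice step.
by exists [ffun i => N i]; split=> i; rewrite ffunE; case: (hN i).
Qed.

(** Lift nu to N. Then f and the Witt difference of [powp N] and [N] have the same reduction, and
    the logarithm of that difference is a Frobenius quotient, hence good. *)
Lemma frobenius_sub_overconvergent (f : wvec) (nu : {ffun 'I_s.+1 -> {poly ks}}) :
  (forall i, rel (f i) (witt_sub p (witt_frob p nu) nu i)) -> (forall i, (f i)`_0 = 0) ->
  (forall i, (nu i)`_0 = 0) -> geometric abs (exp_series (wvec_log s f)).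
Proof.
move=> hf f_0 /residual_lift [N [hN N_0]].
have hG i : rel (witt_sub p (powp N) N i) (witt_sub p (witt_frob p nu) nu i).
  by apply: (witt_sub_red_rel abs_um ks_res Ks_sub p_prime) => //; apply: powp_red.
have G_0 i : (witt_sub p (powp N) N i)`_0 = 0.
  by apply: (witt_sub_coef0 p_prime p0) => //; apply: powp_coef0.
have [_ h _] : good (wvec_log s f); last by [].
rewrite -(subrK (wvec_log s (witt_sub p (powp N) N)) (wvec_log s f)).
apply: (good_logD abs_um f0).
  exact: (good_wvec_log_sub (g := witt_sub p (powp N) N)
    (c := witt_sub p (witt_frob p nu) nu) hf hG f_0 G_0 (leqnn s)).
rewrite wvec_log_sub //; apply: good_wvec_log_powp => // i.
exact: red_rel_poly_le (hN i).
Qed.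

Lemma red_rel_inj (x : {poly Kalg}) y z : rel x y -> rel x z -> y = z.
Proof.
move=> h1 h2; rewrite -(red_rel_eq abs_um ks_res Ks_sub h1).
exact: (red_rel_eq abs_um ks_res Ks_sub h2).
Qed.

(** The component of index m enters level m only through [lt_log] at level 0, which is pi_0 X. *)
Lemma wvec_log_top (m : 'I_s.+1) f g : (forall i : 'I_s.+1, (i < m)%N -> f i = g i) ->
  wvec_log m f - wvec_log m g = pi 0%N *: (f m - g m).
Proof.
move=> hfg; rewrite /wvec_log !(witt_logE p_prime Qp_padic abs_um iota_isom).
rewrite !big_ord_recr /= inord_val subnn.
rewrite (eq_bigr (fun i : 'I_m => lt_log p pi (m - i) \Po g (inord i))) => [|i _].
  rewrite opprD addrACA subrr add0r /lt_log /seq_log big_ord1 /pi_down /= expn0 divr1 expr1.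
  by rewrite !comp_polyZ !comp_polyX scalerBr.
by rewrite hfg // inordK // (ltn_trans (ltn_ord i)).
Qed.

Section LastComponent.
Context (m : 'I_s.+1) (f : wvec) (c nu : {ffun 'I_s.+1 -> {poly ks}}).
Hypotheses (f_red : forall i, rel (f i) (c i)) (f_0 : forall i, (f i)`_0 = 0).
Hypothesis f_geom : geometric abs (exp_series (wvec_log m f)).
Hypotheses (nu_0 : forall i, (nu i)`_0 = 0)
  (nu_sol : forall i : 'I_s.+1, (i < m)%N -> witt_sub p (witt_frob p nu) nu i = c i).

Let cut (A : nmodType) (w : {ffun 'I_s.+1 -> A}) (z : A) : {ffun 'I_s.+1 -> A} :=
  [ffun i : 'I_s.+1 => if (i < m)%N then w i else z].

(** Replacing nu_m by an unknown a changes the m-th component of F(nu) - nu by a^p - a and no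
    earlier one. Dividing the exponential of f by that of an overconvergent vector equal to f below
    m leaves exp(pi_0 g), from which [artin_schreier_polynomial] produces a. *)
Lemma frobenius_sub_extend : exists nu' : {ffun 'I_s.+1 -> {poly ks}},
  (forall i, (nu' i)`_0 = 0) /\
  forall i : 'I_s.+1, (i <= m)%N -> witt_sub p (witt_frob p nu') nu' i = c i.
Proof.
have [N [hN N_0]] := residual_lift nu_0.
have cut_red A a : rel A a -> forall i, rel (cut N A i) (cut nu a i).
  by move=> h i; rewrite !ffunE; case: ifP.
have cut_0 (A : {poly Kalg}) : A`_0 = 0 -> forall i, (cut N A i)`_0 = 0.
  by move=> h i; rewrite ffunE; case: ifP.
pose G (A : {poly Kalg}) : wvec := witt_sub p (powp (cut N A)) (cut N A).
have G_red A a : rel A a -> forall i,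
    rel (G A i) (witt_sub p (witt_frob p (cut nu a)) (cut nu a) i).
  move=> h i; apply: (witt_sub_red_rel abs_um ks_res Ks_sub p_prime); last exact: cut_red.
  exact/powp_red/cut_red.
have G_0 (A : {poly Kalg}) : A`_0 = 0 -> forall i, (G A i)`_0 = 0.
  move=> h i; apply: (witt_sub_coef0 p_prime p0); last exact: cut_0.
  exact/powp_coef0/cut_0.
have G_low A (i : 'I_s.+1) : (i < m)%N -> G A i = witt_sub p (powp N) N i.
  move=> hi; apply: (witt_sub_prefix p_prime pX0 (n := m) _ _).1 => // j hj.
    by rewrite !ffunE hj.
  by rewrite ffunE hj.
have G_low_red A (i : 'I_s.+1) : (i < m)%N -> rel (G A i) (c i).
  move=> hi; rewrite G_low // -nu_sol //.
  by apply: (witt_sub_red_rel abs_um ks_res Ks_sub p_prime) => //; apply: powp_red.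
(* The dependence on the unknown is computed on lifts, where [witt_sub_prefix] applies, and is
   reduced at the end. *)
have G_top A : G A m = G 0 m + (A ^+ p - A).
  have := (witt_sub_prefix p_prime pX0 (n := m) (a := powp (cut N A)) (b := cut N A)
    (a' := powp (cut N 0)) (b' := cut N 0) _ _).2.
  rewrite -/(G A) -/(G 0) !ffunE !ltnn expr0n (gtn_eqF (prime_gt0 p_prime)) subrr subr0.
  move=> h; rewrite -{}h ?subrK // => i hi; by rewrite !ffunE hi.
have rel0 : rel 0 0 by exact: (red_rel0 abs_um ks_res Ks_sub).
have c00 : (0 : {poly Kalg})`_0 = 0 by rewrite coef0.
(* [D] shares its components below m with f, so that only the last one survives in the quotient, and
   shares its reduction with the Frobenius difference [G 0], so that its logarithm is good. *)
pose D : wvec := [ffun i : 'I_s.+1 => if (i < m)%N then f i else G 0 i].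
pose Gb := witt_sub p (witt_frob p (cut nu 0)) (cut nu 0).
have D_red i : rel (D i) (Gb i).
  rewrite ffunE; case: ifP => hi; last exact: G_red.
  by rewrite (red_rel_inj (G_red 0 0 rel0 i) (G_low_red 0 i hi)).
have D_0 i : (D i)`_0 = 0 by rewrite ffunE; case: ifP => // _; apply: G_0.
have ms : (m <= s)%N by rewrite -ltnS.
have [D00 _ D_good] : good (wvec_log m D).
  rewrite -(subrK (wvec_log m (G 0)) (wvec_log m D)).
  apply: (good_logD abs_um f0).
    exact: (good_wvec_log_sub (g := G 0) (c := Gb) D_red (G_red 0 0 rel0) D_0 (G_0 0 c00) ms).
  rewrite wvec_log_sub //; apply: good_wvec_log_powp; first exact: cut_0.
  by move=> i; apply: red_rel_poly_le (cut_red 0 0 rel0 i).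
have top : wvec_log m f - wvec_log m D = pi 0%N *: (f m - G 0 m).
  by rewrite wvec_log_top => [|i hi]; rewrite [D _]ffunE ?ltnn ?hi.
have g_red : rel (f m - G 0 m) (c m - Gb m).
  apply: (red_relD abs_um ks_res Ks_sub); first exact: f_red.
  by apply: (red_relN abs_um ks_res Ks_sub); apply: G_red.
have g_0 : (f m - G 0 m)`_0 = 0 by rewrite coefB f_0 G_0 // subr0.
have [||a [a_0 ha]] := artin_schreier_polynomial abs_um ks_res Ks_sub p_prime vp
   (pi_neq0 abs_um P_LT pi_gen' 0) (tate_lt1 pi_gen' 0) (adjoinV (pi_in_Ks (leq0n s)))
   (pi0_critical p_prime Qp_padic abs_um iota_isom P_LT pi_gen')
   (pi0_power p_prime Qp_padic abs_um iota_isom P_LT pi_gen') g_red g_0.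
- move=> n; apply: exp_in_Ks => i; rewrite coefZ; apply: adjoinM; first exact/pi_in_Ks.
  by have [[]] := g_red i.
- rewrite -top; apply: (geometric_expD abs_um f0) => //; first exact: wvec_log_coef0.
  by rewrite coefN D00 oppr0.
have [A hA A_0] := red_rel_lift abs_um ks_res Ks_sub a_0.
exists (cut nu a); split=> [i|i]; first by rewrite ffunE; case: ifP.
rewrite leq_eqVlt => /orP[/eqP im|hi].
  have -> : i = m by apply: val_inj.
  apply: red_rel_inj (G_red A a hA m) _; rewrite G_top.
  have -> : c m = Gb m + (a ^+ p - a) by rewrite ha addrC subrK.
  apply: (red_relD abs_um ks_res Ks_sub); first exact: G_red.
  apply: (red_relD abs_um ks_res Ks_sub); first exact: (red_relX abs_um ks_res Ks_sub).
  exact: (red_relN abs_um ks_res Ks_sub).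
exact: red_rel_inj (G_red A a hA i) (G_low_red A i hi).
Qed.

End LastComponent.

(** Overconvergence descends from level m + 1 to level m, while the solution is built upwards, one
    component at a time, starting from 0. *)
Lemma overconvergent_frobenius_sub (m : nat) f (c : {ffun 'I_s.+1 -> {poly ks}}) :
  (m <= s)%N -> (forall i, rel (f i) (c i)) -> (forall i, (f i)`_0 = 0) ->
  geometric abs (exp_series (wvec_log m f)) ->
  exists nu : {ffun 'I_s.+1 -> {poly ks}}, (forall i, (nu i)`_0 = 0) /\
    forall i : 'I_s.+1, (i <= m)%N -> witt_sub p (witt_frob p nu) nu i = c i.
Proof.
move=> hm hf f_0.
have f_1 i : poly_le abs 1 (f i) by exact: red_rel_poly_le (hf i).
elim: m hm => [|m IH] hm hg.
  have := @frobenius_sub_extend ord0 f c [ffun=> 0] hf f_0 hg.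
  by apply=> // i; rewrite ffunE coef0.
have [|nu [nu_0 nu_sol]] := IH (ltnW hm).
  by apply: (geometric_witt_log_pred p_prime Qp_padic abs_um iota_isom P_LT pi_gen') hg => i;
    [apply: f_0 | apply: f_1].
have := @frobenius_sub_extend (Ordinal (hm : (m.+1 < s.+1)%N)) f c nu hf f_0 hg nu_0.
exact.
Qed.

Lemma in_neg_red_rel f : witt_in (in_neg O) f -> forall i, rel (f i) (witt_red red f i).
Proof.
by move=> hf i; rewrite ffunE; apply: (red_rel_map abs_um ks_res Ks_sub); case: (hf i).
Qed.

Lemma in_neg_coef0 f : witt_in (in_neg O) f -> forall i, (f i)`_0 = 0.
Proof. by move=> hf i; case: (hf i). Qed.

Lemma same_reduction_overconvergent f g : witt_in (in_neg O) f -> witt_in (in_neg O) g ->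
  witt_red red g = witt_red red f ->
  is_series_quotient (e f) (e g) (e (witt_sub p f g)) /\
  overconvergent (e (witt_sub p f g)).
Proof.
move=> hf hg gf; have f_0 := in_neg_coef0 hf; have g_0 := in_neg_coef0 hg.
have f_red := in_neg_red_rel hf; have g_red := in_neg_red_rel hg.
split; first exact: exp_quotient.
apply: exp_overconvergent => [i l|]; first exact: witt_sub_in_Ks f_red g_red.
rewrite wvec_log_sub //; rewrite gf in g_red.
by have [] := good_wvec_log_sub (f := f) (g := g) (c := witt_red red f)
  f_red g_red f_0 g_0 (leqnn s).
Qed.

Lemma frobenius_lift_overconvergent f g : witt_in (in_neg O) f -> witt_in (in_neg O) g ->
  witt_red red g = witt_frob p (witt_red red f) ->
  is_series_quotient (e g) (e f) (e (witt_sub p g f)) /\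
  overconvergent (e (witt_sub p g f)).
Proof.
move=> hf hg gf; have f_0 := in_neg_coef0 hf; have g_0 := in_neg_coef0 hg.
have f_red := in_neg_red_rel hf; have g_red := in_neg_red_rel hg.
split; first exact: exp_quotient.
apply: exp_overconvergent => [i l|]; first exact: witt_sub_in_Ks g_red f_red.
(* The vector [powp f] is intermediate: it has the same reduction as g, and its logarithm differs
   from that of f by a Frobenius quotient. *)
rewrite wvec_log_sub // -(subrK (wvec_log s (powp f)) (wvec_log s g)) -addrA.
rewrite gf in g_red.
have [] // := good_logD abs_um f0
  (good_wvec_log_sub (f := g) (g := powp f) (c := witt_frob p (witt_red red f))
     g_red (powp_red f_red) g_0 (powp_coef0 f_0) (leqnn s))
  (good_wvec_log_powp s f_0 (fun i => red_rel_poly_le (f_red i))).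
Qed.

Lemma robba_iff_frobenius_sub f : witt_in (in_neg O) f ->
  in_robba_ext absK jK Ks (laurent_neg (e f)) <->
  exists nu : {ffun 'I_s.+1 -> {poly ks}},
    witt_in (in_neg (fun=> True)) nu /\ witt_sub p (witt_frob p nu) nu = witt_red red f.
Proof.
move=> hf; have f_0 := in_neg_coef0 hf; have f_red := in_neg_red_rel hf.
split=> [/(robba_ext_geometric abs_um jK_isom)|[nu [hnu nu_sol]]].
  rewrite artin_hasse_expE => hgeo.
  have [nu [nu_0 hnu]] :=
    overconvergent_frobenius_sub (c := witt_red red f) (leqnn s) f_red f_0 hgeo.
  exists nu; split=> [i|]; first by split.
  by apply/ffunP => i; apply: hnu; rewrite -ltnS.
suff [_ //] : overconvergent (e f).
apply: exp_overconvergent => [i l|]; first by have [[]] := f_red i l.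
apply: (frobenius_sub_overconvergent (nu := nu)) => [i||i] //; first by rewrite nu_sol.
by case: (hnu i).
Qed.

End WittExponentials.

Theorem theorem3p6 (R : realType) (p : nat) (p_prime : prime p)
    (* Q_p, the complete field K containing it, an algebraic closure of K *)
    (Qp K : fieldType) (Kalg : closedFieldType)
    (absQ : Qp -> R) (absK : K -> R) (abs : Kalg -> R)
    (jQ : {rmorphism Qp -> K}) (jK : {rmorphism K -> Kalg})
    (Qp_padic : is_padic_field p absQ)
    (absK_um : ultrametric_abs absK) (K_complete : abs_complete absK)
    (jQ_isom : forall x, absK (jQ x) = absQ x)
    (abs_um : ultrametric_abs abs) (jK_isom : forall x, abs (jK x) = absK x)
    (Kalg_alg : forall x, algebraicOver jK x)
    (* the Lubin-Tate series and the generator of its Tate module *)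
    (P : nat -> Qp) (P_LT : lubin_tate_series p absQ P)
    (pi : nat -> Kalg) (pi_gen : tate_generator abs (jK \o jQ) P pi)
    (s : nat)
    (* the residue field of K_s = K(pi_s) *)
    (ks : fieldType) (red : Kalg -> ks)
    (ks_res : residue_field abs (adjoin jK (pi s)) red)
    (f : {ffun 'I_s.+1 -> {poly Kalg}}) :
  let Ks := adjoin jK (pi s) in
  let O := integers abs Ks in
  let e := @artin_hasse_exp Kalg p s pi in
  let overconvergent (c : nat -> Kalg) :=
    (exists2 eps : R, 0 < eps &
       analytic_on abs Ks `]1 - eps, +oo[ (laurent_neg c)) /\
    in_robba_ext absK jK Ks (laurent_neg c) in
  witt_in (in_neg O) f ->
  [/\ forall f' : {ffun 'I_s.+1 -> {poly Kalg}},
        witt_in (in_neg O) f' -> witt_red red f' = witt_red red f ->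
        is_series_quotient (e f) (e f') (e (witt_sub p f f')) /\
        overconvergent (e (witt_sub p f f')),
      forall fF : {ffun 'I_s.+1 -> {poly Kalg}},
        witt_in (in_neg O) fF ->
        witt_red red fF = witt_frob p (witt_red red f) ->
        is_series_quotient (e fF) (e f) (e (witt_sub p fF f)) /\
        overconvergent (e (witt_sub p fF f))
    & in_robba_ext absK jK Ks (laurent_neg (e f)) <->
      exists nu : {ffun 'I_s.+1 -> {poly ks}},
        witt_in (in_neg (fun=> True)) nu /\
        witt_sub p (witt_frob p nu) nu = witt_red red f].
Proof.
move=> Ks O e oc hf; split=> [f' hf' ff'|fF hF fFf|].
- exact: (same_reduction_overconvergent p_prime Qp_padic absK_um K_complete jQ_isom
    abs_um jK_isom Kalg_alg P_LT pi_gen ks_res hf hf' ff').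
- exact: (frobenius_lift_overconvergent p_prime Qp_padic absK_um K_complete jQ_isom
    abs_um jK_isom Kalg_alg P_LT pi_gen ks_res hf hF fFf).
- exact: (robba_iff_frobenius_sub p_prime Qp_padic absK_um K_complete jQ_isom
    abs_um jK_isom Kalg_alg P_LT pi_gen ks_res hf).
Qed.
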